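(* Let $(\pi,N)$ be a Poisson-Nijenhuis structure on a Lie algebroid $(A,[\cdot,\cdot],\rho)$. Then $\underline N+\pi$ is a weak Nijenhuis vector valued form with curvature, with respect to the multiplicative differential graded Lie algebra structure $l_1^{[\cdot,\cdot],\pi}+l_2^{[\cdot,\cdot]}$ on the graded vector space $\Gamma(\wedge A)[2]$.
   Context: Let $(A,\mu=[\cdot,\cdot],\rho)$ be a Lie algebroid over $M$. $\Gamma(\wedge A)[2]$ is $\Gamma(\wedge A)$ graded so that $\Gamma(\wedge^pA)$ has degree $p-2$ (so $\pi\in\Gamma(\wedge^2A)$ is a vector valued $0$-form of degree zero). $[\cdot,\cdot]_{_{SN}}$ is the Schouten-Nijenhuis bracket: it extends the Lie bracket, $[X,f]_{_{SN}}=\rho(X)f$, $[P,Q]_{_{SN}}=-(-1)^{(p-1)(q-1)}[Q,P]_{_{SN}}$, $[P,Q\wedge R]_{_{SN}}=[P,Q]_{_{SN}}\wedge R+(-1)^{(p-1)q}Q\wedge[P,R]_{_{SN}}$. $l_1^{[\cdot,\cdot],\pi}(P)=[\pi,P]_{_{SN}}$ and $l_2^{[\cdot,\cdot]}(P,Q)=(-1)^{p-1}[P,Q]_{_{SN}}$ for $P\in\Gamma(\wedge^pA)$. For a $(1,1)$-tensor $N:A\to A$: $[X,Y]_N=[NX,Y]+[X,NY]-N[X,Y]$; $N$ is Nijenhuis if $[NX,NY]=N[X,Y]_N$; then $(A,\mu^N=[\cdot,\cdot]_N,\rho\circ N)$ is a Lie algebroid. $N^*:A^*\to A^*$ is the transpose;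 $\pi^\#:A^*\to A$ is given by $\langle\beta,\pi^\#\alpha\rangle=\pi(\alpha,\beta)$; $\{\alpha,\beta\}_\pi^\mu=\mathcal L^A_{\pi^\#\alpha}\beta-\mathcal L^A_{\pi^\#\beta}\alpha-d^A(\pi(\alpha,\beta))$ for $\alpha,\beta\in\Gamma(A^* )$. $(\pi,N)$ is a Poisson-Nijenhuis structure if $N$ is Nijenhuis, $[\pi,\pi]_{_{SN}}=0$, $N\circ\pi^\#=\pi^\#\circ N^*$, and $(\{\alpha,\beta\}_\pi^\mu)_{N^*}=\{\alpha,\beta\}_\pi^{\mu^N}$ for all $\alpha,\beta$, where $(\cdot)_{N^*}$ denotes deformation of the bracket by $N^*$ and the right side is computed with the Lie algebroid $(A,\mu^N,\rho\circ N)$. $\underline N$ is the degree-zero linear map on $\Gamma(\wedge A)[2]$ with $\underline N(f)=0$ on functions and $\underline N(P_1\wedge\cdots\wedge P_p)=\sum_iP_1\wedge\cdots\wedge N(P_i)\wedge\cdots\wedge P_p$. A symmetric vector valued $k$-form on a graded vector space $E$ is a graded symmetric $k$-linear map $K:E^k\to E$ ($k=0$: an element of $E$), of degree $\bar K$ if $|K(X_1,\dots,X_k)|=\sum|X_i|+\bar K$. For a $k$-form $K$ and an $l$-form $L$ ($l\ge1$), $\iota_KL(X_1,\dots,X_{k+l-1})=\sum_{\sigma\in Sh(k,l-1)}\epsilon(\sigma)L(K(X_{\sigma(1)},\dots,X_{\sigma(k)}),\dots,X_{\sigma(k+l-1)})$ (unshuffles, Koszul sign); $\iota_KL=0$ for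 $L\in E$; $\iota_XK=K(X,\cdot,\dots)$ for $X\in E$. $[K,L]_{_{RN}}=\iota_KL-(-1)^{\bar K\bar L}\iota_LK$, extended to sums. $\mathcal N$ of degree zero is weak Nijenhuis with respect to a form $\nu$ of degree $1$ if $[\nu,[\mathcal N,[\mathcal N,\nu]_{_{RN}}]_{_{RN}}]_{_{RN}}=0$; ''with curvature'' means $\mathcal N$ has a vector valued $0$-form component. *)

(* Defs.v *)
From HB Require Import structures.
From mathcomp Require Import all_boot all_order all_algebra.
From mathcomp Require Import all_classical all_reals all_analysis.

Set Implicit Arguments.
Unset Strict Implicit.
Unset Printing Implicit Defensive.

Import Order.TTheory GRing.Theory Num.Theory.
Import numFieldNormedType.Exports.

Local Open Scope classical_set_scope.
Local Open Scope ring_scope.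

(* A graded vector space is a real vector space [E] with subspaces
   [gr d] of homogeneous elements of degree [d : int].  A form is evaluated on
   lists of homogeneous elements, each one tagged by its degree; its component
   of arity k is its restriction to lists of length k.  Thus a single [vform]
   encodes a sum of k-forms, k >= 0, of the same degree. *)
Section GradedForms.
Variables (R : realType) (E : lmodType R) (gr : int -> set E).

Record vform := VForm { vdeg : int; vfun : seq (int * E) -> E }.

Definition totdeg (s : seq (int * E)) : int := \sum_(u <- s) u.1.

Fixpoint homog (s : seq (int * E)) : Prop :=
  if s is u :: s' then gr u.1 u.2 /\ homog s' else True.

Definition is_vform (K : vform) : Prop :=
  [/\ (forall s, homog s -> gr (vdeg K + totdeg s) (vfun K s)),
      (forall s t d (a : R) (x y : E),
         homog s -> homog t -> gr d x -> gr d y ->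
         vfun K (s ++ (d, a *: x + y) :: t) =
         a *: vfun K (s ++ (d, x) :: t) + vfun K (s ++ (d, y) :: t))
    & (forall s t u v, homog (s ++ u :: v :: t) ->
         vfun K (s ++ v :: u :: t) =
         ((-1) ^ (u.1 * v.1)) *: vfun K (s ++ u :: v :: t))].

Definition vform0 (d : int) (e : E) : vform :=
  VForm d (fun s => if s is [::] then e else 0).
Definition vform1 (d : int) (F : int * E -> E) : vform :=
  VForm d (fun s => if s is [:: u] then F u else 0).
Definition vform2 (d : int) (F : int * E -> int * E -> E) : vform :=
  VForm d (fun s => if s is [:: u; v] then F u v else 0).

(* Meant for forms of the same degree. *)
Definition vform_add (K L : vform) : vform :=
  VForm (vdeg K) (fun s => vfun K s + vfun L s).

(* The list of all unshuffles of [s]: each entry is (eps, (a, b)), with [a] a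
   subsequence of [s], [b] the complementary one, and [eps] the Koszul sign of
   the permutation from [s] to [a ++ b].  All sizes of [a] occur, so summing
   over this list is summing over Sh(k, size s - k) for all k. *)
Fixpoint unshuffles (s : seq (int * E)) :
    seq (R * (seq (int * E) * seq (int * E))) :=
  if s is u :: s' then
    [seq (w.1, (u :: w.2.1, w.2.2)) | w <- unshuffles s'] ++
    [seq ((-1) ^ (u.1 * totdeg w.2.1) * w.1, (w.2.1, u :: w.2.2))
       | w <- unshuffles s']
  else [:: (1, ([::], [::]))].

(* iota_K L: the value of K becomes the first argument of L; only components
   of L of positive arity are ever evaluated. *)
Definition insertion (K L : vform) (s : seq (int * E)) : E :=
  \sum_(w <- unshuffles s)
     w.1 *: vfun L ((vdeg K + totdeg w.2.1, vfun K w.2.1) :: w.2.2).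

Definition RN (K L : vform) : vform :=
  VForm (vdeg K + vdeg L)
    (fun s => insertion K L s - ((-1) ^ (vdeg K * vdeg L)) *: insertion L K s).

Definition vform_zero (K : vform) : Prop :=
  forall s, homog s -> vfun K s = 0.

Definition weak_nijenhuis (N nu : vform) : Prop :=
  [/\ is_vform N /\ vdeg N = 0, is_vform nu /\ vdeg nu = 1
    & vform_zero (RN nu (RN N (RN N nu)))].

Definition curvature (N : vform) : E := vfun N [::].

(* Symmetric differential graded Lie algebra structures: L-infinity structures
   with unary and binary components only. *)
Definition is_dgla (nu : vform) : Prop :=
  [/\ is_vform nu /\ vdeg nu = 1,
      (forall s, homog s -> size s != 1%N -> size s != 2%N -> vfun nu s = 0)
    & vform_zero (RN nu nu)].

End GradedForms.

Section Smooth.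
Variables (R : realType) (n : nat).

Definition partial (k : 'I_n) (f : 'rV[R]_n -> R^o) : 'rV[R]_n -> R^o :=
  fun y => 'D_(delta_mx 0 k) f y.

(* [f] is smooth on the open set [U]: all its iterated partial derivatives
   exist and are differentiable at all points of [U]. *)
Definition smooth_on (U : set 'rV[R]_n) (f : 'rV[R]_n -> R^o) : Prop :=
  forall (s : seq 'I_n) y, U y -> differentiable (foldr partial f s) y.

(* [chart i] and [chart_inv i] are total functions, relevant on
   [chart_dom i] and [chart i @` chart_dom i] respectively. *)
Record manifold := Manifold {
  mpoint :> topologicalType;
  chart_idx : Type;
  chart_dom : chart_idx -> set mpoint;
  chart : chart_idx -> mpoint -> 'rV[R]_n;
  chart_inv : chart_idx -> 'rV[R]_n -> mpoint;
  manifold_hausdorff : hausdorff_space mpoint;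
  manifold_second_countable : @second_countable mpoint;
  chart_dom_open : forall i, open (chart_dom i);
  chart_cover : forall x, exists i, chart_dom i x;
  chart_im_open : forall i, open (chart i @` chart_dom i);
  chartK : forall i x, chart_dom i x -> chart_inv i (chart i x) = x;
  chart_continuous : forall i x, chart_dom i x -> {for x, continuous (chart i)};
  chart_inv_continuous : forall i y, (chart i @` chart_dom i) y ->
    {for y, continuous (chart_inv i)};
  transition_smooth : forall i j (k : 'I_n),
    smooth_on (chart i @` (chart_dom i `&` chart_dom j))
      (fun y => chart j (chart_inv i y) 0 k)
}.

Definition smooth_fun (M : manifold) (W : set M) (f : M -> R) : Prop :=
  forall i : chart_idx M,
    smooth_on (@chart M i @` (@chart_dom M i `&` W)) (f \o @chart_inv M i).

End Smooth.

(* Sections, smooth or not, of a family of vector spaces. *)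
Definition section (R : realType) (M : Type) (F : M -> lmodType R) : Type :=
  forall x, F x.

Section SectionLmod.
Variables (R : realType) (M : Type) (F : M -> lmodType R).

HB.instance Definition _ := gen_eqMixin (section F).
HB.instance Definition _ := gen_choiceMixin (section F).

Let add (X Y : section F) : section F := fun x => X x + Y x.
Let zero : section F := fun x => 0.
Let opp (X : section F) : section F := fun x => - X x.
Let scale (a : R) (X : section F) : section F := fun x => a *: X x.

Let addA : associative add.
Proof. by move=> X Y Z; apply: functional_extensionality_dep => x; rewrite /add addrA. Qed.
Let addC : commutative add.
Proof. by move=> X Y; apply: functional_extensionality_dep => x; rewrite /add addrC. Qed.
Let add0 : left_id zero add.
Proof. by move=> X; apply: functional_extensionality_dep => x; rewrite /add add0r. Qed.
Let addN : left_inverse zero opp add.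
Proof. by move=> X; apply: functional_extensionality_dep => x; rewrite /add /opp addNr. Qed.

HB.instance Definition _ :=
  GRing.isZmodule.Build (section F) addA addC add0 addN.

Let scaleA a b X : scale a (scale b X) = scale (a * b) X.
Proof. by apply: functional_extensionality_dep => x; rewrite /scale scalerA. Qed.
Let scale1 : left_id 1 scale.
Proof. by move=> X; apply: functional_extensionality_dep => x; rewrite /scale scale1r. Qed.
Let scaleDr : right_distributive scale +%R.
Proof. by move=> a X Y; apply: functional_extensionality_dep => x; apply: scalerDr. Qed.
Let scaleDl X : {morph scale^~ X : a b / a + b}.
Proof. by move=> a b; apply: functional_extensionality_dep => x; apply: scalerDl. Qed.

HB.instance Definition _ :=
  GRing.Zmodule_isLmodule.Build R (section F) scaleA scale1 scaleDr scaleDl.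

Definition fscale (f : M -> R) (X : section F) : section F :=
  fun x => f x *: X x.

End SectionLmod.

Section Bundles.
Variables (R : realType) (n : nat) (M : manifold R n).

(* A vector bundle of rank [r] given by its fibres and a cover by local frames
   with smooth transition functions. *)
Record vbundle (r : nat) := VBundle {
  fib :> M -> lmodType R;
  triv_idx : Type;
  triv_dom : triv_idx -> set M;
  frame : triv_idx -> 'I_r -> section fib;
  triv_dom_open : forall j, open (triv_dom j);
  triv_cover : forall x, exists j, triv_dom j x;
  frame_basis : forall j x, triv_dom j x -> forall v : fib x,
    exists! c : 'rV[R]_r, v = \sum_(a < r) c 0 a *: frame j a x;
  frame_smooth : forall j k b, exists g : 'I_r -> M -> R,
    (forall a, smooth_fun (triv_dom j `&` triv_dom k) (g a)) /\
    (forall x, triv_dom j x -> triv_dom k x ->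
       frame k b x = \sum_(a < r) g a x *: frame j a x)
}.

Variables (r : nat) (A : vbundle r).

Definition smooth_section (W : set M) (X : section A) : Prop :=
  forall j : triv_idx A, exists g : 'I_r -> M -> R,
    (forall a, smooth_fun (W `&` @triv_dom r A j) (g a)) /\
    (forall x, W x -> @triv_dom r A j x ->
       X x = \sum_(a < r) g a x *: frame j a x).

Definition smoothM (f : M -> R) : Prop := smooth_fun setT f.

Definition gsec (X : section A) : Prop := smooth_section setT X.

(* Smooth sections of A^* , tested on the local frames. *)
Definition covec (alpha : forall x, A x -> R) : Prop :=
  (forall x (c : R) u v, alpha x (c *: u + v) = c * alpha x u + alpha x v) /\
  (forall (j : triv_idx A) a,
     smooth_fun (@triv_dom r A j) (fun x => alpha x (frame j a x))).

Definition tensor11 (N : forall x, A x -> A x) : Prop :=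
  (forall x (c : R) u v, N x (c *: u + v) = c *: N x u + N x v) /\
  (forall (j : triv_idx A) a,
     smooth_section (@triv_dom r A j) (fun x => N x (frame j a x))).

Definition tapp (N : forall x, A x -> A x) (X : section A) : section A :=
  fun x => N x (X x).

(* [v] is a tangent vector at [x]: a derivation at [x] of C^oo(M).  Values
   outside C^oo(M) are irrelevant. *)
Definition tangent (x : M) (v : (M -> R) -> R) : Prop :=
  (forall (c : R) f g, smoothM f -> smoothM g ->
     v (fun y => c * f y + g y) = c * v f + v g) /\
  (forall f g, smoothM f -> smoothM g ->
     v (fun y => f y * g y) = f x * v g + g x * v f).

(* [anchor x u f] is the derivative of [f] at [x] along rho(u). *)
Definition anchor_map : Type := forall x, A x -> (M -> R) -> R.

Definition anc (rho : anchor_map) (X : section A) (f : M -> R) : M -> R :=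
  fun x => rho x (X x) f.

(* rho is a smooth vector bundle morphism from A to TM. *)
Definition is_anchor (rho : anchor_map) : Prop :=
  [/\ (forall x u, tangent x (rho x u)),
      (forall x (c : R) u v f, smoothM f ->
         rho x (c *: u + v) f = c * rho x u f + rho x v f)
    & (forall X f, gsec X -> smoothM f -> smoothM (anc rho X f))].

Record lie_algebroid := LieAlgebroid {
  lbr : section A -> section A -> section A;
  anchor : anchor_map;
  lbr_smooth : forall X Y, gsec X -> gsec Y -> gsec (lbr X Y);
  lbr_linear : forall (c : R) X Y Z, gsec X -> gsec Y -> gsec Z ->
    lbr (c *: X + Y) Z = c *: lbr X Z + lbr Y Z;
  lbr_anti : forall X Y, gsec X -> gsec Y -> lbr X Y = - lbr Y X;
  lbr_jacobi : forall X Y Z, gsec X -> gsec Y -> gsec Z ->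
    lbr X (lbr Y Z) + lbr Y (lbr Z X) + lbr Z (lbr X Y) = 0;
  anchorP : is_anchor anchor;
  anchor_morph : forall X Y f, gsec X -> gsec Y -> smoothM f ->
    anc anchor (lbr X Y) f =
    anc anchor X (anc anchor Y f) - anc anchor Y (anc anchor X f);
  lbr_leibniz : forall X Y f, gsec X -> gsec Y -> smoothM f ->
    lbr X (fscale f Y) = fscale f (lbr X Y) + fscale (anc anchor X f) Y
}.

End Bundles.

(* An exterior algebra of a vector space, by its universal property. *)
Record exterior (R : realType) (V : lmodType R) := Exterior {
  ext_alg :> algType R;
  ext_in : {linear V -> ext_alg};
  ext_sq0 : forall v, ext_in v * ext_in v = 0;
  ext_lift : forall (B : algType R) (f : {linear V -> B}),
    (forall v, f v * f v = 0) ->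
    exists g : {lrmorphism ext_alg -> B}, forall v, g (ext_in v) = f v;
  ext_lift_unique : forall (B : algType R) (g h : {lrmorphism ext_alg -> B}),
    (forall v, g (ext_in v) = h (ext_in v)) -> forall w, g w = h w
}.

Section Pairing.
Variables (R : realType) (V : lmodType R) (L : exterior V).

(* w(a, b) for w in the second exterior power of V and a, b in its dual, with
   (u /\ v)(a, b) = a(u) b(v) - a(v) b(u); the value does not depend on the
   decomposition of w as a sum of products. *)
Definition pairing2 (w : L) (a b : V -> R) : R :=
  xget 0 [set c : R | exists s : seq (V * V),
    w = \sum_(u <- s) ext_in L u.1 * ext_in L u.2 /\
    c = \sum_(u <- s) (a u.1 * b u.2 - a u.2 * b u.1)].

(* <b, sharp w a> = w(a, b) *)
Definition sharp (w : L) (a : V -> R) : V :=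
  xget 0 [set v : V | forall b : {linear V -> R^o}, b v = pairing2 w a b].

End Pairing.

Section Multivectors.
Variables (R : realType) (n : nat) (M : manifold R n).
Variables (r : nat) (A : vbundle M r) (Lam : forall x, exterior (A x)).

Definition multisec : Type := section (fun x => ext_alg (Lam x) : lmodType R).
HB.instance Definition _ := GRing.Lmodule.on multisec.

Definition wedge (P Q : multisec) : multisec := fun x => P x * Q x.
Definition of_fun (f : M -> R) : multisec := fun x => (f x)%:A.
Definition of_sec (X : section A) : multisec := fun x => ext_in (Lam x) (X x).

(* P is in Gamma(/\^p A): in each local frame, P is a combination with smooth
   coefficients of the p-fold products of elements of the frame. *)
Definition mvec (p : nat) (P : multisec) : Prop :=
  forall j : triv_idx A, exists g : p.-tuple 'I_r -> M -> R,
    (forall t, smooth_fun (@triv_dom _ _ _ _ A j) (g t)) /\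
    (forall x, @triv_dom _ _ _ _ A j x ->
       P x = \sum_(t : p.-tuple 'I_r)
               g t x *: \prod_(a <- t) ext_in (Lam x) (frame j a x)).

(* The grading of Gamma(/\ A)[2]. *)
Definition mgr (d : int) : set multisec :=
  [set P | P = 0 \/ exists2 p : nat, d = p%:Z - 2 & mvec p P].

Definition is_schouten (T : lie_algebroid A)
    (sn : multisec -> multisec -> multisec) : Prop :=
  [/\ (forall p q (c : R) P P' Q, mvec p P -> mvec p P' -> mvec q Q ->
         sn (c *: P + P') Q = c *: sn P Q + sn P' Q),
      (forall p q P Q, mvec p P -> mvec q Q ->
         (forall k, (p + q = k.+1)%N -> mvec k (sn P Q)) /\
         ((p + q = 0)%N -> sn P Q = 0)),
      (forall p q P Q, mvec p P -> mvec q Q ->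
         sn P Q = - ((-1) ^ ((p%:Z - 1) * (q%:Z - 1)) *: sn Q P)),
      (forall p q q' P Q Q', mvec p P -> mvec q Q -> mvec q' Q' ->
         sn P (wedge Q Q') =
         wedge (sn P Q) Q' + (-1) ^ ((p%:Z - 1) * q%:Z) *: wedge Q (sn P Q'))
    & (forall X, gsec X ->
         (forall Y, gsec Y -> sn (of_sec X) (of_sec Y) = of_sec (lbr T X Y)) /\
         (forall f, smoothM f ->
            sn (of_sec X) (of_fun f) = of_fun (anc (anchor T) X f)))].

(* The map /\A -> /\A extending N as a derivation: 0 on functions and
   P1 /\ .. /\ Pp |-> sum_i P1 /\ .. /\ N(Pi) /\ .. /\ Pp. *)
Definition is_underline (N : forall x, A x -> A x)
    (uN : forall x, Lam x -> Lam x) : Prop :=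
  forall x,
  [/\ (forall (c : R) (v w : Lam x), uN x (c *: v + w) = c *: uN x v + uN x w),
      uN x 1 = 0
    & (forall s : seq (A x),
         uN x (\prod_(v <- s) ext_in (Lam x) v) =
         \sum_(i < size s) \prod_(k < size s)
           ext_in (Lam x) (if k == i then N x (s`_k) else s`_k))].

(* A bracket and an anchor are passed separately, as both (mu, rho) and its
   deformation (mu^N, rho o N) are used. *)
Definition def_br (br : section A -> section A -> section A)
    (N : forall x, A x -> A x) (X Y : section A) : section A :=
  br (tapp N X) Y + br X (tapp N Y) - tapp N (br X Y).

Definition def_anchor (rho : anchor_map A) (N : forall x, A x -> A x) :
  anchor_map A := fun x u => rho x (N x u).

Definition nijenhuis (T : lie_algebroid A) (N : forall x, A x -> A x) : Prop :=
  tensor11 N /\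
  (forall X Y, gsec X -> gsec Y ->
     lbr T (tapp N X) (tapp N Y) = tapp N (def_br (lbr T) N X Y)).

Definition transpose (N : forall x, A x -> A x) (alpha : forall x, A x -> R) :
  forall x, A x -> R := fun x u => alpha x (N x u).

Definition pi_sharp (pi : multisec) (alpha : forall x, A x -> R) : section A :=
  fun x => sharp (pi x) (alpha x).

Definition pi_pair (pi : multisec) (alpha beta : forall x, A x -> R) : M -> R :=
  fun x => pairing2 (pi x) (alpha x) (beta x).

(* <Lie_X alpha, Y> *)
Definition lie_der (br : section A -> section A -> section A)
    (rho : anchor_map A) (X : section A) (alpha : forall x, A x -> R)
    (Y : section A) : M -> R :=
  fun x => anc rho X (fun y => alpha y (Y y)) x - alpha x (br X Y x).

(* <{alpha, beta}_pi, Y>: the 1-form {alpha, beta}_pi is regarded as a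
   C^oo(M)-linear map from Gamma(A) to C^oo(M). *)
Definition koszul (br : section A -> section A -> section A)
    (rho : anchor_map A) (pi : multisec) (alpha beta : forall x, A x -> R)
    (Y : section A) : M -> R :=
  fun x => lie_der br rho (pi_sharp pi alpha) beta Y x
           - lie_der br rho (pi_sharp pi beta) alpha Y x
           - anc rho Y (pi_pair pi alpha beta) x.

(* Deformation of {.,.}_pi by N^*; <N^* gamma, Y> is <gamma, N Y>. *)
Definition def_koszul (br : section A -> section A -> section A)
    (rho : anchor_map A) (pi : multisec) (N : forall x, A x -> A x)
    (alpha beta : forall x, A x -> R) (Y : section A) : M -> R :=
  fun x => koszul br rho pi (transpose N alpha) beta Y x
           + koszul br rho pi alpha (transpose N beta) Y x
           - koszul br rho pi alpha beta (tapp N Y) x.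

Definition poisson_nijenhuis (T : lie_algebroid A)
    (sn : multisec -> multisec -> multisec)
    (pi : multisec) (N : forall x, A x -> A x) : Prop :=
  [/\ mvec 2 pi,
      nijenhuis T N,
      sn pi pi = 0,
      (forall alpha, covec alpha ->
         tapp N (pi_sharp pi alpha) = pi_sharp pi (transpose N alpha))
    & (forall alpha beta Y, covec alpha -> covec beta -> gsec Y ->
         def_koszul (lbr T) (anchor T) pi N alpha beta Y =
         koszul (def_br (lbr T) N) (def_anchor (anchor T) N) pi alpha beta Y)].

Definition l1 (sn : multisec -> multisec -> multisec) (pi : multisec) :
  vform multisec := vform1 1 (fun u => sn pi u.2).

(* An element of degree d lies in Gamma(/\^p A) with p - 1 = d + 1. *)
Definition l2 (sn : multisec -> multisec -> multisec) : vform multisec :=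
  vform2 1 (fun u v => (-1) ^ (u.1 + 1) *: sn u.2 v.2).

Definition underline_form (uN : forall x, Lam x -> Lam x) : vform multisec :=
  vform1 (E := multisec) 0 (fun u x => uN x (u.2 x)).

(* Each component of nu is a derivation of the wedge product in its last,
   hence by symmetry in each, argument. *)
Definition wedge_multiplicative (nu : vform multisec) : Prop :=
  forall s q q' Q Q', homog mgr s -> mvec q Q -> mvec q' Q' ->
    vfun nu (rcons s ((q + q')%:Z - 2, wedge Q Q')) =
    wedge (vfun nu (rcons s (q%:Z - 2, Q))) Q'
    + (-1) ^ (q%:Z * (vdeg nu + totdeg s))
        *: wedge Q (vfun nu (rcons s (q'%:Z - 2, Q'))).

End Multivectors.

Arguments mgr {R n M r A} Lam d _.

(* Main.v *)
Require Import Defs.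
From HB Require Import structures.
From mathcomp Require Import all_boot all_order all_algebra.
From mathcomp Require Import all_classical all_reals all_analysis.
From mathcomp Require Import ring lra zify.

(* Write [P, Q] for the Schouten bracket, U for the underlined N and
   D P = [pi, U P] - U [pi, P].  The Schouten bracket and its deformation
   [P, Q]_N = [U P, Q] + [P, U Q] - U [P, Q], which is the Schouten bracket of
   (A, mu^N, rho o N), satisfy the graded Jacobi identity: the Jacobiator is a
   derivation in each argument, it vanishes on functions and sections, and after
   multiplication with a cutoff function these generate all multivectors.

   The last two conditions in the definition of a Poisson-Nijenhuis structure say
   that [U pi, P] = 2 (U [pi, P] - [pi, U P]) when P is a function or a section.
   Both sides being derivations, this holds for all P, that is D = - [pi, .]_N,
   and P = pi gives [pi, U pi] = 0.

   It follows that [U + pi, [U + pi, l1 + l2]] = [U, [U, l1 + l2]].  Applying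
   [U, [U, .]] to the identities l1 l1 = 0, [l1, l2] = 0 and [l2, l2] = 0
   expresses the bracket of l1 + l2 with this form through D D, the failure of D
   to be a derivation of [., .]_N, and the Jacobiator of [., .]_N; these vanish by
   the Jacobi identity of [., .]_N, as D = - [pi, .]_N and [pi, pi]_N = 0. *)

Set Implicit Arguments.
Unset Strict Implicit.
Unset Printing Implicit Defensive.

Import Order.TTheory GRing.Theory Num.Theory.
Import numFieldNormedType.Exports.

Local Open Scope classical_set_scope.
Local Open Scope ring_scope.

(** Let delta be the Richardson-Nijenhuis bracket with U, and nu = l1 + l2. As delta is a derivation
    of that bracket, applying it twice to [nu, nu] = 0 gives [nu, delta (delta nu)] = -
    [delta nu, delta nu]: the claim amounts to D + [., .]_N being again a differential graded Lie
    algebra structure. This is the source of the coefficients 2 in the identities that are expanded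
    by hand in arities 1, 2 and 3.

    The factor 2 in [U pi, P] comes from (U pi)^# being the sum of N pi^# and pi^# composed with the
    transpose of N, which are equal. It is exactly what removes the curvature: inserting pi into l2
    adds - [pi, .] to [U + pi, nu]; in the second bracket the commutator of this term with U is - D,
    while inserting pi into the deformed bracket gives - [pi, .]_N = D.

    The geometric difficulty is that the hypotheses concern functions, sections and 1-forms on all
    of M, whereas multivectors are given in local frames. Passing between the two requires smooth
    cutoff functions on M, and smoothness here means that all iterated partial derivatives are
    differentiable. *)

Lemma add_idem0 (V : zmodType) (x : V) : x = x + x -> x = 0.
Proof. by move=> /eqP; rewrite -{1}[x]addr0 (inj_eq (addrI _)) => /eqP. Qed.

(** * Smooth functions *)

Lemma near_eq_differentiable (R : realType) (V W : normedModType R)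
    (f g : V -> W) (x : V) :
  (\near x, f x = g x) -> differentiable f x -> differentiable g x.
Proof.
move=> fg df.
have fgx : f x = g x := nbhs_singleton fg.
have E : g \o shift x = cst (g x) + 'd f x +o_ 0 id.
  have E := diff_locally df.
  apply/eqaddoP => e e0.
  have /eqaddoP/(_ _ e0) H := E.
  have H2 : \forall z \near (0 : V), f (z + x) = g (z + x).
    by move: fg; rewrite (near_shift 0); apply: filterS => z /=; rewrite subr0.
  apply: filterS2 H H2 => z /= H1 H2.
  by move: H1; rewrite -fgx !fctE /= -H2.
have dc : continuous ('d f x) by apply: diff_continuous.
have D : 'd g x = 'd f x :> (V -> W) by apply: diff_unique.
by apply/diff_locallyP; rewrite D.
Qed.

Section Flat.
Variable R : realType.

(** The classical flat function is the case m = 0. The powers of 1/t are included because the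
    derivative of [flat m] is a combination of [flat m.+1] and [flat m.+2], so that the whole family
    is closed under differentiation. *)
Definition flat (m : nat) (t : R) : R :=
  if 0 < t then t^-1 ^+ m * expR (- t^-1) else 0.

Lemma flat_gt0 m t : 0 < t -> 0 < flat m t.
Proof.
by move=> t0; rewrite /flat t0 mulr_gt0 ?expR_gt0// exprn_gt0// invr_gt0.
Qed.

Lemma flat_le0 m t : t <= 0 -> flat m t = 0.
Proof. by rewrite /flat ltNge => ->. Qed.

(** With u = 1/t, the exponential of u dominates one term u^(m+2) / (m+2)! of its series. A
    quadratic bound is what makes the derivative at 0 exist and vanish. *)
Lemma norm_flat_le m t : `|flat m t| <= m.+2`!%:R * `|t| ^+ 2.
Proof.
have [t0|t0] := ltP 0 t; last first.
  by rewrite flat_le0// normr0 mulr_ge0// ?exprn_ge0.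
rewrite gtr0_norm ?flat_gt0// gtr0_norm// /flat t0.
have u0 : 0 < t^-1 by rewrite invr_gt0.
have := expR_ge1Dxn m.+1 (ltW u0).
set u := t^-1 in u0 *; have -> : t = u^-1 by rewrite /u invrK.
have f0 : 0 < (m.+2`!%:R : R) by rewrite ltr0n fact_gt0.
move=> H; rewrite expRN.
have H2 : u ^+ m.+2 / m.+2`!%:R <= expR u by apply: le_trans H; lra.
rewrite ler_pdivrMr ?expR_gt0//.
have -> : u ^+ m = m.+2`!%:R * u^-1 ^+ 2 * (u ^+ m.+2 / m.+2`!%:R).
  by rewrite !exprS; field; rewrite ?gt_eqF//.
by rewrite ler_wpM2l// mulr_ge0// exprn_ge0// invr_ge0 ltW.
Qed.

Lemma is_derive_flat (m : nat) (t : R) :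
  is_derive t 1 (flat m) (flat m.+2 t - m%:R * flat m.+1 t).
Proof.
have [t0|t0|t0] := ltgtP t 0.
- apply: (@near_eq_is_derive _ _ _ (cst 0)).
    by near=> z; rewrite flat_le0//; apply: ltW; near: z; apply: lt_nbhsl.
  rewrite !flat_le0 ?ltW// mulr0 subr0; exact: is_derive_cst.
- apply: (@near_eq_is_derive _ _ _ (fun t : R => t^-1 ^+ m * expR (- t^-1) : R)).
    near=> z; rewrite /flat; suff -> : 0 < z by [].
    by near: z; apply: lt_nbhsr.
  have tn : t != 0 by rewrite gt_eqF.
  have dV : is_derive t 1 (fun t : R => t^-1) (- t^-2).
    have := @is_deriveV _ id t 1 1 tn (is_derive_id _ _); rewrite /= scaler1; exact.
  have dE : is_derive t 1 (fun t : R => expR (- t^-1)) (expR (- t^-1) * t^-2).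
    have dN : is_derive t 1 (fun t : R => - t^-1) (t^-2).
      by rewrite -[t^-2]opprK; exact: is_deriveN.
    exact: is_derive1_comp.
  have dX : is_derive t 1 (fun t : R => t^-1 ^+ m) ((m%:R * t^-1 ^+ m.-1) *: - t^-2).
    have := @is_deriveX _ _ (fun t : R => t^-1) m t 1 _ dV.
    by rewrite exprfctE; exact.
  have := is_deriveM dX dE.
  have -> : flat m.+2 t - m%:R * flat m.+1 t =
      t^-1 ^+ m *: (expR (- t^-1) / t ^+ 2) +
      expR (- t^-1) *: ((m%:R * t^-1 ^+ m.-1) *: - t ^- 2).
    rewrite /flat t0 /GRing.scale /=.
    by case: m {dX} => [|m] /=; rewrite ?expr0 !exprS; field.
  by [].
- rewrite t0 !flat_le0// mulr0 subr0.
  have H : (fun h : R => h^-1 *: ((flat m \o shift 0) (h *: (1 : R)) - flat m 0))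
      @ 0^' --> (0 : R).
    apply/cvgr0Pnorm_le => e e0.
    have C0 : 0 < m.+2`!%:R :> R by rewrite ltr0n fact_gt0.
    near=> h.
    have h0 : h != 0 by near: h; exact: nbhs_dnbhs_neq.
    have hle : `|h| <= e / m.+2`!%:R.
      by near: h; apply: dnbhs0_le; rewrite divr_gt0.
    rewrite /= (flat_le0 _ (lexx 0)) subr0 addr0 normrM normfV /GRing.scale /= mulr1.
    have h1 : 0 < `|h| by rewrite normr_gt0.
    rewrite mulrC ler_pdivrMr//; apply: le_trans (norm_flat_le _ _) _.
    by rewrite expr2 mulrA ler_pM2r// mulrC -ler_pdivlMr.
  by split; [apply/cvg_ex; exists 0|exact: cvg_lim].
Unshelve. all: by end_near.
Qed.
End Flat.

Section SmoothOn.
Variables (R : realType) (n : nat).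
Implicit Types (U V : set 'rV[R]_n) (f g : 'rV[R]_n -> R^o).

Lemma eq_on_near U f g y : open U -> U y -> {in U, f =1 g} -> \near y, f y = g y.
Proof.
move=> oU Uy fg; apply: filterS (open_nbhs_nbhs (conj oU Uy)) => z Uz.
by apply: fg; rewrite inE.
Qed.

Lemma eq_partial U f g k : open U -> {in U, f =1 g} ->
  {in U, partial k f =1 partial k g}.
Proof.
move=> oU fg y; rewrite inE => Uy; apply: near_eq_derive.
exact: eq_on_near fg.
Qed.

Lemma eq_foldr_partial U f g s : open U -> {in U, f =1 g} ->
  {in U, foldr (@partial R n) f s =1 foldr (@partial R n) g s}.
Proof. by move=> oU fg; elim: s => //= k s; apply: eq_partial. Qed.

Lemma eq_smooth_on U f g : open U -> {in U, f =1 g} -> smooth_on U f ->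
  smooth_on U g.
Proof.
move=> oU fg sf s y Uy; apply: near_eq_differentiable (sf s y Uy).
by apply: eq_on_near Uy _ => //; apply: eq_foldr_partial.
Qed.

Lemma sub_smooth_on U V f : U `<=` V -> smooth_on V f -> smooth_on U f.
Proof. by move=> UV sf s y /UV; apply: sf. Qed.

Lemma smooth_on_local U f :
  (forall y, U y -> exists V, V y /\ smooth_on V f) -> smooth_on U f.
Proof. by move=> H s y /H[V [Vy]]; apply. Qed.

(** Smoothness by coinduction: a class of differentiable functions that is stable under partial
    derivatives, up to equality on U, consists of smooth functions. In [foldr] the last index is
    differentiated first, hence the induction from the end of the list. *)
Lemma smooth_on_coind U (C : ('rV[R]_n -> R^o) -> Prop) : open U ->
  (forall f y, C f -> U y -> differentiable f y) ->
  (forall f k, C f -> exists2 g, C g & {in U, partial k f =1 g}) ->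
  forall f, C f -> smooth_on U f.
Proof.
move=> oU Cd Cp f Cf s; elim/last_ind: s f Cf => [f Cf y Uy|s k IH f Cf y Uy].
  exact: Cd.
have [g Cg fg] := Cp f k Cf.
rewrite foldr_rcons; apply: near_eq_differentiable (IH g Cg y Uy).
apply: eq_on_near Uy _ => //; apply: eq_foldr_partial => // z Uz.
exact/esym/fg.
Qed.

(** The closure that [smooth_on_coind] is applied to. Sums and products must be present together
    with [flat], since the chain and product rules produce them, and all [flat m] occur at once
    because differentiation raises m. *)
Inductive smooth_class U : ('rV[R]_n -> R^o) -> Prop :=
| SmoothBase f : smooth_on U f -> smooth_class U f
| SmoothCst c : smooth_class U (cst c)
| SmoothAdd f g : smooth_class U f -> smooth_class U g ->
    smooth_class U (fun y => f y + g y)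
| SmoothMul f g : smooth_class U f -> smooth_class U g ->
    smooth_class U (fun y => f y * g y)
| SmoothFlat m f : smooth_class U f -> smooth_class U (fun y => flat m (f y)).

Lemma smooth_class_diff U f y : smooth_class U f -> U y -> differentiable f y.
Proof.
move=> + Uy; elim=> {f} [f sf|c|f g _ df _ dg|f g _ df _ dg|m f _ df].
- exact: (sf [::]).
- exact: differentiable_cst.
- exact: differentiableD.
- exact: differentiableM.
- apply: (@differentiable_comp _ _ R^o R^o f (flat m)) => //.
  by apply/derivable1_diffP; have [] := is_derive_flat m (f y).
Qed.

Lemma partial_flat m f k y : differentiable f y ->
  partial k (fun y => flat m (f y)) y =
  (flat m.+2 (f y) - m%:R * flat m.+1 (f y)) * partial k f y.
Proof.
move=> df; have [dF DF] := is_derive_flat m (f y).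
have dF' : differentiable (flat m : R^o -> R^o) (f y) by apply/derivable1_diffP.
rewrite /partial deriveE; last exact: (@differentiable_comp _ _ R^o R^o f (flat m)).
rewrite (@diff_comp _ _ R^o R^o f (flat m))//=.
rewrite -DF mulrC (deriveE _ df).
set v := 'd f y _; rewrite -[in LHS](mulr1 v).
rewrite -[X in (_ X = _)]/(v *: (1 : R^o)) linearZ; congr (_ * _);
  exact/esym/(deriveE _ dF').
Qed.

Lemma smooth_class_partial U f k : open U -> smooth_class U f ->
  exists2 g, smooth_class U g & {in U, partial k f =1 g}.
Proof.
move=> oU; elim=> {f} [f sf|c|f g Cf [f' Cf' Ef] Cg [g' Cg' Eg]
                      |f g Cf [f' Cf' Ef] Cg [g' Cg' Eg]|m f Cf [f' Cf' Ef]].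
- exists (partial k f) => //; apply: SmoothBase => s y Uy.
  by have := sf (rcons s k) y Uy; rewrite foldr_rcons.
- by exists (cst 0); [exact: SmoothCst|move=> y _; exact: derive_cst].
- exists (fun y => f' y + g' y); first exact: SmoothAdd.
  move=> y Uy; rewrite -Ef// -Eg//; rewrite inE in Uy.
  apply: deriveD; exact/diff_derivable/(smooth_class_diff _ Uy).
- exists (fun y => f y * g' y + g y * f' y).
    by apply: SmoothAdd; apply: SmoothMul.
  move=> y Uy; rewrite -Ef// -Eg//; rewrite inE in Uy.
  apply: deriveM; exact/diff_derivable/(smooth_class_diff _ Uy).
- exists (fun y => (flat m.+2 (f y) + (- m%:R) * flat m.+1 (f y)) * f' y).
    apply: SmoothMul => //; apply: SmoothAdd; first exact: SmoothFlat.
    by apply: (SmoothMul (SmoothCst U (- m%:R))); apply: SmoothFlat.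
  move=> y Uy; rewrite -Ef//; rewrite inE in Uy.
  by rewrite mulNr partial_flat//; exact: (smooth_class_diff _ Uy).
Qed.

Lemma smooth_class_smooth U f : open U -> smooth_class U f -> smooth_on U f.
Proof.
move=> oU; apply: smooth_on_coind => // [{}f y|{}f k].
  exact: smooth_class_diff.
exact: smooth_class_partial.
Qed.

End SmoothOn.

Section SmoothFun.
Variables (R : realType) (n : nat) (M : manifold R n).
Implicit Types (V W : set M) (f g : M -> R).

Lemma chart_im_nbhs (i : chart_idx M) W x : open W -> chart_dom i x -> W x ->
  nbhs (chart i x) (chart i @` (chart_dom i `&` W)).
Proof.
move=> oW dx Wx.
have cy : (chart i @` chart_dom i) (chart i x) by exists x.
have H1 := open_nbhs_nbhs (conj (@chart_im_open _ _ M i) cy).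
have H2 : \forall z \near chart i x, W (chart_inv i z).
  apply: (chart_inv_continuous cy); rewrite (chartK dx).
  exact: open_nbhs_nbhs (conj oW Wx).
apply: filterS2 H1 H2 => z [x' dx' <-]; rewrite (chartK dx') => Wx'.
by exists x'.
Qed.

Lemma open_chart_im (i : chart_idx M) W : open W ->
  open (chart i @` (chart_dom i `&` W)).
Proof.
by move=> oW; rewrite openE => _ [x [dx Wx] <-]; apply: chart_im_nbhs.
Qed.

Lemma sub_smooth_fun V W f : V `<=` W -> smooth_fun W f -> smooth_fun V f.
Proof.
move=> VW sf i; apply: sub_smooth_on (sf i).
by move=> _ [x [dx Vx] <-]; exists x => //; split=> //; apply: VW.
Qed.

Lemma smooth_fun_local W f :
  (forall x, W x -> exists V, V x /\ smooth_fun V f) -> smooth_fun W f.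
Proof.
move=> H i; apply: smooth_on_local => _ [x [dx Wx] <-].
have [V [Vx sf]] := H x Wx.
by exists (chart i @` (chart_dom i `&` V)); split; [exists x|apply: sf].
Qed.

Lemma eq_smooth_fun W f g : open W -> (forall x, W x -> f x = g x) ->
  smooth_fun W f -> smooth_fun W g.
Proof.
move=> oW fg sf i; apply: eq_smooth_on (sf i); first exact: open_chart_im.
move=> y; rewrite inE => -[x [dx Wx] <-] /=.
by rewrite (chartK dx) fg.
Qed.

Lemma smooth_fun_cst W c : smooth_fun W (fun=> c).
Proof.
apply: (@sub_smooth_fun W setT) => // i.
apply: smooth_class_smooth; last exact: SmoothCst.
by apply: open_chart_im; apply: openT.
Qed.

Lemma smooth_funD W f g : open W -> smooth_fun W f -> smooth_fun W g ->
  smooth_fun W (fun x => f x + g x).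
Proof.
move=> oW sf sg i.
apply: (@smooth_class_smooth _ _ _ (fun y => (f \o chart_inv i) y + (g \o chart_inv i)
  y)).
  exact: open_chart_im.
by apply: SmoothAdd; apply: SmoothBase; [apply: sf|apply: sg].
Qed.

Lemma smooth_funM W f g : open W -> smooth_fun W f -> smooth_fun W g ->
  smooth_fun W (fun x => f x * g x).
Proof.
move=> oW sf sg i.
apply: (@smooth_class_smooth _ _ _ (fun y => (f \o chart_inv i) y * (g \o chart_inv i)
  y)).
  exact: open_chart_im.
by apply: SmoothMul; apply: SmoothBase; [apply: sf|apply: sg].
Qed.

Lemma smooth_funZ W c f : open W -> smooth_fun W f ->
  smooth_fun W (fun x => c * f x).
Proof. by move=> oW; apply: smooth_funM oW _; apply: smooth_fun_cst. Qed.

Lemma smooth_funN W f : open W -> smooth_fun W f -> smooth_fun W (fun x => - f x).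
Proof.
move=> oW sf; have := smooth_funZ (-1) oW sf.
by apply: eq_smooth_fun => // x _; rewrite mulN1r.
Qed.

Lemma smooth_fun_sum W (I : Type) (s : seq I) (F : I -> M -> R) : open W ->
  (forall i, smooth_fun W (F i)) -> smooth_fun W (fun x => \sum_(i <- s) F i x).
Proof.
move=> oW sF; elim: s => [|i s IH].
  by apply: eq_smooth_fun (@smooth_fun_cst W 0) => // x _; rewrite big_nil.
by apply: eq_smooth_fun (smooth_funD oW (sF i) IH) => // x _; rewrite big_cons.
Qed.

Lemma smooth_fun_prod W (I : Type) (s : seq I) (F : I -> M -> R) : open W ->
  (forall i, smooth_fun W (F i)) -> smooth_fun W (fun x => \prod_(i <- s) F i x).
Proof.
move=> oW sF; elim: s => [|i s IH].
  by apply: eq_smooth_fun (@smooth_fun_cst W 1) => // x _; rewrite big_nil.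
by apply: eq_smooth_fun (smooth_funM oW (sF i) IH) => // x _; rewrite big_cons.
Qed.

Lemma smooth_fun_chart (i : chart_idx M) (k : 'I_n) :
  smooth_fun (chart_dom i) (fun x => chart i x 0 k).
Proof. by move=> j; apply: transition_smooth. Qed.

Lemma smooth_fun_flat W m f : open W -> smooth_fun W f ->
  smooth_fun W (fun x => flat m (f x)).
Proof.
move=> oW sf i.
apply: (@smooth_class_smooth _ _ _ (fun y => flat m ((f \o chart_inv i) y))).
  exact: open_chart_im.
by apply/SmoothFlat/SmoothBase/sf.
Qed.

(** The support lies in a set K closed in M: then W and the complement of K are open and cover M, so
    a product of phi with a function smooth on W extends by zero. *)
Record cutoff W (x : M) (phi : M -> R) : Prop := Cutoff {
  cutoff_smooth : smoothM phi;
  cutoff1 : phi x = 1;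
  cutoff_supp : exists K, [/\ closed K, K `<=` W & forall y, ~ K y -> phi y = 0]
}.

(** A product over the coordinates of functions that are positive exactly inside an interval,
    transported by a chart and normalized at x. The image K of the closed cube is compact, hence
    closed because M is Hausdorff; this is what allows the extension by zero outside the chart. *)
Lemma cutoff_exists W x : open W -> W x -> exists phi, cutoff W x phi.
Proof.
move=> oW Wx; have [i dx] := chart_cover x.
have /nbhs_ballP[e /= e0 He] := chart_im_nbhs oW dx Wx.
(* Half the radius, so that the closed cube [B] stays inside the open ball. *)
pose c := chart i x; pose d := e / 2.
have d0 : 0 < d by rewrite divr_gt0.
pose B : set 'rV[R]_n := [set v | forall k, `[c 0 k - d, c 0 k + d]%classic (v 0 k)].
have cB : compact B.
  by apply: (@rV_compact R n (fun k => `[c 0 k - d, c 0 k + d]%classic)) => k;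
    apply: segment_compact.
have BW : B `<=` chart i @` (chart_dom i `&` W).
  move=> v Bv; apply: He; split => // a k; rewrite (ord1 a) /ball /=.
  have := Bv k; rewrite /= in_itv /= => /andP[h1 h2].
  by rewrite ltr_norml /c /d in h1 h2 *; apply/andP; split; lra.
pose K := chart_inv i @` B.
have KW y : K y -> chart_dom i y /\ W y.
  by move=> [v /BW[z [dz Wz] <-] <-]; rewrite (chartK dz).
have cK : closed K.
  apply: compact_closed; first exact: manifold_hausdorff.
  apply: continuous_compact cB; apply: continuous_in_subspaceT => v.
  rewrite inE => /BW[z [dz Wz] <-].
  by apply: chart_inv_continuous; exists z.
pose h k y := flat 0 (d - (chart i y 0 k - c 0 k)) * flat 0 (d + (chart i y 0 k - c 0 k)).
(* Outside its domain [chart i] has arbitrary values, so zero is imposed there. *)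
pose psi y := if y \in chart_dom i then \prod_(k <- enum 'I_n) h k y else 0.
have psiK y : ~ K y -> psi y = 0.
  move=> nK; rewrite /psi; case: ifPn => // /set_mem dy.
  apply: contra_notP nK => /eqP; rewrite prodf_seq_neq0 => /allP H.
  exists (chart i y); last exact: chartK.
  move=> k; rewrite /= in_itv /=.
  have := H k; rewrite mem_enum inE => /(_ isT) /=; rewrite mulf_eq0 negb_or => /andP[].
  case: (ltP 0 (d - (chart i y 0 k - c 0 k))) => [h1 _|h1];
    last by rewrite flat_le0// eqxx.
  case: (ltP 0 (d + (chart i y 0 k - c 0 k))) => [h2 _|h2];
    last by rewrite flat_le0// eqxx.
  by apply/andP; split; lra.
have spsi : smoothM psi.
  apply: smooth_fun_local => y _; have [Ky|nKy] := pselect (K y).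
    exists (chart_dom i); split; first by have [] := KW y Ky.
    have od := @chart_dom_open _ _ M i.
    apply: (@eq_smooth_fun _ (fun y => \prod_(k <- enum 'I_n) h k y)) => //.
      by move=> z dz; rewrite /psi mem_set.
    apply: smooth_fun_prod => // k.
    apply: smooth_funM => //; apply: smooth_fun_flat => //; apply: smooth_funD => //.
    - exact: smooth_fun_cst.
    - apply: smooth_funN => //; apply: smooth_funD => //; last exact: smooth_fun_cst.
      exact: smooth_fun_chart.
    - exact: smooth_fun_cst.
    - by apply: smooth_funD => //; [apply: smooth_fun_chart|exact: smooth_fun_cst].
  exists (~` K); split=> //; apply: eq_smooth_fun (@smooth_fun_cst _ 0).
    exact: closed_openC.
  by move=> z /psiK.
have psix : psi x != 0.
  rewrite /psi mem_set//; rewrite prodf_seq_neq0; apply/allP => k _ /=.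
  by rewrite /h /c !subrr subr0 addr0 mulf_neq0// gt_eqF// flat_gt0.
exists (fun y => (psi x)^-1 * psi y); split.
- by apply: smooth_funZ => //; apply: openT.
- by rewrite mulVf.
- exists K; split=> //; first by move=> y /KW[].
  by move=> y /psiK ->; rewrite mulr0.
Qed.

Lemma cutoff_out W x phi y : cutoff W x phi -> ~ W y -> phi y = 0.
Proof. by case=> _ _ [K [_ KW K0]] nW; apply: K0 => /KW. Qed.

(** Two functions appear because g is typically a total function with arbitrary values outside W,
    such as a frame coordinate, while f is the smooth coefficient that it agrees with on W. *)
Lemma smooth_fun_cutoff V W x phi f g : open V -> open W -> cutoff W x phi ->
  smooth_fun (V `&` W) f -> (forall y, V y -> W y -> f y = g y) ->
  smooth_fun V (fun y => phi y * g y).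
Proof.
move=> oV oW [sp _ [K [cK KW K0]]] sf fg.
apply: smooth_fun_local => y Vy; have [Ky|nKy] := pselect (K y).
  exists (V `&` W); split; first by split=> //; apply: KW.
  have oVW : open (V `&` W) by apply: openI.
  apply: (@eq_smooth_fun _ (fun z => phi z * f z)) => //.
    by move=> z [Vz Wz]; rewrite fg.
  by apply: smooth_funM => //; apply: sub_smooth_fun sp.
exists (~` K); split=> //; apply: eq_smooth_fun (@smooth_fun_cst _ 0).
  exact: closed_openC.
by move=> z /K0 ->; rewrite mul0r.
Qed.

End SmoothFun.

(** * Sections and multivectors *)

Section Sections.
Variables (R : realType) (M : Type) (F : M -> lmodType R).
Implicit Types X Y : section F.

Lemma secDE X Y x : (X + Y) x = X x + Y x. Proof. by []. Qed.
Lemma secNE X x : (- X) x = - X x. Proof. by []. Qed.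
Lemma sec0E x : (0 : section F) x = 0. Proof. by []. Qed.
Lemma secZE (c : R) X x : (c *: X) x = c *: X x. Proof. by []. Qed.
Lemma fscaleE f X x : fscale f X x = f x *: X x. Proof. by []. Qed.

Lemma sec_sumE (I : Type) (s : seq I) (G : I -> section F) x :
  (\sum_(i <- s) G i) x = \sum_(i <- s) G i x.
Proof. by elim/big_rec2: _ => // i y1 y2 _ <-. Qed.

Lemma secP X Y : (forall x, X x = Y x) -> X = Y.
Proof. exact: functional_extensionality_dep. Qed.

Definition secE := (secDE, secNE, sec0E, secZE, fscaleE, sec_sumE).
End Sections.

Section BundleSections.
Variables (R : realType) (n : nat) (M : manifold R n).
Variables (r : nat) (A : vbundle M r).
Local Notation dom j := (@triv_dom _ _ _ _ A j).

Lemma open_dom (j : triv_idx A) : open (dom j).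
Proof. exact: triv_dom_open. Qed.

Lemma gsecZD (c : R) (X Y : section A) : gsec X -> gsec Y -> gsec (c *: X + Y).
Proof.
move=> gX gY j; have [g [sg Xg]] := gX j; have [h [sh Yh]] := gY j.
have o : open (setT `&` dom j) by apply: openI; [exact: openT|exact: open_dom].
exists (fun a x => c * g a x + h a x); split.
  by move=> a; apply: smooth_funD => //; apply: smooth_funZ.
move=> x _ dx; rewrite secDE secZE Xg// Yh// scaler_sumr -big_split /=.
by apply: eq_bigr => a _; rewrite scalerDl scalerA.
Qed.

Lemma gsec0 : gsec (0 : section A).
Proof.
move=> j; exists (fun _ _ => 0); split; first by move=> a; apply: smooth_fun_cst.
by move=> x _ _; rewrite big1// => a _; rewrite scale0r.
Qed.

Lemma gsecD (X Y : section A) : gsec X -> gsec Y -> gsec (X + Y).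
Proof. by move=> gX gY; rewrite -[X]scale1r; apply: gsecZD. Qed.

Lemma gsecZ c (X : section A) : gsec X -> gsec (c *: X).
Proof. by move=> gX; rewrite -[_ *: _]addr0; apply: gsecZD gX gsec0. Qed.

Lemma gsecN (X : section A) : gsec X -> gsec (- X).
Proof. by move=> gX; rewrite -scaleN1r; apply: gsecZ. Qed.

Lemma gsecB (X Y : section A) : gsec X -> gsec Y -> gsec (X - Y).
Proof. by move=> gX gY; apply: gsecD => //; apply: gsecN. Qed.

Lemma gsec_fscale f (X : section A) : smoothM f -> gsec X -> gsec (fscale f X).
Proof.
move=> sf gX j; have [g [sg Xg]] := gX j.
have o : open (setT `&` dom j) by apply: openI; [exact: openT|exact: open_dom].
exists (fun a x => f x * g a x); split.
  by move=> a; apply: smooth_funM => //; apply: sub_smooth_fun sf.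
move=> x _ dx; rewrite fscaleE Xg// scaler_sumr.
by apply: eq_bigr => a _; rewrite scalerA.
Qed.

Lemma fib_linear_sum (V W : lmodType R) (f : V -> W) :
  (forall c u v, f (c *: u + v) = c *: f u + f v) ->
  forall (I : Type) (s : seq I) (c : I -> R) (v : I -> V),
  f (\sum_(i <- s) c i *: v i) = \sum_(i <- s) c i *: f (v i).
Proof.
move=> fl I s c v.
have f0 : f 0 = 0 by have := fl 1 0 0; rewrite !scale1r addr0; exact: add_idem0.
by elim: s => [|i s IH]; rewrite ?big_nil// !big_cons fl IH.
Qed.

Lemma gsec_tapp (N : forall x, A x -> A x) X : tensor11 N -> gsec X -> gsec (tapp N X).
Proof.
move=> [Nl Ns] gX j; have [g [sg Xg]] := gX j.
have H a : exists h : 'I_r -> M -> R, (forall b, smooth_fun (dom j) (h b)) /\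
    forall x, dom j x -> N x (frame j a x) = \sum_(b < r) h b x *: frame j b x.
  have [h [sh Nh]] := Ns j a j.
  exists h; split; last by move=> x dx; apply: Nh.
  by move=> b; apply: sub_smooth_fun (sh b) => x dx; split.
have [h Hh] := choice H.
have o : open (setT `&` dom j) by apply: openI; [exact: openT|exact: open_dom].
exists (fun b x => \sum_(a < r) g a x * h a b x); split.
  move=> b; apply: (@smooth_fun_sum _ _ _ _ _ _ (fun a x => g a x * h a b x)) => // a.
  by apply: smooth_funM => //; apply: sub_smooth_fun ((Hh a).1 b) => x [].
move=> x _ dx; rewrite /tapp Xg// (fib_linear_sum (Nl x)).
rewrite (eq_bigr (fun a => \sum_(b < r) (g a x * h a b x) *: frame j b x)); last first.
  by move=> a _; rewrite (Hh a).2// scaler_sumr; apply: eq_bigr => b _; rewrite scalerA.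
by rewrite exchange_big; apply: eq_bigr => b _; rewrite scaler_suml.
Qed.

Lemma smooth_covec (alpha : forall x, A x -> R) X :
  covec alpha -> gsec X -> smoothM (fun x => alpha x (X x)).
Proof.
move=> [al sa] gX; apply: smooth_fun_local => x _.
have [j dx] := @triv_cover _ _ _ _ A x; exists (dom j); split => //.
have [g [sg Xg]] := gX j.
apply: (@eq_smooth_fun _ _ _ _ (fun x => \sum_(a < r) g a x * alpha x (frame j a x))).
- exact: open_dom.
- by move=> y dy; rewrite Xg// (@fib_linear_sum _ R^o _ (al y)).
- apply: smooth_fun_sum; first exact: open_dom.
  move=> a; apply: smooth_funM => //; first exact: open_dom.
  by apply: sub_smooth_fun (sg a) => y dy; split.
Qed.

Lemma covec_transpose (N : forall x, A x -> A x) alpha :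
  tensor11 N -> covec alpha -> covec (transpose N alpha).
Proof.
move=> [Nl Ns] [al sa]; split; first by move=> x c u v; rewrite /transpose Nl al.
move=> j a; have [h [sh Nh]] := Ns j a j.
have o := open_dom j.
apply: (@eq_smooth_fun _ _ _ _ (fun x => \sum_(b < r) h b x * alpha x (frame j b x)))
  => //.
  by move=> y dy; rewrite /transpose Nh// (@fib_linear_sum _ R^o _ (al y)).
apply: smooth_fun_sum => // b; apply: smooth_funM => //.
by apply: sub_smooth_fun (sh b) => x dx; split.
Qed.

Lemma gsec_cutoff_frame j a x phi : cutoff (dom j) x phi ->
  gsec (fscale phi (@frame _ _ _ _ A j a)).
Proof.
move=> bphi k; have [g [sg fg]] := @frame_smooth _ _ _ _ A k j a.
exists (fun b y => phi y * g b y); split.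
  move=> b; apply: (@sub_smooth_fun _ _ _ _ (dom k)); first by move=> y [].
  exact: (smooth_fun_cutoff (open_dom k) (open_dom j) bphi (sg b)).
move=> y _ dky; rewrite fscaleE; have [djy|ndjy] := pselect (dom j y).
  by rewrite fg// scaler_sumr; apply: eq_bigr => b _; rewrite scalerA.
rewrite (cutoff_out bphi ndjy) scale0r big1// => b _.
by rewrite mul0r scale0r.
Qed.

(* Junk outside [triv_dom j], where the frame need not be a basis. *)
Definition frame_coord (j : triv_idx A) (a : 'I_r) (x : M) (v : A x) : R :=
  (xget 0 [set c : 'rV[R]_r | v = \sum_(b < r) c 0 b *: frame j b x]) 0 a.

Lemma frame_coordP j x (v : A x) : dom j x ->
  v = \sum_(a < r) frame_coord j a v *: frame j a x.
Proof.
move=> dx; have [c [Hc _]] := frame_basis dx v.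
by rewrite /frame_coord; case: xgetP => [c' _ //|/(_ c)].
Qed.

Lemma frame_coord_uniq j x (v : A x) (c : 'I_r -> R) : dom j x ->
  v = \sum_(a < r) c a *: frame j a x -> forall a, frame_coord j a v = c a.
Proof.
move=> dx Hv a; have [c0 [_ U]] := frame_basis dx v.
have E1 : c0 = \row_a frame_coord j a v.
  by apply: U; rewrite [LHS](frame_coordP v dx); apply: eq_bigr => b _; rewrite mxE.
have E2 : c0 = \row_a c a by apply: U; rewrite [LHS]Hv; apply: eq_bigr => b _;
  rewrite mxE.
by move: E1; rewrite E2 => /rowP/(_ a); rewrite !mxE.
Qed.

Lemma frame_coord_linear j a x (c : R) (u v : A x) : dom j x ->
  frame_coord j a (c *: u + v) = c * frame_coord j a u + frame_coord j a v.
Proof.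
move=> dx; apply: (frame_coord_uniq (c := fun a => c * frame_coord j a u + frame_coord
  j a v)) => //.
rewrite {1}(frame_coordP u dx) {1}(frame_coordP v dx) scaler_sumr -big_split /=.
by apply: eq_bigr => b _; rewrite scalerDl scalerA.
Qed.

Lemma covec_cutoff_coord j a x phi : cutoff (dom j) x phi ->
  covec (fun y v => phi y * frame_coord j a (v : A y)).
Proof.
move=> bphi; split=> [y c u v|k b].
  have [dy|ndy] := pselect (dom j y); first by rewrite frame_coord_linear//; ring.
  by rewrite (cutoff_out bphi ndy); ring.
have [g [sg fg]] := @frame_smooth _ _ _ _ A j k b.
apply: (smooth_fun_cutoff (f := g a) (open_dom k) (open_dom j) bphi).
  by rewrite setIC; apply: sg.
by move=> y dk dj; apply/esym/(frame_coord_uniq (c := fun a => g a y)) => //; apply: fg.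
Qed.

(** Turns hypotheses tested on smooth 1-forms into statements about functionals on a single fibre.
    The coefficients of f in the frame at x are kept constant and cut off. *)
Lemma covec_extend x (f : A x -> R) :
  (forall (c : R) u v, f (c *: u + v) = c * f u + f v) ->
  exists2 alpha : forall y, A y -> R, covec alpha & alpha x = f.
Proof.
move=> fl; have [j dx] := @triv_cover _ _ _ _ A x.
have [phi bphi] := cutoff_exists (open_dom j) dx.
exists (fun y v => \sum_(a < r) f (frame j a x) * (phi y * frame_coord j a v)).
  split=> [y c u v|k b].
    rewrite mulr_sumr -big_split; apply: eq_bigr => a _ /=.
    by rewrite (covec_cutoff_coord a bphi).1; ring.
  apply: smooth_fun_sum; first exact: open_dom.
  move=> a; apply: smooth_funZ; first exact: open_dom.
  exact: (covec_cutoff_coord a bphi).2.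
apply/funext => v; rewrite (cutoff1 bphi) [in RHS](frame_coordP v dx)
  (@fib_linear_sum _ R^o _ fl).
by apply: eq_bigr => a _; rewrite mul1r mulrC.
Qed.

End BundleSections.

Section Multi.
Variables (R : realType) (n : nat) (M : manifold R n).
Variables (r : nat) (A : vbundle M r) (Lam : forall x, exterior (A x)).
Local Notation dom j := (@triv_dom _ _ _ _ A j).
Implicit Types (P Q S : multisec Lam) (X Y : section A) (f : M -> R).

Lemma msDE P Q x : (P + Q) x = P x + Q x. Proof. by []. Qed.
Lemma msNE P x : (- P) x = - P x. Proof. by []. Qed.
Lemma ms0E x : (0 : multisec Lam) x = 0. Proof. by []. Qed.
Lemma msZE (c : R) P x : (c *: P) x = c *: P x. Proof. by []. Qed.
Lemma wedgeE P Q x : wedge P Q x = P x * Q x. Proof. by []. Qed.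
Lemma of_funE f x : of_fun Lam f x = (f x)%:A. Proof. by []. Qed.
Lemma of_secE X x : of_sec Lam X x = ext_in (Lam x) (X x). Proof. by []. Qed.

Lemma ms_sumE (I : Type) (s : seq I) (G : I -> multisec Lam) x :
  (\sum_(i <- s) G i) x = \sum_(i <- s) G i x.
Proof. by elim/big_rec2: _ => // i y1 y2 _ <-. Qed.

Lemma msP P Q : (forall x, P x = Q x) -> P = Q.
Proof. exact: functional_extensionality_dep. Qed.

Definition msE := (msDE, msNE, ms0E, msZE, wedgeE, of_funE, of_secE, ms_sumE).

Lemma wedgeDl P Q S : wedge (P + Q) S = wedge P S + wedge Q S.
Proof. by apply: msP => x; rewrite !msE mulrDl. Qed.
Lemma wedgeDr P Q S : wedge P (Q + S) = wedge P Q + wedge P S.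
Proof. by apply: msP => x; rewrite !msE mulrDr. Qed.
Lemma wedgeNl P Q : wedge (- P) Q = - wedge P Q.
Proof. by apply: msP => x; rewrite !msE mulNr. Qed.
Lemma wedgeNr P Q : wedge P (- Q) = - wedge P Q.
Proof. by apply: msP => x; rewrite !msE mulrN. Qed.
Lemma wedgeZl c P Q : wedge (c *: P) Q = c *: wedge P Q.
Proof. by apply: msP => x; rewrite !msE -scalerAl. Qed.
Lemma wedgeZr c P Q : wedge P (c *: Q) = c *: wedge P Q.
Proof. by apply: msP => x; rewrite !msE -scalerAr. Qed.
Lemma wedge0l P : wedge 0 P = 0.
Proof. by apply: msP => x; rewrite !msE mul0r. Qed.
Lemma wedge0r P : wedge P 0 = 0.
Proof. by apply: msP => x; rewrite !msE mulr0. Qed.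
Lemma wedge_fun f P : wedge (of_fun Lam f) P = fscale f P.
Proof. by apply: msP => x; rewrite !msE -scalerAl mul1r. Qed.
(* [mvec p P] is convertible to [forall j, lmvec j p P]. *)
Definition lmvec (j : triv_idx A) (p : nat) P : Prop :=
  exists g : p.-tuple 'I_r -> M -> R,
    (forall t, smooth_fun (dom j) (g t)) /\
    (forall x, dom j x -> P x = \sum_(t : p.-tuple 'I_r)
       g t x *: \prod_(a <- t) ext_in (Lam x) (frame j a x)).

Lemma eq_lmvec j p P Q : (forall x, dom j x -> P x = Q x) -> lmvec j p P -> lmvec j p Q.
Proof.
by move=> PQ [g [sg Pg]]; exists g; split=> // x dx; rewrite -PQ// Pg.
Qed.

Lemma lmvecZD j p c P Q : lmvec j p P -> lmvec j p Q -> lmvec j p (c *: P + Q).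
Proof.
move=> [g [sg Pg]] [h [sh Qh]]; exists (fun t x => c * g t x + h t x); split.
  move=> t; apply: smooth_funD => //; first exact: open_dom.
  by apply: smooth_funZ => //; apply: open_dom.
move=> x dx; rewrite !msE Pg// Qh// scaler_sumr -big_split /=.
by apply: eq_bigr => t _; rewrite scalerDl scalerA.
Qed.

Lemma lmvec0 j p : lmvec j p 0.
Proof.
exists (fun _ _ => 0); split; first by move=> a; apply: smooth_fun_cst.
by move=> x _; rewrite big1// => a _; rewrite scale0r.
Qed.

Lemma lmvec_sum j p (I : Type) (s : seq I) (G : I -> multisec Lam) :
  (forall i, lmvec j p (G i)) -> lmvec j p (\sum_(i <- s) G i).
Proof.
move=> HG; elim/big_ind: _ => [|P Q HP HQ|//]; first exact: lmvec0.
by rewrite -[P]scale1r; apply: lmvecZD.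
Qed.

Lemma lmvec_prod_frame j p (s : seq 'I_r) f P : size s = p -> smooth_fun (dom j) f ->
  (forall x, dom j x -> P x = f x *: \prod_(a <- s) ext_in (Lam x) (frame j a x)) ->
  lmvec j p P.
Proof.
move=> /eqP ss sf HP; pose u := Tuple ss.
exists (fun t x => (t == u)%:R * f x); split.
  by move=> t; apply: smooth_funZ => //; apply: open_dom.
move=> x dx; rewrite (bigD1 u) //= [X in _ + X]big1 ?addr0 => [|t Ht].
  by rewrite eqxx mul1r HP.
by rewrite (negbTE Ht) mul0r scale0r.
Qed.

Lemma lmvec_wedge j p q P Q : lmvec j p P -> lmvec j q Q -> lmvec j (p + q) (wedge P Q).
Proof.
move=> [g [sg Pg]] [h [sh Qh]].
pose T t u : multisec Lam := fun x => (g t x * h u x) *: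
  \prod_(a <- tval t ++ tval u) ext_in (Lam x) (frame j a x).
apply: (@eq_lmvec j _ (\sum_t \sum_u T t u)).
  move=> x dx; rewrite !msE Pg// Qh// mulr_suml; apply: eq_bigr => t _.
  rewrite !msE mulr_sumr; apply: eq_bigr => u _.
  by rewrite /T big_cat /= -scalerAl -scalerAr scalerA.
apply: lmvec_sum => t; apply: lmvec_sum => u.
apply: (lmvec_prod_frame (s := tval t ++ tval u) (f := fun x => g t x * h u x)) => //.
  by rewrite size_cat !size_tuple.
by apply: smooth_funM => //; apply: open_dom.
Qed.

Lemma lmvec_of_sec j X : smooth_section (dom j) X -> lmvec j 1 (of_sec Lam X).
Proof.
move=> /(_ j)[g [sg Xg]].
pose T a : multisec Lam := fun x => g a x *: ext_in (Lam x) (frame j a x).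
apply: (@eq_lmvec j _ (\sum_(a < r) T a)).
  by move=> x dx; rewrite !msE Xg// linear_sum; apply: eq_bigr => a _; rewrite /T linearZ.
apply: lmvec_sum => a; apply: (lmvec_prod_frame (s := [:: a]) (f := g a)) => //.
  by apply: sub_smooth_fun (sg a) => x dx.
by move=> x dx; rewrite big_seq1.
Qed.

Lemma mvecZD p c P Q : mvec p P -> mvec p Q -> mvec p (c *: P + Q).
Proof. by move=> HP HQ j; apply: lmvecZD; [apply: HP|apply: HQ]. Qed.

Lemma mvec0 p : mvec p (0 : multisec Lam).
Proof. by move=> j; apply: lmvec0. Qed.

Lemma mvecZ p c P : mvec p P -> mvec p (c *: P).
Proof. by move=> HP; rewrite -[_ *: _]addr0; apply: mvecZD HP (@mvec0 p). Qed.

Lemma mvecD p P Q : mvec p P -> mvec p Q -> mvec p (P + Q).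
Proof. by rewrite -{2}[P]scale1r; apply: mvecZD. Qed.

Lemma mvecN p P : mvec p P -> mvec p (- P).
Proof. by rewrite -scaleN1r; apply: mvecZ. Qed.

Lemma mvecB p P Q : mvec p P -> mvec p Q -> mvec p (P - Q).
Proof. by move=> HP HQ; apply: mvecD => //; apply: mvecN. Qed.

Lemma mvec_sum p (I : Type) (s : seq I) (G : I -> multisec Lam) :
  (forall i, mvec p (G i)) -> mvec p (\sum_(i <- s) G i).
Proof. by move=> HG j; apply: lmvec_sum => i; apply: HG. Qed.

Lemma mvec_wedge p q P Q : mvec p P -> mvec q Q -> mvec (p + q) (wedge P Q).
Proof. by move=> HP HQ j; apply: lmvec_wedge; [apply: HP|apply: HQ]. Qed.

Lemma mvec_of_fun f : smoothM f -> mvec 0 (of_fun Lam f).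
Proof.
move=> sf j; apply: (lmvec_prod_frame (s := [::]) (f := f)) => //.
  exact: sub_smooth_fun sf.
by move=> x dx; rewrite big_nil.
Qed.

Lemma mvec_of_sec X : gsec X -> mvec 1 (of_sec Lam X).
Proof.
move=> gX j; apply: lmvec_of_sec => k; have [g [sg Xg]] := gX k.
exists g; split=> [a|x _ dx]; last exact: Xg.
by apply: sub_smooth_fun (sg a) => x [_ dx].
Qed.

Lemma mvec_fscale p f P : smoothM f -> mvec p P -> mvec p (fscale f P).
Proof. by move=> sf HP; rewrite -wedge_fun; exact: (mvec_wedge (mvec_of_fun sf) HP). Qed.

Definition wedge_secs (s : seq (section A)) : multisec Lam :=
  foldr (fun X => wedge (of_sec Lam X)) (of_fun Lam (fun=> 1)) s.

Lemma mvec_wedge_secs s : (forall i, (i < size s)%N -> gsec (nth 0 s i)) ->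
  mvec (size s) (wedge_secs s).
Proof.
elim: s => [|X s IH] Hs /=; first by apply: mvec_of_fun; apply: smooth_fun_cst.
rewrite -add1n; apply: mvec_wedge; first by apply: mvec_of_sec; apply: (Hs 0%N).
by apply: IH => i; apply: (Hs i.+1).
Qed.

(* The cutoff is a power p + 1: one factor extends the coefficient, the others
   the p frame vectors. *)
Lemma mvec_decomp p P x : mvec p P ->
  exists phi : M -> R, [/\ smoothM phi, phi x = 1 &
  exists (g : p.-tuple 'I_r -> M -> R) (e : 'I_r -> section A),
  [/\ forall t, smoothM (g t), forall a, gsec (e a) &
   fscale phi P = \sum_t fscale (g t) (wedge_secs [seq e a | a <- t])]].
Proof.
move=> HP; have [j dx] := @triv_cover _ _ _ _ A x.
have [phi bphi] := cutoff_exists (open_dom j) dx.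
have sphi k : smoothM (fun x => phi x ^+ k).
  elim: k => [|k IH]; first exact: smooth_fun_cst.
  apply: (@eq_smooth_fun _ _ _ _ (fun x => phi x * phi x ^+ k)) => //; first exact: openT.
    by move=> y _; rewrite exprS.
  by apply: smooth_funM IH => //; [apply: openT|case: bphi].
exists (fun x => phi x ^+ p.+1); split; first exact: sphi.
  by rewrite (cutoff1 bphi) expr1n.
have [g [sg Pg]] := HP j.
exists (fun t y => phi y * g t y), (fun a => fscale phi (frame j a)); split.
- move=> t; apply: (smooth_fun_cutoff (f := g t) openT (open_dom j) bphi) => //.
  by apply: sub_smooth_fun (sg t) => y [].
- by move=> a; apply: gsec_cutoff_frame bphi.
apply: msP => y; rewrite ms_sumE.
have [dy|ndy] := pselect (dom j y); last first.
  rewrite fscaleE (cutoff_out bphi ndy) exprS mul0r scale0r big1// => t _.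
  by rewrite fscaleE (cutoff_out bphi ndy) mul0r scale0r.
rewrite fscaleE Pg// scaler_sumr; apply: eq_bigr => t _.
suff W : wedge_secs [seq fscale phi (frame j a) | a <- t] y =
    phi y ^+ size t *: \prod_(a <- t) ext_in (Lam y) (frame j a y).
  by rewrite fscaleE W !scalerA size_tuple exprS; congr (_ *: _); ring.
elim: (tval t) => [|a s IH] /=; first by rewrite expr0 big_nil msE scale1r.
by rewrite big_cons exprS !msE fscaleE linearZ /= IH -scalerAl -scalerAr scalerA.
Qed.

(* For a cutoff phi, D (phi P) = phi D P because D kills functions; hence phi
   need not be constant near the point. *)
Lemma derivation_zero (D : multisec Lam -> multisec Lam) (e : int) :
  (forall p c P Q, mvec p P -> mvec p Q -> D (c *: P + Q) = c *: D P + D Q) ->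
  (forall p q P Q, mvec p P -> mvec q Q ->
     D (wedge P Q) = wedge (D P) Q + (-1) ^ (p%:Z * e) *: wedge P (D Q)) ->
  (forall f, smoothM f -> D (of_fun Lam f) = 0) ->
  (forall X, gsec X -> D (of_sec Lam X) = 0) ->
  forall p P, mvec p P -> D P = 0.
Proof.
move=> Dl Dw Df DX p P HP; apply: msP => x.
have D0 : D 0 = 0.
  have := Dl 0%N 1 0 0 (@mvec0 _) (@mvec0 _).
  by rewrite !scale1r addr0; exact: add_idem0.
have Dsum q (I : Type) (s : seq I) G : (forall i, mvec q (G i)) ->
    (forall i, D (G i) = 0) -> D (\sum_(i <- s) G i) = 0.
  move=> mG DG; elim: s => [|i s IH]; first by rewrite big_nil.
  rewrite big_cons -[G i]scale1r (Dl q)// ?DG ?IH ?scaler0 ?addr0//.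
  exact: mvec_sum.
have [phi [sphi phix [g [ee [sg ge E]]]]] := mvec_decomp x HP.
have : D (fscale phi P) = 0.
  rewrite E; apply: (Dsum p) => t.
    apply: mvec_fscale => //; rewrite -{1}(size_tuple t) -(size_map ee).
    apply: mvec_wedge_secs => i; rewrite size_map => it.
    have a0 : 'I_r by case: (tval t) it => [//|a].
    by rewrite (nth_map a0).
  rewrite -wedge_fun.
  have [m W0] : mvec (size t) (wedge_secs [seq ee a | a <- t])
    /\ D (wedge_secs [seq ee a | a <- t]) = 0.
    elim: (tval t) => [|a s [IH1 IH2]] /=.
      by split; [apply: mvec_of_fun|apply: Df]; apply: smooth_fun_cst.
    split; first by rewrite -add1n; apply: mvec_wedge IH1; apply: mvec_of_sec.
    by rewrite (Dw 1%N (size s))// ?DX ?IH2 ?wedge0l ?wedge0r ?scaler0 ?addr0//;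
      apply: mvec_of_sec.
  rewrite (Dw 0%N (size t))// ?Df ?W0 ?wedge0l ?wedge0r ?scaler0 ?addr0//.
  exact: mvec_of_fun.
rewrite -wedge_fun (Dw 0%N p)//; last exact: mvec_of_fun.
rewrite Df// wedge0l add0r mul0r expr0z scale1r wedge_fun => /(congr1 (fun P => P x)).
by rewrite fscaleE phix scale1r.
Qed.

End Multi.

(** * Graded brackets *)

Section Abel.
Variable V : zmodType.

Inductive zterm :=
  ZVar of nat | ZZero | ZAdd of zterm & zterm | ZOpp of zterm | ZMuln of zterm & nat.

Fixpoint zeval (env : seq V) (t : zterm) : V :=
  match t with
  | ZVar i => nth 0 env i
  | ZZero => 0
  | ZAdd a b => zeval env a + zeval env b
  | ZOpp a => - zeval env a
  | ZMuln a k => zeval env a *+ k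
  end.

Fixpoint zcoef (t : zterm) (i : nat) : int :=
  match t with
  | ZVar j => if j == i then 1 else 0
  | ZZero => 0
  | ZAdd a b => zcoef a i + zcoef b i
  | ZOpp a => - zcoef a i
  | ZMuln a k => zcoef a i * k%:Z
  end.

Lemma zevalE env t : zeval env t = \sum_(i < size env) nth 0 env i *~ zcoef t i.
Proof.
elim: t => [j||a IHa b IHb|a IHa|a IHa k] /=.
- have [js|js] := ltnP j (size env); last first.
    rewrite nth_default// big1// => i _; case: eqP => // E.
    by have := ltn_ord i; rewrite -E ltnNge js.
  rewrite (bigD1 (Ordinal js)) //= eqxx [X in _ + X]big1 ?addr0// => i /negbTE ij.
  by case: eqP => // E; move: ij; rewrite -val_eqE /= E eqxx.
- by rewrite big1.
- by rewrite IHa IHb -big_split; apply: eq_bigr => i _; rewrite mulrzDr.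
- by rewrite IHa -sumrN; apply: eq_bigr => i _; rewrite mulrNz.
- by rewrite IHa -sumrMnl; apply: eq_bigr => i _; rewrite pmulrn -mulrzA.
Qed.

(** Compares the integer coefficients of each atom. These are closed terms, so the premise is
    settled by computation. *)
Lemma abelP env a b :
  all (fun i => zcoef a i == zcoef b i) (iota 0 (size env)) -> zeval env a = zeval env b.
Proof.
move=> /allP H; rewrite !zevalE; apply: eq_bigr => i _.
by have /eqP -> : zcoef a i == zcoef b i by apply: H; rewrite mem_iota /=.
Qed.
End Abel.

(* Scaled atoms are compared up to conversion, because the same scaling may be
   reached through different structures. *)
Ltac abel_index x env :=
  match env with
  | x :: _ => constr:(0%N)
  | ?y :: _ =>
      let _ := lazymatch x with GRing.scale _ _ => idtac end in
      let _ := lazymatch y with GRing.scale _ _ => idtac end in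
      let _ := match x with _ => unify x y end in
      constr:(0%N)
  | _ :: ?env' => let i := abel_index x env' in constr:(i.+1)
  end.

Ltac abel_env t env :=
  match t with
  | GRing.zero => env
  | GRing.add ?a ?b => let env' := abel_env a env in abel_env b env'
  | GRing.opp ?a => abel_env a env
  | GRing.natmul ?a _ => abel_env a env
  | _ => match env with
         | _ => let _ := abel_index t env in env
         | _ => constr:(t :: env)
         end
  end.

Ltac abel_term t env :=
  match t with
  | GRing.zero => constr:(ZZero)
  | GRing.add ?a ?b =>
      let a' := abel_term a env in let b' := abel_term b env in constr:(ZAdd a' b')
  | GRing.opp ?a => let a' := abel_term a env in constr:(ZOpp a')
  | GRing.natmul ?a ?k => let a' := abel_term a env in constr:(ZMuln a' k)
  | _ => let i := abel_index t env in constr:(ZVar i)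
  end.

Ltac abel :=
  lazymatch goal with
  | |- @eq ?V ?a ?b =>
      let env0 := abel_env a (@nil V) in
      let env := abel_env b env0 in
      let a' := abel_term a env in
      let b' := abel_term b env in
      apply: (@abelP _ env a' b'); vm_compute; reflexivity
  end.

Section Signs.
Variable R : realType.
Implicit Types a b : int.

Definition oddz a := odd `|a|%N.

Lemma expN1E a : (-1 : R) ^ a = if oddz a then -1 else 1.
Proof.
have H k : (-1 : R) ^+ k = if odd k then -1 else 1.
  by rewrite -signr_odd; case: odd; rewrite ?expr0 ?expr1.
by case: a => k; rewrite ?NegzE -?exprz_inv ?invrN1 -exprnP H /oddz ?abszN.
Qed.

Lemma oddzN a : oddz (- a) = oddz a.
Proof. by rewrite /oddz abszN. Qed.

Lemma oddzD a b : oddz (a + b) = oddz a (+) oddz b.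
Proof.
have H c : (oddz c : nat)%:Z = c %% 2 :> int by rewrite /oddz; lia.
have := H (a + b); have := H a; have := H b.
by case: (oddz a); case: (oddz b); case: (oddz _) => //=; lia.
Qed.

Lemma oddzM a b : oddz (a * b) = oddz a && oddz b.
Proof. by rewrite /oddz abszM oddM. Qed.

Lemma oddz0 : oddz 0 = false. Proof. by []. Qed.
Lemma oddz1 : oddz 1 = true. Proof. by []. Qed.
Lemma oddz2 : oddz 2 = false. Proof. by []. Qed.
End Signs.

(* [signs] reduces every [(-1) ^ a] to the parities of the variables of [a];
   [unsign] removes the signs once [parity] has determined these. *)
Ltac signs := rewrite ?expN1E ?(oddzD, oddzM, oddzN, oddz0, oddz1, oddz2).
Ltac parity a := case: (oddz a).
Ltac unsign := cbv beta iota delta [addb andb negb]; rewrite ?scaleN1r ?scale1r.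

Section GradedBracket.
Variables (R : realType) (E : lmodType R).

(* A graded antisymmetric bracket of degree 1, for the grading shifted by one:
   [x] of degree [d] has parity [d + 1]. *)
Record graded_bracket (gr : int -> set E) (br : E -> E -> E) : Prop := GradedBracket {
  gb0 : forall d, gr d 0;
  gbZD : forall d (c : R) x y, gr d x -> gr d y -> gr d (c *: x + y);
  gb_lin : forall d e (c : R) x x' y, gr d x -> gr d x' -> gr e y ->
    br (c *: x + x') y = c *: br x y + br x' y;
  gb_br : forall d e x y, gr d x -> gr e y -> gr (d + e + 1) (br x y);
  gb_anti : forall d e x y, gr d x -> gr e y ->
    br x y = - ((-1) ^ ((d + 1) * (e + 1)) *: br y x)
}.

Variables (gr : int -> set E) (br : E -> E -> E).
Hypothesis G : graded_bracket gr br.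

Lemma gb_cast d e x : gr d x -> d = e -> gr e x.
Proof. by move=> + <-. Qed.

Lemma gbD d x y : gr d x -> gr d y -> gr d (x + y).
Proof. by rewrite -{2}[x]scale1r; apply: gbZD G _ _ _ _. Qed.

Lemma gbZ d c x : gr d x -> gr d (c *: x).
Proof. by move=> dx; rewrite -[_ *: _]addr0; apply: gbZD G _ _ _ _ dx (gb0 G d). Qed.

Lemma gbN d x : gr d x -> gr d (- x).
Proof. by rewrite -scaleN1r; apply: gbZ. Qed.

Lemma gbMn d x k : gr d x -> gr d (x *+ k).
Proof. by rewrite -scaler_nat; apply: gbZ. Qed.

Lemma gbDl d e x x' y : gr d x -> gr d x' -> gr e y -> br (x + x') y = br x y + br x' y.
Proof. by move=> *; rewrite -[x]scale1r (gb_lin G (d := d) (e := e))// !scale1r. Qed.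

Lemma gb0l e y : gr e y -> br 0 y = 0.
Proof.
move=> ey; have := gbDl (gb0 G 0) (gb0 G 0) ey; rewrite addr0; exact: add_idem0.
Qed.

Lemma gbZl d e c x y : gr d x -> gr e y -> br (c *: x) y = c *: br x y.
Proof.
move=> dx ey; rewrite -[_ *: _]addr0 (gb_lin G _ dx (gb0 G d) ey) (gb0l ey).
by rewrite addr0.
Qed.

Lemma gbNl d e x y : gr d x -> gr e y -> br (- x) y = - br x y.
Proof. by move=> dx ey; rewrite -scaleN1r (gbZl _ dx ey) scaleN1r. Qed.

Lemma gbMnl d e x y k : gr d x -> gr e y -> br (x *+ k) y = br x y *+ k.
Proof. by move=> dx ey;
  rewrite -(scaler_nat k x) -(scaler_nat k (br x y)) (gbZl _ dx ey). Qed.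

Lemma gb0r e y : gr e y -> br y 0 = 0.
Proof. by move=> ey; rewrite (gb_anti G ey (gb0 G 0)) (gb0l ey) scaler0 oppr0. Qed.

Lemma gb_linr d e c x y y' : gr d x -> gr e y -> gr e y' ->
  br x (c *: y + y') = c *: br x y + br x y'.
Proof.
move=> dx ey ey'; rewrite (gb_anti G dx (gbZD G _ ey ey')) (gb_lin G _ ey ey' dx).
rewrite (gb_anti G dx ey) (gb_anti G dx ey') scalerDr opprD scalerN; congr (- _ + _).
by rewrite !scalerA mulrC.
Qed.

Lemma gbDr d e x y y' : gr d x -> gr e y -> gr e y' -> br x (y + y') = br x y + br x y'.
Proof. by move=> *; rewrite -[y]scale1r (gb_linr (d := d) (e := e))// !scale1r. Qed.

Lemma gbZr d e c x y : gr d x -> gr e y -> br x (c *: y) = c *: br x y.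
Proof.
move=> dx ey; rewrite -[_ *: _]addr0 (gb_linr _ dx ey (gb0 G e)) (gb0r dx).
by rewrite addr0.
Qed.

Lemma gbNr d e x y : gr d x -> gr e y -> br x (- y) = - br x y.
Proof. by move=> dx ey; rewrite -scaleN1r (gbZr _ dx ey) scaleN1r. Qed.

Lemma gbMnr d e x y k : gr d x -> gr e y -> br x (y *+ k) = br x y *+ k.
Proof. by move=> dx ey;
  rewrite -(scaler_nat k y) -(scaler_nat k (br x y)) (gbZr _ dx ey). Qed.

End GradedBracket.

(* [hom_with G] proves [gr d x] by computing the degree of [x]; [extra] handles
   the operations other than [br]. *)
Ltac hom_infer G extra :=
  first
  [ eassumption
  | extra tt
  | lazymatch goal with
    | |- _ (_ + _) => eapply (gbD G); [hom_infer G extra | eapply gb_cast;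
      [hom_infer G extra | lia]]
    | |- _ (- _) => eapply (gbN G); hom_infer G extra
    | |- _ (_ *: _) => eapply (gbZ G); hom_infer G extra
    | |- _ (_ *+ _) => eapply (gbMn G); hom_infer G extra
    | |- _ => eapply (gb_br G); [hom_infer G extra | hom_infer G extra]
    end ].

Ltac hom_with G extra := eapply gb_cast; [hom_infer G extra | lia].

(** [br] is additive only on homogeneous elements of equal degree, so every rewriting step carries
    proofs of homogeneity: the degree is inferred from one summand and the other summand is cast to
    it. *)
Ltac expand_with G br extra :=
  repeat match goal with
  | |- context [br (?a + ?b) ?c] =>
      let H := fresh in
      eassert (H : br (a + b) c = _) by
        (eapply (gbDl G); [hom_infer G extra | hom_with G extra | hom_infer G extra]);
      rewrite H; clear H
  | |- context [br (- ?a) ?c] =>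
      let H := fresh in
      eassert (H : br (- a) c = _) by (eapply (gbNl G); hom_infer G extra);
      rewrite H; clear H
  | |- context [br (?a *+ ?k) ?c] =>
      let H := fresh in
      eassert (H : br (a *+ k) c = _) by (eapply (gbMnl G); hom_infer G extra);
      rewrite H; clear H
  | |- context [br (?k *: ?a) ?c] =>
      let H := fresh in
      eassert (H : br (k *: a) c = _) by (eapply (gbZl G); hom_infer G extra);
      rewrite H; clear H
  | |- context [br ?c (?a + ?b)] =>
      let H := fresh in
      eassert (H : br c (a + b) = _) by
        (eapply (gbDr G); [hom_infer G extra | hom_infer G extra | hom_with G extra]);
      rewrite H; clear H
  | |- context [br ?c (- ?a)] =>
      let H := fresh in
      eassert (H : br c (- a) = _) by (eapply (gbNr G); hom_infer G extra);
      rewrite H; clear H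
  | |- context [br ?c (?a *+ ?k)] =>
      let H := fresh in
      eassert (H : br c (a *+ k) = _) by (eapply (gbMnr G); hom_infer G extra);
      rewrite H; clear H
  | |- context [br ?c (?k *: ?a)] =>
      let H := fresh in
      eassert (H : br c (k *: a) = _) by (eapply (gbZr G); hom_infer G extra);
      rewrite H; clear H
  end.

Section Jacobiator.
Variables (R : realType) (E : lmodType R) (gr : int -> set E) (br : E -> E -> E).
Hypothesis G : graded_bracket gr br.

(** The Jacobi identity in Leibniz form: bracketing with x is a derivation of the bracket. The
    degrees are arguments because an element does not determine its degree, 0 lying in all of
    them. *)
Definition jacobiator (d e : int) (x y z : E) : E :=
  br x (br y z) - br (br x y) z - (-1) ^ ((d + 1) * (e + 1)) *: br y (br x z).

Ltac expand := expand_with G br ltac:(fun _ => fail).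

Lemma jacobiator_linear d e f c x y z z' : gr d x -> gr e y -> gr f z -> gr f z' ->
  jacobiator d e x y (c *: z + z') = c *: jacobiator d e x y z + jacobiator d e x y z'.
Proof.
move=> dx ey fz fz'; rewrite /jacobiator; expand.
signs; parity d; parity e; unsign; rewrite ?scalerDr ?scalerN; abel.
Qed.

(** Together with [jacobiator_swapl], this makes vanishing independent of the order of the
    arguments, so a reduction carried out in the last slot applies to every slot. *)
Lemma jacobiator_swapr d e f x y z : gr d x -> gr e y -> gr f z ->
  jacobiator d e x y z = - ((-1) ^ ((e + 1) * (f + 1)) *: jacobiator d f x z y).
Proof.
move=> dx ey fz; rewrite /jacobiator.
rewrite (gb_anti G (gb_br G dx ey) fz) (gb_anti G ey (gb_br G dx fz)).
rewrite (gb_anti G ey fz); expand.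
by signs; parity d; parity e; parity f; unsign; abel.
Qed.

Lemma jacobiator_swapl d e f x y z : gr d x -> gr e y -> gr f z ->
  jacobiator d e x y z = - ((-1) ^ ((d + 1) * (e + 1)) *: jacobiator e d y x z).
Proof.
move=> dx ey fz; rewrite /jacobiator (gb_anti G dx ey); expand.
by signs; parity d; parity e; unsign; abel.
Qed.

End Jacobiator.

(** * The Schouten bracket *)

Section LieBracket.
Variables (R : realType) (n : nat) (M : manifold R n).
Variables (r : nat) (A : vbundle M r) (T : lie_algebroid A).
Implicit Types (X Y Z : section A) (f : M -> R).

Lemma lbrDl X Y Z : gsec X -> gsec Y -> gsec Z -> lbr T (X + Y) Z = lbr T X Z + lbr T Y Z.
Proof. by move=> gX gY gZ; rewrite -[X]scale1r lbr_linear// !scale1r. Qed.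

Lemma lbr0l Z : gsec Z -> lbr T 0 Z = 0.
Proof.
move=> gZ; have := lbrDl (@gsec0 _ _ _ _ A) (@gsec0 _ _ _ _ A) gZ; rewrite addr0;
  exact: add_idem0.
Qed.

Lemma lbrNl X Z : gsec X -> gsec Z -> lbr T (- X) Z = - lbr T X Z.
Proof.
move=> gX gZ; rewrite -scaleN1r -[_ *: _]addr0 lbr_linear//; last exact: gsec0.
by rewrite lbr0l// addr0 scaleN1r.
Qed.

Lemma lbrDr X Y Z : gsec X -> gsec Y -> gsec Z -> lbr T Z (X + Y) = lbr T Z X + lbr T Z Y.
Proof.
move=> gX gY gZ; rewrite lbr_anti//; last exact: gsecD.
by rewrite lbrDl// opprD -!lbr_anti.
Qed.

Lemma lbrNr X Z : gsec X -> gsec Z -> lbr T Z (- X) = - lbr T Z X.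
Proof.
move=> gX gZ; rewrite lbr_anti//; last exact: gsecN.
by rewrite lbrNl// opprK lbr_anti.
Qed.

Lemma lbr_fscalel f X Y : smoothM f -> gsec X -> gsec Y ->
  lbr T (fscale f X) Y = fscale f (lbr T X Y) - fscale (anc (anchor T) Y f) X.
Proof.
move=> sf gX gY; rewrite lbr_anti//; last exact: gsec_fscale.
rewrite lbr_leibniz// opprD; congr (_ - _).
by rewrite [in RHS]lbr_anti//; apply: secP => x; rewrite !secE scalerN.
Qed.

End LieBracket.

Section Schouten.
Variables (R : realType) (n : nat) (M : manifold R n).
Variables (r : nat) (A : vbundle M r) (Lam : forall x, exterior (A x)).
Implicit Types (P Q S : multisec Lam) (X Y : section A) (f : M -> R).

Lemma mgr_mvec p P : mvec p P -> mgr Lam (p%:Z - 2) P.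
Proof. by move=> HP; right; exists p. Qed.

Lemma mgr0 d : mgr Lam d 0.
Proof. by left. Qed.

Lemma mgr_pair d P Q : mgr Lam d P -> mgr Lam d Q ->
  (exists p : nat, [/\ d = p%:Z - 2, mvec p P & mvec p Q]) \/ (P = 0 /\ Q = 0).
Proof.
move=> [->|[p dp HP]] [->|[q dq HQ]]; first by right.
- by left; exists q; split=> //; apply: mvec0.
- by left; exists p; split=> //; apply: mvec0.
- left; exists p; split=> //; have -> // : p = q by lia.
Qed.

(** The alternative is needed since 0 also lies in degrees that are not of the form p - 2; it is
    then regarded as a function. *)
Lemma mgr_single d P : mgr Lam d P ->
  exists2 p : nat, mvec p P & d = p%:Z - 2 \/ P = 0.
Proof.
move=> [->|[p dp HP]]; first by exists 0%N; [apply: mvec0|right].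
by exists p => //; left.
Qed.

Lemma mgrZD d c P Q : mgr Lam d P -> mgr Lam d Q -> mgr Lam d (c *: P + Q).
Proof.
move=> HP HQ; have [[p [-> mP mQ]]|[-> ->]] := mgr_pair HP HQ.
  by apply/mgr_mvec/mvecZD.
by rewrite scaler0 addr0; apply: mgr0.
Qed.

Lemma mgr_wedge d e P Q : mgr Lam d P -> mgr Lam e Q -> mgr Lam (d + e + 2) (wedge P Q).
Proof.
move=> [->|[p -> HP]]; first by rewrite wedge0l => _; apply: mgr0.
move=> [->|[q -> HQ]]; first by rewrite wedge0r; apply: mgr0.
by right; exists (p + q)%N; [lia|apply: mvec_wedge].
Qed.

Lemma mgr_of_fun f : smoothM f -> mgr Lam (-2) (of_fun Lam f).
Proof. by move=> sf; right; exists 0%N => //; apply: mvec_of_fun. Qed.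

Lemma mgr_of_sec X : gsec X -> mgr Lam (-1) (of_sec Lam X).
Proof. by move=> gX; right; exists 1%N => //; apply: mvec_of_sec. Qed.

Lemma of_secD X Y : of_sec Lam (X + Y) = of_sec Lam X + of_sec Lam Y.
Proof. by apply: msP => x; rewrite !msE linearD. Qed.

Lemma of_secN X : of_sec Lam (- X) = - of_sec Lam X.
Proof. by apply: msP => x; rewrite !msE linearN. Qed.

Lemma of_sec0 : of_sec Lam (0 : section A) = 0.
Proof. by apply: msP => x; rewrite !msE linear0. Qed.

Variables (T : lie_algebroid A) (sn : multisec Lam -> multisec Lam -> multisec Lam).
Hypothesis H : is_schouten T sn.

Lemma schouten_graded : graded_bracket (mgr Lam) sn.
Proof.
have [Hl Hd Ha Hw Hg] := H.
have sn0l q Q : mvec q Q -> sn 0 Q = 0.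
  move=> mQ; have := Hl 0%N q 1 0 0 Q (@mvec0 _ _ _ _ _ _ _) (@mvec0 _ _ _ _ _ _ _) mQ.
  rewrite !scale1r addr0; exact: add_idem0.
have sn0r q Q : mvec q Q -> sn Q 0 = 0.
  by move=> mQ; rewrite (Ha q 0%N)// ?(sn0l q)// ?scaler0 ?oppr0//; apply: mvec0.
split.
- exact: mgr0.
- exact: mgrZD.
- move=> d e c P P' Q HP HP' HQ; have [q mQ _] := mgr_single HQ.
  have [[p [_ mP mP']]|[-> ->]] := mgr_pair HP HP'; first exact: (Hl p q).
  by rewrite scaler0 addr0 (sn0l q)// scaler0 addr0.
- move=> d e P Q HP HQ.
  have [p mP [dp|P0]] := mgr_single HP; have [q mQ [eq|Q0]] := mgr_single HQ.
  + have [H1 H2] := Hd p q P Q mP mQ.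
    case E : (p + q)%N => [|k]; first by rewrite (H2 E); apply: mgr0.
    by right; exists k; [lia|apply: H1].
  + by rewrite Q0 (sn0r p)//; apply: mgr0.
  + by rewrite P0 (sn0l q)//; apply: mgr0.
  + by rewrite P0 (sn0l q)//; apply: mgr0.
- move=> d e P Q HP HQ.
  have [p mP [dp|P0]] := mgr_single HP; have [q mQ [eq|Q0]] := mgr_single HQ.
  + rewrite (Ha p q)//; congr (- (_ ^ _ *: _)); lia.
  + by rewrite Q0 (sn0r p)// (sn0l p)// scaler0 oppr0.
  + by rewrite P0 (sn0r q)// (sn0l q)// scaler0 oppr0.
  + by rewrite P0 (sn0r q)// (sn0l q)// scaler0 oppr0.
Qed.
Let G := schouten_graded.

Lemma schouten_wedge d e k P Q S : mgr Lam d P -> mgr Lam e Q -> mgr Lam k S ->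
  sn P (wedge Q S) = wedge (sn P Q) S + (-1) ^ ((d + 1) * e) *: wedge Q (sn P S).
Proof.
move=> HP HQ HS; have [_ _ _ Hw _] := H.
have [p mP [dp|P0]] := mgr_single HP; last first.
  rewrite P0 (gb0l G HQ) (gb0l G HS) (gb0l G (mgr_wedge HQ HS)).
  by rewrite wedge0l wedge0r scaler0 addr0.
have [q mQ [eq|Q0]] := mgr_single HQ; last first.
  by rewrite Q0 !wedge0l (gb0r G HP) wedge0l scaler0 addr0.
have [s mS _] := mgr_single HS.
rewrite (Hw p q s)//; congr (_ + _ *: _).
have -> : p%:Z - 1 = d + 1 by lia.
have -> : q%:Z = e + 2 by lia.
rewrite mulrDr expfzDr ?oppr_eq0 ?oner_eq0//;
  suff -> : (-1 : R) ^ ((d + 1) * 2) = 1 by rewrite mulr1.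
by rewrite expN1E oddzM andbF.
Qed.

Lemma sn_fun_fun f g : smoothM f -> smoothM g -> sn (of_fun Lam f) (of_fun Lam g) = 0.
Proof.
move=> sf sg; have [_ Hd _ _ _] := H.
by have [_ ->] := Hd 0%N 0%N _ _ (mvec_of_fun Lam sf) (mvec_of_fun Lam sg).
Qed.

Lemma sn_sec_fun X f : gsec X -> smoothM f ->
  sn (of_sec Lam X) (of_fun Lam f) = of_fun Lam (anc (anchor T) X f).
Proof. by have [_ _ _ _ Hg] := H; move=> /Hg[_ Hf] /Hf. Qed.

Lemma sn_sec_sec X Y : gsec X -> gsec Y ->
  sn (of_sec Lam X) (of_sec Lam Y) = of_sec Lam (lbr T X Y).
Proof. by have [_ _ _ _ Hg] := H; move=> /Hg[Hs _] /Hs. Qed.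

Lemma sn_fun_sec X f : gsec X -> smoothM f ->
  sn (of_fun Lam f) (of_sec Lam X) = - of_fun Lam (anc (anchor T) X f).
Proof.
move=> gX sf; rewrite (gb_anti G (mgr_of_fun sf) (mgr_of_sec gX)) sn_sec_fun//.
by rewrite mulr0 expr0z scale1r.
Qed.

Lemma smooth_anc X f : gsec X -> smoothM f -> smoothM (anc (anchor T) X f).
Proof. by have [_ _ s] := anchorP T; apply: s. Qed.

Local Notation J := (jacobiator sn).

Definition generator (d : int) P : Prop :=
  (exists2 f, smoothM f & d = -2 /\ P = of_fun Lam f) \/
  (exists2 X, gsec X & d = -1 /\ P = of_sec Lam X).

Lemma generator_mgr d P : generator d P -> mgr Lam d P.
Proof.
by move=> [[f sf [-> ->]]|[X gX [-> ->]]]; [apply: mgr_of_fun|apply: mgr_of_sec].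
Qed.

Lemma of_funB f g : of_fun Lam (fun x => f x - g x) = of_fun Lam f - of_fun Lam g.
Proof. by apply: msP => x; rewrite !msE scalerBl. Qed.

(** Up to permutation there are four cases. With at least two functions every term contains a
    bracket of two functions or a bracket with 0; two sections and a function give the morphism
    property of the anchor, and three sections the Jacobi identity of the algebroid. *)
Lemma jacobiator_gen d e k P Q S : generator d P -> generator e Q -> generator k S ->
  J d e P Q S = 0.
Proof.
have Jff u a X : smoothM u -> smoothM a -> gsec X ->
    J (-1) (-2) (of_sec Lam X) (of_fun Lam u) (of_fun Lam a) = 0.
  move=> su sa gX; rewrite /jacobiator sn_fun_fun// (gb0r G (mgr_of_sec gX)).
  rewrite !sn_sec_fun// !sn_fun_fun ?scaler0 ?subr0//; exact: smooth_anc.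
have Jf X Y u : smoothM u -> gsec X -> gsec Y ->
    J (-1) (-1) (of_sec Lam X) (of_sec Lam Y) (of_fun Lam u) = 0.
  move=> su gX gY; rewrite /jacobiator sn_sec_sec// !sn_sec_fun//;
    try exact: smooth_anc; last exact: lbr_smooth.
  rewrite (anchor_morph T gX gY su).
  rewrite (of_funB (anc (anchor T) X (anc (anchor T) Y u)) (anc (anchor T)
    Y (anc (anchor T) X u))).
  by rewrite addNr mulr0 expr0z scale1r; abel.
move=> gP gQ gS.
have [mP mQ mS] := And3 (generator_mgr gP) (generator_mgr gQ) (generator_mgr gS).
have swapl : J e d Q P S = 0 -> J d e P Q S = 0.
  by move=> J0; rewrite (jacobiator_swapl G mP mQ mS) J0 scaler0 oppr0.
have swapr : J d k P S Q = 0 -> J d e P Q S = 0.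
  by move=> J0; rewrite (jacobiator_swapr G mP mQ mS) J0 scaler0 oppr0.
have rot : J k d S P Q = 0 -> J d e P Q S = 0.
  by move=> J0; apply: swapr; rewrite (jacobiator_swapl G mP mS mQ) J0 scaler0 oppr0.
have rot' : J e k Q S P = 0 -> J d e P Q S = 0.
  by move=> J0; apply: swapl; rewrite (jacobiator_swapr G mQ mP mS) J0 scaler0 oppr0.
case: gP gQ gS swapl swapr rot rot' {mP mQ mS} => [[a sa [-> ->]]|[X gX [-> ->]]]
  [[b sb [-> ->]]|[Y gY [-> ->]]] [[c sc [-> ->]]|[Z gZ [-> ->]]] swapl swapr rot rot'.
- rewrite /jacobiator !sn_fun_fun//.
  have m := mgr_of_fun.
  by rewrite !(gb0r G (m _ _)) ?(gb0l G (m _ _))// scaler0 !subr0.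
- by apply: rot; apply: Jff.
- by apply: swapl; apply: Jff.
- by apply: rot'; apply: Jf.
- exact: Jff.
- by apply: swapr; apply: Jf.
- exact: Jf.
- rewrite /jacobiator !sn_sec_sec//; try exact: lbr_smooth.
  rewrite mulr0 expr0z scale1r -!of_secN -!of_secD -of_sec0; congr (of_sec Lam _).
  rewrite -(lbr_jacobi T gX gY gZ) (lbr_anti T gZ gX)
    (lbr_anti T gZ (lbr_smooth T gX gY)).
  by rewrite lbrNr//; [abel|exact: lbr_smooth].
Qed.

End Schouten.

Section SchoutenJacobi.
Variables (R : realType) (n : nat) (M : manifold R n).
Variables (r : nat) (A : vbundle M r) (Lam : forall x, exterior (A x)).
Implicit Types (P Q S : multisec Lam) (X Y : section A) (f : M -> R).
Variables (T : lie_algebroid A) (sn : multisec Lam -> multisec Lam -> multisec Lam).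
Hypothesis H : is_schouten T sn.
Let G := schouten_graded H.
Local Notation J := (jacobiator sn).

(** In its last slot the Jacobiator is the graded commutator of the derivations [P, .] and [Q, .],
    minus the derivation [[P, Q], .], hence a derivation of the wedge product. *)
Lemma jacobiator_wedge d e p q P Q S S' :
  mgr Lam d P -> mgr Lam e Q -> mvec p S -> mvec q S' ->
  J d e P Q (wedge S S') =
  wedge (J d e P Q S) S' + (-1) ^ (p%:Z * (d + e)) *: wedge S (J d e P Q S').
Proof.
move=> HP HQ /mgr_mvec HS /mgr_mvec HS'.
(* Exposes the degree p - 2 of [S], which is then generalized to [s]; the remaining shift by 2 does
   not affect signs. *)
have -> : p%:Z * (d + e) = (p%:Z - 2 + 2) * (d + e) by lia.
move: (p%:Z - 2) HS => s HS; move: (q%:Z - 2) HS' => s' HS'.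
have HPQ := gb_br G HP HQ; have HQS := gb_br G HQ HS; have HQS' := gb_br G HQ HS'.
have HPS := gb_br G HP HS; have HPS' := gb_br G HP HS'.
rewrite /jacobiator (schouten_wedge H HQ HS HS') (schouten_wedge H HP HS HS').
rewrite (schouten_wedge H HPQ HS HS').
rewrite (gbDr G HP (mgr_wedge HQS HS')); last first.
  by apply: gb_cast (gbZ G _ (mgr_wedge HS HQS')) _; lia.
rewrite (gbZr G _ HP (mgr_wedge HS HQS')).
rewrite (gbDr G HQ (mgr_wedge HPS HS')); last first.
  by apply: gb_cast (gbZ G _ (mgr_wedge HS HPS')) _; lia.
rewrite (gbZr G _ HQ (mgr_wedge HS HPS')).
rewrite (schouten_wedge H HP HQS HS') (schouten_wedge H HP HS HQS').
rewrite (schouten_wedge H HQ HPS HS') (schouten_wedge H HQ HS HPS').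
rewrite !(wedgeDl, wedgeDr, wedgeNl, wedgeNr, wedgeZl, wedgeZr).
by signs; parity d; parity e; parity s; unsign; abel.
Qed.

Lemma jacobiator_zero d e P Q : mgr Lam d P -> mgr Lam e Q ->
  (forall k w, generator k w -> J d e P Q w = 0) ->
  forall k S, mgr Lam k S -> J d e P Q S = 0.
Proof.
move=> HP HQ Hg k S /mgr_single[p mS _].
apply: (@derivation_zero _ _ _ _ _ _ (J d e P Q) (d + e) _ _ _ _ p S mS).
- move=> q c S1 S2 /mgr_mvec H1 /mgr_mvec H2; exact: (jacobiator_linear G _ HP HQ H1 H2).
- by move=> p1 p2 S1 S2; apply: jacobiator_wedge.
- by move=> f sf; apply: (Hg (-2)); left; exists f.
- by move=> X gX; apply: (Hg (-1)); right; exists X.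
Qed.

(** The slots are freed one at a time: starting from three generators, [jacobiator_zero] frees the
    last slot, and the swaps bring a slot still held by a generator to the last place before each
    further use. *)
Lemma schouten_jacobi d e k P Q S : mgr Lam d P -> mgr Lam e Q -> mgr Lam k S ->
  J d e P Q S = 0.
Proof.
have S1 d1 e1 u v k1 w : generator d1 u -> generator e1 v -> mgr Lam k1 w ->
    J d1 e1 u v w = 0.
  move=> gu gv; apply: jacobiator_zero => [||k2 z gz]; try exact: generator_mgr.
  exact: (jacobiator_gen H gu gv gz).
have S2 d1 e1 u v k1 w : generator d1 u -> mgr Lam e1 v -> mgr Lam k1 w ->
    J d1 e1 u v w = 0.
  move=> gu mv; have mu := generator_mgr gu.
  apply: jacobiator_zero => // k2 z gz.
  by rewrite (jacobiator_swapr G mu mv (generator_mgr gz)) (S1 _ _ _ _ _ _ gu gz mv)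
    scaler0 oppr0.
move=> mP mQ; apply: jacobiator_zero => // k2 z gz; have mz := generator_mgr gz.
rewrite (jacobiator_swapr G mP mQ mz) (jacobiator_swapl G mP mz mQ).
by rewrite (S2 _ _ _ _ _ _ gz mP mQ) scaler0 oppr0 scaler0 oppr0.
Qed.

End SchoutenJacobi.

(** * Forms on a graded vector space *)

Section Insertion.
Variables (R : realType) (E : lmodType R) (gr : int -> set E).
Implicit Types (K L : vform E) (u v w : int * E) (s : seq (int * E)).

Lemma homog_unshuffles0 s (F : R * (seq (int * E) * seq (int * E)) -> E) :
  homog gr s ->
  (forall c a b, homog gr a -> homog gr b -> (size a + size b)%N = size s ->
     F (c, (a, b)) = 0) ->
  \sum_(w <- unshuffles s) F w = 0.
Proof.
elim: s F => [|u s IH] F /=; first by move=> _ HF; rewrite big_seq1 HF.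
move=> [gu hs] HF; rewrite big_cat !big_map /= !IH ?addr0// => c a b ha hb Es.
  by apply: HF => //=; rewrite -Es addnS.
by apply: HF => //=; rewrite -Es.
Qed.

(* The second condition is additivity in the first argument, as far as it is
   needed. *)
Definition arity_le2 L : Prop :=
  (forall s, homog gr s -> (2 < size s)%N -> vfun L s = 0) /\
  (forall d s, homog gr s -> vfun L ((d, 0) :: s) = 0).

(** The unshuffle with empty first block inserts the curvature of K into L. Here and in the next
    lemmas this term is L evaluated at 0, which the second clause of [arity_le2] removes. *)
Lemma insertion_nil K L : vfun K [::] = 0 -> arity_le2 L -> insertion K L [::] = 0.
Proof. by move=> K0 [_ L0]; rewrite /insertion big_seq1 /= scale1r K0 L0. Qed.

Lemma insertion1 K L u : vfun K [::] = 0 -> arity_le2 L -> homog gr [:: u] ->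
  insertion K L [:: u] = vfun L [:: (vdeg K + u.1, vfun K [:: u])].
Proof.
move=> K0 [_ L0] hu; rewrite /insertion /= !big_cons big_nil /totdeg /= big_seq1.
by rewrite K0 L0// scaler0 !addr0 scale1r.
Qed.

Lemma insertion2 K L u v : vfun K [::] = 0 -> arity_le2 L -> homog gr [:: u; v] ->
  insertion K L [:: u; v] =
    vfun L [:: (vdeg K + (u.1 + v.1), vfun K [:: u; v])]
    + vfun L [:: (vdeg K + u.1, vfun K [:: u]); v]
    + (-1) ^ (u.1 * v.1) *: vfun L [:: (vdeg K + v.1, vfun K [:: v]); u].
Proof.
move=> K0 [_ L0] [hu [hv _]].
rewrite /insertion /= !big_cons big_nil /totdeg /= !(big_cons, big_nil) /=.
by rewrite K0 L0//= scaler0 !(addr0, mulr0, expr0z, mulr1, scale1r) !addrA.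
Qed.

(** Only the unshuffles with blocks of sizes 2 and 1 survive. The homogeneity of the values of K on
    single arguments is what permits the arity bound of L on the lists that contain them. *)
Lemma insertion3 K L u v w : vfun K [::] = 0 -> arity_le2 K -> arity_le2 L ->
  homog gr [:: u; v; w] -> gr (vdeg K + u.1) (vfun K [:: u]) ->
  gr (vdeg K + v.1) (vfun K [:: v]) -> gr (vdeg K + w.1) (vfun K [:: w]) ->
  insertion K L [:: u; v; w] =
    vfun L [:: (vdeg K + (u.1 + v.1), vfun K [:: u; v]); w]
    + (-1) ^ (v.1 * w.1) *: vfun L [:: (vdeg K + (u.1 + w.1), vfun K [:: u; w]); v]
    + (-1) ^ (u.1 * (v.1 + w.1)) *:
        vfun L [:: (vdeg K + (v.1 + w.1), vfun K [:: v; w]); u].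
Proof.
move=> K0 [K3 _] [L3 L0] [hu [hv [hw _]]] gu gv gw.
rewrite /insertion /= !big_cons big_nil /totdeg /= !(big_cons, big_nil) /=.
rewrite (K3 [:: u; v; w])// K0.
rewrite !L0//= !(L3 [:: _; _; _])//= ?addr0//=.
rewrite !scaler0.
by rewrite !(addr0, add0r, mulr0, expr0z, mulr1, scale1r) !addrA.
Qed.

(** If K receives at most two arguments and L its value and at most one more, no more than three
    arguments are used. *)
Lemma insertion_gt3 K L s : arity_le2 K -> arity_le2 L ->
  (forall s, homog gr s -> gr (vdeg K + totdeg s) (vfun K s)) ->
  homog gr s -> (3 < size s)%N -> insertion K L s = 0.
Proof.
move=> [K3 _] [L3 L0] Kd hs s3; apply: homog_unshuffles0 hs _ => c a b ha hb Es /=.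
have [a2|a2] := leqP (size a) 2; last by rewrite K3// L0// scaler0.
rewrite L3 ?scaler0//=; first by split => //; apply: Kd.
lia.
Qed.

Variables (N : E -> E) (pi : E).
Hypothesis N0 : N 0 = 0.
Hypothesis Ngr : forall d x, gr d x -> gr d (N x).
Hypothesis pi_gr : gr 0 pi.

Definition curved_form : vform E := vform_add (vform1 0 (fun u => N u.2)) (vform0 0 pi).
Local Notation NN := curved_form.

Lemma RN_curved_nil L : vdeg L = 1 -> arity_le2 L ->
  vfun (RN NN L) [::] = vfun L [:: (0, pi)] - N (vfun L [::]).
Proof.
move=> L1 [L3 L0]; rewrite /RN /insertion /= !big_seq1 /= mul0r expr0z !scale1r.
by rewrite /totdeg big_nil !addr0 add0r.
Qed.

(** The middle term is the effect of the curvature: inserting [pi] turns the binary part of L into a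
    unary one. *)
Lemma RN_curved1 L u : vdeg L = 1 -> arity_le2 L -> homog gr [:: u] ->
  vfun (RN NN L) [:: u] =
  vfun L [:: (u.1, N u.2)] + vfun L [:: (0, pi); u] - N (vfun L [:: u]).
Proof.
move=> L1 [L3 L0] [gu _]; rewrite /RN /insertion /= !big_cons big_nil /=.
rewrite /totdeg /= !(big_cons, big_nil) /= mul0r expr0z.
by rewrite !(addr0, add0r, mulr0, expr0z, mulr1, scale1r, scaler0).
Qed.

Lemma RN_curved2 L u v : vdeg L = 1 -> arity_le2 L -> homog gr [:: u; v] ->
  vfun (RN NN L) [:: u; v] =
  vfun L [:: (u.1, N u.2); v] + (-1) ^ (u.1 * v.1) *: vfun L [:: (v.1, N v.2); u]
  - N (vfun L [:: u; v]).
Proof.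
move=> L1 [L3 L0] [gu [gv _]]; rewrite /RN /insertion /= !big_cons big_nil /=.
rewrite /totdeg /= !(big_cons, big_nil) /= mul0r expr0z !(addr0, add0r).
rewrite L0// (L3 [:: _; _; _])//=.
by rewrite !(addr0, add0r, mulr0, expr0z, mulr1, scale1r, scaler0).
Qed.

(** Bracketing with N preserves arities and inserting [pi] lowers them, so the bound 2 persists. The
    vanishing at 0 is left to be shown on the short lists, where the bracket has an explicit
    formula. *)
Lemma RN_curved_arity L : (forall d, gr d 0) -> vdeg L = 1 -> arity_le2 L ->
  (forall d s, homog gr s -> (size s < 2)%N -> vfun (RN NN L) ((d, 0) :: s) = 0) ->
  arity_le2 (RN NN L).
Proof.
move=> gr0 L1 [L3 L0] H.
have H3 s : homog gr s -> (2 < size s)%N -> vfun (RN NN L) s = 0.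
  move=> hs s3; rewrite /RN /= /insertion.
  rewrite !homog_unshuffles0 ?scaler0 ?subrr// => c a b ha hb Es /=.
    case: b hb Es => [|y b] hb Es; last by rewrite addr0 scaler0.
    by rewrite L3 ?N0 ?addr0 ?scaler0//; move: Es => /=; lia.
  case: a ha Es => [|x [|y a]] ha Es /=.
  - rewrite /totdeg big_nil L3 ?scaler0//=; last by move: Es => /=; lia.
    by rewrite !add0r.
  - rewrite /totdeg big_seq1 L3 ?scaler0//=; last by move: Es => /=; lia.
    by rewrite add0r addr0; split => //; apply: Ngr; case: ha.
  - by rewrite addr0 L0// scaler0.
split=> // d s hs; have [s2|s2] := ltnP (size s) 2; first exact: H.
by apply: H3.
Qed.

End Insertion.

(** * Deformation of graded brackets by a linear map, and the resulting identities *)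

Section Deformation.
Variables (R : realType) (E : lmodType R) (gr : int -> set E) (N : E -> E).
Hypothesis Nlin : forall (c : R) x y, N (c *: x + y) = c *: N x + N y.
Hypothesis Ngr : forall d x, gr d x -> gr d (N x).

Lemma defN0 : N 0 = 0.
Proof.
have := Nlin 1 0 0; rewrite !scale1r addr0; exact: add_idem0.
Qed.

Lemma defND x y : N (x + y) = N x + N y.
Proof. by rewrite -{1}[x]scale1r Nlin scale1r. Qed.

Lemma defNZ c x : N (c *: x) = c *: N x.
Proof. by rewrite -[_ *: x]addr0 Nlin defN0 addr0. Qed.

Lemma defNN x : N (- x) = - N x.
Proof. by rewrite -scaleN1r defNZ scaleN1r. Qed.

Lemma defNMn x k : N (x *+ k) = N x *+ k.
Proof. by rewrite -(scaler_nat k x) -(scaler_nat k (N x)) defNZ. Qed.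

Definition deform (b : E -> E -> E) (x y : E) : E := b (N x) y + b x (N y) - N (b x y).

Lemma deform_graded b : graded_bracket gr b -> graded_bracket gr (deform b).
Proof.
move=> G; split.
- exact: (gb0 G).
- exact: (gbZD G).
- move=> d e c x x' y dx dx' ey; rewrite /deform Nlin.
  rewrite !(gb_lin G c (d := d) (e := e))//; try exact: Ngr.
  by rewrite Nlin !scalerDr !scalerN; abel.
- move=> d e x y dx ey; rewrite /deform.
  by apply: (gbD G); [apply: (gbD G)|apply: (gbN G); apply: Ngr];
    apply: (gb_br G) => //; apply: Ngr.
- move=> d e x y dx ey; rewrite /deform.
  rewrite (gb_anti G (Ngr dx) ey) (gb_anti G dx (Ngr ey)) (gb_anti G dx ey).
  by rewrite defNN defNZ !scalerDr !scalerN; abel.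
Qed.

End Deformation.

Section BracketIdentities.
Variables (R : realType) (E : lmodType R) (gr : int -> set E).

Definition mixed_jacobiator (b1 b2 : E -> E -> E) (d e : int) (x y z : E) : E :=
  b1 x (b2 y z) - b1 (b2 x y) z - (-1) ^ ((d + 1) * (e + 1)) *: b1 y (b2 x z).

(** The left side is [insertion3] for the symmetric forms of b2 and b1. Their sign (-1)^(d + 1)
    trades graded symmetry for the antisymmetry of a bracket of degree 1, which turns the three
    unshuffles into the three terms of a Jacobiator. *)
Lemma mixed_jacobiator_insertion b1 b2 d e f x y z :
  graded_bracket gr b1 -> graded_bracket gr b2 -> gr d x -> gr e y -> gr f z ->
  (-1) ^ (1 + (d + e) + 1) *: b1 ((-1) ^ (d + 1) *: b2 x y) z
  + (-1) ^ (e * f) *: ((-1) ^ (1 + (d + f) + 1) *: b1 ((-1) ^ (d + 1) *: b2 x z) y)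
  + (-1) ^ (d * (e + f)) *: ((-1) ^ (1 + (e + f) + 1) *: b1 ((-1) ^ (e + 1) *: b2 y z) x)
  = (-1) ^ e *: mixed_jacobiator b1 b2 d e x y z.
Proof.
move=> G1 G2 dx ey fz; rewrite /mixed_jacobiator.
have xy := gb_br G2 dx ey; have xz := gb_br G2 dx fz; have yz := gb_br G2 ey fz.
rewrite (gbZl G1 _ xy fz) (gbZl G1 _ xz ey) (gbZl G1 _ yz dx).
rewrite (gb_anti G1 xz ey) (gb_anti G1 yz dx).
by signs; parity d; parity e; parity f; unsign; abel.
Qed.

(** The arity 2 counterpart: the first term inserts the form of b into D, the other two insert D
    into the form of b, and together they measure the failure of D to be a derivation of b. *)
Lemma derivation_insertion b (D : E -> E) d e x y : graded_bracket gr b ->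
  gr d x -> gr e y -> gr (e + 1) (D y) -> D (- b x y) = - D (b x y) ->
  D ((-1) ^ (d + 1) *: b x y)
  + (-1) ^ (1 + d + 1) *: b (D x) y
  + (-1) ^ (d * e) *: ((-1) ^ (1 + e + 1) *: b (D y) x)
  = (-1) ^ (d + 1) *: (D (b x y) - b (D x) y - (-1) ^ (d + 1) *: b x (D y)).
Proof.
move=> G dx ey Dy DN; rewrite (gb_anti G Dy dx).
signs; parity d; parity e; unsign; rewrite ?DN; abel.
Qed.

Variables (br : E -> E -> E) (N : E -> E) (pi : E).
Hypothesis G : graded_bracket gr br.
Hypothesis Nlin : forall (c : R) x y, N (c *: x + y) = c *: N x + N y.
Hypothesis Ngr : forall d x, gr d x -> gr d (N x).
Hypothesis jac : forall d e f x y z, gr d x -> gr e y -> gr f z ->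
  jacobiator br d e x y z = 0.
Local Notation brN := (deform N br).
Local Notation brNN := (deform N brN).
Hypothesis jacN : forall d e f x y z, gr d x -> gr e y -> gr f z ->
  jacobiator brN d e x y z = 0.
Let GN := deform_graded Nlin Ngr G.
Let GNN := deform_graded Nlin Ngr GN.

Ltac hom_def G' := hom_infer G' ltac:(fun _ => eapply Ngr; hom_def G').
Ltac expand_def :=
  repeat progress (rewrite ?(defND Nlin, defNN Nlin, defNMn Nlin, defNZ Nlin);
    expand_with G br ltac:(fun _ => eapply Ngr; hom_def G)).

(** The Jacobiator is quadratic in the bracket, so its second derivative under the commutator with N
    consists of the two mixed Jacobiators and twice the Jacobiator of [brN]. The second derivative
    of zero is zero; [E1] writes it out by placing N twice on the arguments, once inside and once
    outside, or twice outside. *)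
Lemma jacobi_mixed d e f x y z : gr d x -> gr e y -> gr f z ->
  mixed_jacobiator br brNN d e x y z + mixed_jacobiator brNN br d e x y z = 0.
Proof.
move=> dx ey fz; have [Nx Ny Nz] := And3 (Ngr dx) (Ngr ey) (Ngr fz).
have [NNx NNy NNz] := And3 (Ngr Nx) (Ngr Ny) (Ngr Nz).
have J0 := jac dx ey fz.
have Jx := jac Nx ey fz; have Jy := jac dx Ny fz; have Jz := jac dx ey Nz.
have Jxx := jac NNx ey fz; have Jyy := jac dx NNy fz; have Jzz := jac dx ey NNz.
have Jxy := jac Nx Ny fz; have Jxz := jac Nx ey Nz; have Jyz := jac dx Ny Nz.
have JN := jacN dx ey fz.
have E1 : jacobiator br d e (N (N x)) y z + jacobiator br d e x (N (N y)) z
   + jacobiator br d e x y (N (N z))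
   + (jacobiator br d e (N x) (N y) z + jacobiator br d e (N x) y (N z)
   + jacobiator br d e x (N y) (N z)) *+ 2
   - (N (jacobiator br d e (N x) y z + jacobiator br d e x (N y) z
   + jacobiator br d e x y (N z))) *+ 2
   + N (N (jacobiator br d e x y z)) - jacobiator brN d e x y z *+ 2 = 0.
  rewrite Jxx Jyy Jzz Jxy Jxz Jyz Jx Jy Jz J0 JN !(addr0, mul0rn) !(defN0 Nlin).
  by rewrite mul0rn oppr0 !addr0.
rewrite -[RHS]E1 {E1 Jxx Jyy Jzz Jxy Jxz Jyz Jx Jy Jz J0 JN}.
rewrite /mixed_jacobiator /jacobiator.
(* The sign is made an opaque scalar, so that the expansion treats it as a mere coefficient. *)
set c := (-1) ^ _; have Hc : c = 1 \/ c = -1.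
  by rewrite /c expN1E; case: oddz; [right|left].
rewrite /deform; move: c Hc => c Hc.
expand_def.
by case: Hc => ->; rewrite ?scaleN1r ?scale1r; abel.
Qed.

Hypothesis pi_gr : gr 0 pi.
Hypothesis pi2 : br pi pi = 0.
Hypothesis compat : forall d x, gr d x ->
  br (N pi) x = (N (br pi x) - br pi (N x)) *+ 2.

Definition com (F : E -> E) (x : E) : E := F (N x) - N (F x).
Local Notation D := (com (br pi)).
Local Notation W := (com (com (br pi))).

Lemma mulrn_inj0 (k : nat) (x : E) : x *+ k.+1 = 0 -> x = 0.
Proof.
by rewrite -scaler_nat => /eqP; rewrite scaler_eq0 pnatr_eq0 /= => /eqP.
Qed.

Lemma adpi_gr d x : gr d x -> gr (d + 1) (br pi x).
Proof. by move=> dx; apply: gb_cast (gb_br G pi_gr dx) _; lia. Qed.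

Lemma com_gr F d x : (forall e y, gr e y -> gr (e + 1) (F y)) -> gr d x ->
  gr (d + 1) (com F x).
Proof.
by move=> Fg dx; apply: (gbD G); [|apply: (gbN G)]; [apply/Fg/Ngr|apply/Ngr/Fg].
Qed.

(** In the shifted grading [pi] is odd, so the Jacobi identity for [pi], [pi], x contains [pi,
    [pi, x]] twice with the same sign. *)
Lemma adpi_sq0 d x : gr d x -> br pi (br pi x) = 0.
Proof.
move=> dx; have := jac pi_gr pi_gr dx; rewrite /jacobiator pi2 (gb0l G dx).
by signs; unsign; rewrite subr0 opprK -mulr2n => /mulrn_inj0.
Qed.

(** The compatibility at [pi] reads [N pi, pi] = - 2 [pi, N pi], while the bracket of two odd
    elements is symmetric; hence 3 [pi, N pi] = 0. *)
Lemma br_pi_Npi : br pi (N pi) = 0.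
Proof.
have C := compat pi_gr; rewrite pi2 (defN0 Nlin) sub0r in C.
have C' := gb_anti G (Ngr pi_gr) pi_gr; move: C'; signs; unsign => C'.
apply: (@mulrn_inj0 2); move: C; rewrite C' opprK => C.
have -> : br pi (N pi) *+ 3 = br pi (N pi) - (- br pi (N pi)) *+ 2 by abel.
by rewrite -C subrr.
Qed.

Lemma deform_pi d x : gr d x -> brN pi x = - D x.
Proof. by move=> dx; rewrite /deform (compat dx) /com; abel. Qed.

Lemma com_adpi_sq0 d x : gr d x -> D (D x) = 0.
Proof.
move=> dx; have Dx : gr (d + 1) (D x) by apply: com_gr dx => e y; apply: adpi_gr.
have : brN pi (brN pi x) = 0.
  have := jacN pi_gr pi_gr dx; rewrite /jacobiator.
  have -> : brN pi pi = 0.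
    by rewrite (deform_pi pi_gr) /com br_pi_Npi pi2 (defN0 Nlin) subr0 oppr0.
  rewrite (gb0l GN dx).
  by signs; unsign; rewrite subr0 opprK -mulr2n => /mulrn_inj0.
by rewrite (deform_pi dx) (gbNr GN pi_gr Dx) (deform_pi Dx) opprK.
Qed.

(** The second derivative, under the commutator with N, of the square of [pi, .], which is zero: its
    cross term is twice the square of D. *)
Lemma curvature_arity1 d x : gr d x -> W (br pi x) + br pi (W x) = 0.
Proof.
move=> dx; have Nx := Ngr dx; have NNx := Ngr Nx.
have -> : W (br pi x) + br pi (W x) =
    br pi (br pi (N (N x))) + N (N (br pi (br pi x))) - N (br pi (br pi (N x))) *+ 2
    - D (D x) *+ 2.
  by rewrite /com; expand_def; abel.
rewrite (com_adpi_sq0 dx) (adpi_sq0 dx) (adpi_sq0 Nx) (adpi_sq0 NNx).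
by rewrite !(defN0 Nlin) !mul0rn !subr0 addr0.
Qed.

Definition leibniz_defect (F : E -> E) (b : E -> E -> E) (d : int) (x y : E) : E :=
  F (b x y) - b (F x) y - (-1) ^ (d + 1) *: b x (F y).

Lemma leibniz_adpi d e x y : gr d x -> gr e y -> leibniz_defect (br pi) br d x y = 0.
Proof.
move=> dx ey; have := jac pi_gr dx ey; rewrite /jacobiator /leibniz_defect.
by rewrite add0r mul1r.
Qed.

(** The Leibniz defect is linear in the map and in the bracket. Differentiating twice the fact that
    [pi, .] is a derivation of [br] gives the two terms of the claim and twice the defect of D for
    [brN]. *)
Lemma curvature_arity2 d e x y : gr d x -> gr e y ->
  leibniz_defect (br pi) brNN d x y + leibniz_defect W br d x y = 0.
Proof.
move=> dx ey; have [Nx Ny] := conj (Ngr dx) (Ngr ey).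
have [NNx NNy] := conj (Ngr Nx) (Ngr Ny).
have [gx gy] := conj (adpi_gr dx) (adpi_gr ey).
have [gNx gNy] := conj (adpi_gr Nx) (adpi_gr Ny).
have [gNNx gNNy] := conj (adpi_gr NNx) (adpi_gr NNy).
pose L := leibniz_defect (br pi) br d.
(* As D is minus the [brN]-bracket with [pi], this is the Jacobi identity of [brN] with first
   argument [pi]. *)
have DN : leibniz_defect D brN d x y = 0.
  have := jacN pi_gr dx ey; rewrite /jacobiator add0r mul1r.
  have Dg k z : gr k z -> gr (k + 1) (D z) by apply: com_gr => k' z'; apply: adpi_gr.
  rewrite (deform_pi dx) (deform_pi ey) (deform_pi (gb_br GN dx ey)).
  rewrite (gbNl GN (Dg _ _ dx) ey) (gbNr GN dx (Dg _ _ ey)) => J.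
  by rewrite -[RHS]oppr0 -J /leibniz_defect scalerN; abel.
have L0 : L (N (N x)) y + L x (N (N y)) + L (N x) (N y) *+ 2
    - N (L (N x) y + L x (N y)) *+ 2 + N (N (L x y))
    - leibniz_defect D brN d x y *+ 2 = 0.
  rewrite DN /L (leibniz_adpi NNx ey) (leibniz_adpi dx NNy) (leibniz_adpi Nx Ny).
  rewrite (leibniz_adpi Nx ey) (leibniz_adpi dx Ny) (leibniz_adpi dx ey).
  by rewrite !(addr0, mul0rn, subr0, defN0 Nlin).
rewrite -[RHS]L0 {L0 DN} /L /leibniz_defect.
set c := (-1) ^ _; have Hc : c = 1 \/ c = -1.
  by rewrite /c expN1E; case: oddz; [right|left].
rewrite /deform /com; move: c Hc => c Hc.
expand_def.
by case: Hc => ->; rewrite ?scaleN1r ?scale1r; abel.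
Qed.

End BracketIdentities.

(** * The weak Nijenhuis condition, arity by arity *)

Section WeakNijenhuis.
Variables (R : realType) (E : lmodType R) (gr : int -> set E).
Variables (br : E -> E -> E) (N : E -> E) (pi : E).
Hypothesis G : graded_bracket gr br.
Hypothesis Nlin : forall (c : R) x y, N (c *: x + y) = c *: N x + N y.
Hypothesis Ngr : forall d x, gr d x -> gr d (N x).
Hypothesis jac : forall d e f x y z, gr d x -> gr e y -> gr f z ->
  jacobiator br d e x y z = 0.
Local Notation brN := (deform N br).
Local Notation brNN := (deform N brN).
Hypothesis jacN : forall d e f x y z, gr d x -> gr e y -> gr f z ->
  jacobiator brN d e x y z = 0.
Hypothesis pi_gr : gr 0 pi.
Hypothesis pi2 : br pi pi = 0.
Hypothesis compat : forall d x, gr d x ->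
  br (N pi) x = (N (br pi x) - br pi (N x)) *+ 2.

Definition unary_binary (F : E -> E) (b : E -> E -> E) : vform E :=
  vform_add (vform1 1 (fun u => F u.2))
            (vform2 1 (fun u v => (-1) ^ (u.1 + 1) *: b u.2 v.2)).

Lemma unary_binary_nil F b : vfun (unary_binary F b) [::] = 0.
Proof. by rewrite /= addr0. Qed.
Lemma unary_binary1 F b u : vfun (unary_binary F b) [:: u] = F u.2.
Proof. by rewrite /= addr0. Qed.
Lemma unary_binary2 F b u v :
  vfun (unary_binary F b) [:: u; v] = (-1) ^ (u.1 + 1) *: b u.2 v.2.
Proof. by rewrite /= add0r. Qed.
Lemma unary_binary3 F b u v w s : vfun (unary_binary F b) [:: u, v, w & s] = 0.
Proof. by rewrite /= addr0. Qed.
Definition unary_binaryE :=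
  (unary_binary_nil, unary_binary1, unary_binary2, unary_binary3).

Local Notation nu := (unary_binary (br pi) br).
Local Notation NN := (curved_form N pi).

Lemma unary_binary_vform : is_vform gr nu.
Proof.
have ap : forall d x, gr d x -> gr (d + 1) (br pi x) := adpi_gr G pi_gr.
split.
- case=> [|[d x] [|[e y] [|w s]]] /= => [_|[dx _]|[dx [ey _]]|_];
    rewrite /totdeg ?addr0 ?add0r; try exact: (gb0 G).
    by rewrite big_seq1 /=; apply: gb_cast (ap _ _ dx) _; lia.
  rewrite !big_cons big_nil; apply: (gbZ G); apply: gb_cast (gb_br G dx ey) _ => /=; lia.
- case=> [|[e z] [|w s]] [|[f t] [|w' t']] d a x y /=;
  rewrite ?addr0 ?add0r ?scaler0 ?addr0 //.
  + by move=> _ _ dx dy; apply: (gb_linr G _ pi_gr dx dy).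
  + move=> _ [ft _] dx dy; rewrite (gb_lin G _ dx dy ft) scalerDr !scalerA.
    by rewrite mulrC.
  + move=> [ez _] _ dx dy; rewrite (gb_linr G _ ez dx dy) scalerDr !scalerA.
    by rewrite mulrC.
  + by case: s => [|? ?]; rewrite /= ?addr0 ?scaler0 ?addr0.
  + by case: s => [|? ?]; rewrite /= ?addr0 ?scaler0 ?addr0.
  + by case: s => [|? ?]; rewrite /= ?addr0 ?scaler0 ?addr0.
- case=> [|w [|w' s]] [|w'' t] [d x] [e y] /=; rewrite ?addr0 ?add0r ?scaler0 //.
  + move=> [dx [ey _]]; rewrite (gb_anti G dx ey).
    by signs; parity d; parity e; unsign;
      rewrite ?opprK ?scalerN ?scaleN1r ?scale1r ?opprK.
  + by case: s => [|? ?]; rewrite /= ?addr0 ?scaler0 ?addr0.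
  + by case: s => [|? ?]; rewrite /= ?addr0 ?scaler0 ?addr0.
Qed.

Lemma unary_binary_arity : arity_le2 gr nu.
Proof.
split; first by case=> [|u [|v [|w s]]] // _ _; rewrite unary_binaryE.
move=> d [|[e y] [|w s]] /= => [_|[ey _]|_]; rewrite ?addr0 ?add0r//.
  exact: (gb0r G pi_gr).
by rewrite (gb0l G ey) scaler0.
Qed.

(** In arities 1, 2 and 3 this says that [pi, .] squares to zero, that it is a derivation, and that
    the bracket satisfies the Jacobi identity. *)
Lemma unary_binary_sq0 : vform_zero gr (RN nu nu).
Proof.
suff I0 s : homog gr s -> insertion nu nu s = 0.
  by move=> s hs; rewrite /= I0// scaler0 subr0.
have ar := unary_binary_arity; have [Kd _ _] := unary_binary_vform.
have ap : forall d x, gr d x -> gr (d + 1) (br pi x) := adpi_gr G pi_gr.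
case: s => [|[d x] [|[e y] [|[f z] [|w s]]]] hs.
- by rewrite (insertion_nil _ ar)// unary_binaryE.
- rewrite (insertion1 _ ar hs) ?unary_binaryE//=; case: hs => /= dx _.
  exact: (adpi_sq0 G jac pi_gr pi2 dx).
- rewrite (insertion2 _ ar hs) ?unary_binaryE//=; case: hs => /= dx [ey _].
  rewrite (derivation_insertion G dx ey (ap _ _ ey)); last first.
    by rewrite (gbNr G pi_gr (gb_br G dx ey)).
  by have := leibniz_adpi jac pi_gr dx ey; rewrite /leibniz_defect => ->; rewrite scaler0.
- case: (hs) => /= dx [ey [fz _]].
  rewrite (insertion3 _ ar ar hs) ?unary_binaryE//=; try by rewrite addrC; apply: ap.
  rewrite (mixed_jacobiator_insertion G G dx ey fz).
  by rewrite [mixed_jacobiator _ _ _ _ _ _ _](jac dx ey fz) scaler0.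
- exact: (insertion_gt3 ar ar Kd hs).
Qed.

Lemma curved_vform : is_vform gr NN.
Proof.
split.
- case=> [|[d x] [|w s]] /= => [_|[dx _]|_]; rewrite /totdeg ?big_nil ?addr0 ?add0r //.
  + by rewrite big_seq1; apply: Ngr.
  + exact: (gb0 G).
- case=> [|w s] [|w' t] d a x y /=; rewrite ?addr0 ?scaler0 ?addr0//.
  + by case: s => [|? ?] /=; rewrite ?addr0 ?scaler0.
  + by case: s => [|? ?] /=; rewrite ?addr0 ?scaler0.
- case=> [|w [|w' s]] t u v /=; rewrite ?addr0 ?scaler0//.
Qed.

Local Notation nu1 := (RN NN nu).
Local Notation nu2 := (RN NN nu1).
Let N0 := defN0 Nlin.
Let arity0 := unary_binary_arity.

Lemma nu1_nil : vfun nu1 [::] = 0.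
Proof. by rewrite (RN_curved_nil _ _ _ arity0)// !unary_binaryE pi2 N0 subr0. Qed.

(** The second term is the curvature inserted into the binary part; its sign is (-1)^(0 + 1), as
    [pi] has degree 0. *)
Lemma nu1_1 u : homog gr [:: u] -> vfun nu1 [:: u] = com N (br pi) u.2 - br pi u.2.
Proof.
move=> hu; rewrite (RN_curved1 _ _ _ arity0 hu)// !unary_binaryE /= add0r expr1z.
by rewrite scaleN1r /com addrAC.
Qed.

Lemma nu1_2 u v : homog gr [:: u; v] ->
  vfun nu1 [:: u; v] = (-1) ^ (u.1 + 1) *: brN u.2 v.2.
Proof.
move=> huv; rewrite (RN_curved2 _ _ _ arity0 huv)// !unary_binaryE /=.
case: u v huv => [d x] [e y] /= [dx [ey _]].
rewrite (gb_anti G (Ngr ey) dx) (defNZ Nlin) /deform.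
by signs; parity d; parity e; unsign; abel.
Qed.

Let GN := deform_graded Nlin Ngr G.
Let GNN := deform_graded Nlin Ngr GN.
Local Notation W := (com N (com N (br pi))).

Lemma nu1_arity : arity_le2 gr nu1.
Proof.
apply: (RN_curved_arity N0 Ngr pi_gr (gb0 G) _ arity0) => // d [|v [|w s]] // hs _.
  rewrite nu1_1 /=; last by split=> //; apply: (gb0 G).
  by rewrite /com N0 (gb0r G pi_gr) N0 !subr0.
rewrite nu1_2 /=; last by split=> //; apply: (gb0 G).
by case: hs => gv _; rewrite (gb0l GN gv) scaler0.
Qed.

Lemma nu2_nil : vfun nu2 [::] = 0.
Proof.
rewrite (RN_curved_nil _ _ _ nu1_arity)// nu1_nil nu1_1//.
by rewrite /com /= (br_pi_Npi G Nlin Ngr pi_gr pi2 compat) pi2 N0 !subr0.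
Qed.

(** The curvature disappears here: the term - [pi, .] of [nu1] contributes - D through its
    commutator with N, and inserting [pi] into [brN] contributes D by [deform_pi]. *)
Lemma nu2_1 u : homog gr [:: u] -> vfun nu2 [:: u] = W u.2.
Proof.
move=> hu; have [gu _] := hu; rewrite (RN_curved1 _ _ _ nu1_arity hu)//.
rewrite nu1_2// !nu1_1//; last by split=> //; apply: Ngr.
rewrite /= add0r expr1z scaleN1r (deform_pi compat gu).
by rewrite opprK (defND Nlin) (defNN Nlin) /com; abel.
Qed.

Lemma nu2_2 u v : homog gr [:: u; v] ->
  vfun nu2 [:: u; v] = (-1) ^ (u.1 + 1) *: brNN u.2 v.2.
Proof.
move=> huv; rewrite (RN_curved2 _ _ _ nu1_arity huv)//.
case: u v huv => [d x] [e y] huv.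
have dx : gr d x by case: huv.
have ey : gr e y by case: huv => _ [].
have [Nx Ny] := conj (Ngr dx) (Ngr ey).
rewrite !nu1_2// /= (gb_anti GN Ny dx) (defNZ Nlin).
have -> : brNN x y = brN (N x) y + brN x (N y) - N (brN x y) by [].
by signs; parity d; parity e; unsign; abel.
Qed.

Lemma adpi_com_gr d x : gr d x -> gr (d + 1) (W x).
Proof.
move=> dx; do 2 (apply: (com_gr G Ngr _) => // {dx}d {}x dx).
exact: (adpi_gr G pi_gr dx).
Qed.

Lemma nu2_arity : arity_le2 gr nu2.
Proof.
apply: (RN_curved_arity N0 Ngr pi_gr (gb0 G) _ nu1_arity) => // d [|v [|w s]] // hs _.
  rewrite nu2_1 /=; last by split=> //; apply: (gb0 G).
  by rewrite /com !N0 (gb0r G pi_gr) !(N0, subr0).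
rewrite nu2_2 /=; last by split=> //; apply: (gb0 G).
by case: hs => gv _; rewrite (gb0l GNN gv) scaler0.
Qed.

Lemma nu2_deg s : homog gr s -> gr (vdeg nu2 + totdeg s) (vfun nu2 s).
Proof.
case: s => [|u [|v [|w s]]] hs.
- by rewrite nu2_nil; apply: (gb0 G).
- rewrite nu2_1// /totdeg big_seq1; case: hs => gu _.
  by apply: gb_cast (adpi_com_gr gu) _ => /=; lia.
- rewrite nu2_2// /totdeg !big_cons big_nil; case: hs => gu [gv _].
  by apply: (gbZ G); apply: gb_cast (gb_br GNN gu gv) _ => /=; lia.
- by rewrite nu2_arity.1//; apply: (gb0 G).
Qed.

Lemma curved_weak_nijenhuis : vform_zero gr (RN nu nu2).
Proof.
move=> s hs.
(* Both forms have degree 1, so their bracket is the sum of the two insertions. *)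
have -> : vfun (RN nu nu2) s = insertion nu nu2 s - (-1) ^+ 1 *: insertion nu2 nu s by [].
rewrite expr1 scaleN1r opprK.
have ar := unary_binary_arity; have ar2 := nu2_arity; have [Kd _ _] := unary_binary_vform.
have ap : forall d x, gr d x -> gr (d + 1) (br pi x) := adpi_gr G pi_gr.
have V2 : vdeg nu2 = 1 by []; have z0 := unary_binary_nil (br pi) br.
case: s hs => [|[d x] [|[e y] [|[f z] [|w s]]]] hs.
- by rewrite (insertion_nil nu2_nil ar) (insertion_nil z0 ar2) addr0.
- rewrite (insertion1 nu2_nil ar hs) (insertion1 z0 ar2 hs) !unary_binary1.
  have [gx _] := hs; have hx : homog gr [:: (vdeg nu + (d, x).1, br pi x)].
    by split=> //; apply: gb_cast (ap _ _ gx) _; rewrite /= addrC.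
  rewrite (nu2_1 hx) (nu2_1 hs).
  exact: (curvature_arity1 G Nlin Ngr jac jacN pi_gr pi2 compat gx).
- have dx : gr d x by case: hs.
  have ey : gr e y by case: hs => _ [].
  have [hx hy] : homog gr [:: (d, x)] /\ homog gr [:: (e, y)] by [].
  have g1 : homog gr [:: (1 + d, br pi x); (e, y)].
    by split; [rewrite addrC; apply: ap|].
  have g2 : homog gr [:: (1 + e, br pi y); (d, x)].
    by split; [rewrite addrC; apply: ap|].
  have g3 : homog gr [:: (1 + (d + e), (-1) ^ (d + 1) *: br x y)].
    by split=> //; apply: (gbZ G); apply: gb_cast (gb_br G dx ey) _ => /=; lia.
  rewrite (insertion2 nu2_nil ar hs) (insertion2 z0 ar2 hs) V2 !unary_binaryE.
  rewrite (nu2_1 g3) (nu2_2 g1) (nu2_2 g2) (nu2_2 hs) (nu2_1 hx) (nu2_1 hy) /=.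
  have I1 := derivation_insertion GNN dx ey (ap _ _ ey) (gbNr G pi_gr (gb_br GNN dx ey)).
  (* [br pi] commutes with negation only on homogeneous elements, so this property is carried
     through both commutators. *)
  have WN : W (- br x y) = - W (br x y) .
    have comN F k y' : (forall j t, gr j t -> F (- t) = - F t) -> gr k y' ->
        com N F (- y') = - com N F y'.
      move=> FN gy; rewrite /com (defNN Nlin y') (FN _ _ (Ngr gy)) (FN _ _ gy).
      by rewrite (defNN Nlin); abel.
    have piN j t : gr j t -> br pi (- t) = - br pi t by apply: (gbNr G pi_gr).
    apply: (comN _ _ _ _ (gb_br G dx ey)) => j t gt.
    exact: comN gt.
  have I2 := derivation_insertion G dx ey (adpi_com_gr ey) WN.
  have := curvature_arity2 G Nlin Ngr jac jacN pi_gr compat dx ey.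
  rewrite /leibniz_defect => C.
  (* Each insertion mixes two Leibniz defects. The terms are regrouped into the defect of [pi, .]
     for [brNN] and that of [W] for [br]. *)
  have -> : forall a b c a' b' c' : E, a + b' + c' + (a' + b + c) = (a + b + c)
    + (a' + b' + c').
    by move=> *; abel.
  rewrite I2 I1 -scalerDr [X in _ *: X](_ : _ = 0) ?scaler0//.
  by rewrite -[RHS]C; abel.
- have dx : gr d x by case: hs.
  have ey : gr e y by case: hs => _ [].
  have fz : gr f z by case: hs => _ [_ []].
  have gxy : homog gr [:: (d, x); (e, y)] by [].
  have gxz : homog gr [:: (d, x); (f, z)] by [].
  have gyz : homog gr [:: (e, y); (f, z)] by [].
  have dg b j k (s t : E) c : graded_bracket gr b -> gr j s -> gr k t ->
      gr (1 + (j + k)) ((-1) ^ c *: b s t).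
    by move=> Gb gs gt; apply: (gbZ G); apply: gb_cast (gb_br Gb gs gt) _; lia.
  have h2 j (t : E) k (t' : E) : gr j t -> gr k t' -> homog gr [:: (j, t); (k, t')] by [].
  have K1 L j t : (forall s, homog gr s -> gr (vdeg L + totdeg s) (vfun L s)) -> gr j t ->
      gr (vdeg L + j) (vfun L [:: (j, t)]).
    by move=> Lg gt; have := Lg [:: (j, t)] (conj gt I); rewrite /totdeg big_seq1.
  rewrite (insertion3 nu2_nil ar2 ar hs (K1 _ _ _ nu2_deg dx) (K1 _ _ _ nu2_deg ey)
    (K1 _ _ _ nu2_deg fz)).
  rewrite (insertion3 z0 ar ar2 hs (K1 _ _ _ Kd dx) (K1 _ _ _ Kd ey) (K1 _ _ _ Kd fz)).
  rewrite V2 (nu2_2 gxy) (nu2_2 gxz) (nu2_2 gyz) !unary_binary2.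
  rewrite (nu2_2 (h2 _ _ _ _ (dg _ _ _ _ _ (d + 1) G dx ey) fz)).
  rewrite (nu2_2 (h2 _ _ _ _ (dg _ _ _ _ _ (d + 1) G dx fz) ey)).
  rewrite (nu2_2 (h2 _ _ _ _ (dg _ _ _ _ _ (e + 1) G ey fz) dx)).
  have I1 := mixed_jacobiator_insertion G GNN dx ey fz.
  have I2 := mixed_jacobiator_insertion GNN G dx ey fz.
  move: I1 I2 => /= -> ->.
  by rewrite -scalerDr addrC (jacobi_mixed G Nlin Ngr jac jacN dx ey fz) scaler0.
- by rewrite (insertion_gt3 ar ar2 Kd hs)// (insertion_gt3 ar2 ar nu2_deg hs)// addr0.
Qed.

End WeakNijenhuis.

(** * Deformation by a Nijenhuis tensor *)

Section Underline.
Variables (R : realType) (n : nat) (M : manifold R n).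
Variables (r : nat) (A : vbundle M r) (Lam : forall x, exterior (A x)).
Local Notation dom j := (@triv_dom _ _ _ _ A j).
Implicit Types (P Q S : multisec Lam) (X Y : section A) (f : M -> R).
Variables (N : forall x : M, A x -> A x) (uN : forall x : M, Lam x -> Lam x).
Hypothesis HN : tensor11 N.
Hypothesis HU : is_underline N uN.

Definition uapp P : multisec Lam := fun x => uN (P x).

Lemma uN_linear x (c : R) (v w : Lam x) : uN (c *: v + w) = c *: uN v + uN w.
Proof. by have [H _ _] := HU x; apply: H. Qed.

(** Recasts the indexed sum in [is_underline] as a Leibniz rule for the first factor, the form
    suited to induction on the number of factors. *)
Lemma uN_cons x (v : A x) (s : seq (A x)) :
  uN (ext_in (Lam x) v * \prod_(u <- s) ext_in (Lam x) u) =
  ext_in (Lam x) (N v) * \prod_(u <- s) ext_in (Lam x) u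
  + ext_in (Lam x) v * uN (\prod_(u <- s) ext_in (Lam x) u).
Proof.
have [_ _ H] := HU x.
rewrite -(big_cons _ _ v s xpredT (fun u => ext_in (Lam x) u)) !H /= big_ord_recl;
  congr (_ + _).
  rewrite big_ord_recl /=; congr (_ * _); rewrite (big_nth 0) big_mkord.
  by apply: eq_bigr => k _.
rewrite big_distrr; apply: eq_bigr => i _ /=.
by rewrite big_ord_recl; congr (_ * _); apply: eq_bigr => k _.
Qed.

Lemma uN_prod x (s t : seq (A x)) :
  let p s := \prod_(u <- s) ext_in (Lam x) u in
  uN (p s * p t) = uN (p s) * p t + p s * uN (p t).
Proof.
move=> p; have [_ H1 _] := HU x.
have pc v s' : p (v :: s') = ext_in (Lam x) v * p s' by rewrite /p big_cons.
have pcat s' : p s' * p t = p (s' ++ t) by rewrite /p big_cat.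
have uc v s' : uN (ext_in (Lam x) v * p s') =
  ext_in (Lam x) (N v) * p s' + ext_in (Lam x) v * uN (p s') := uN_cons v s'.
elim: s => [|v s IH]; first last.
  by rewrite pc -mulrA pcat !uc -pcat IH mulrDl mulrDr !mulrA addrA.
have -> : p [::] = 1 by rewrite /p big_nil.
by rewrite H1 mul0r add0r !mul1r.
Qed.

Lemma uN_sum x (I : Type) (s : seq I) (c : I -> R) (v : I -> Lam x) :
  uN (\sum_(i <- s) c i *: v i) = \sum_(i <- s) c i *: uN (v i).
Proof. by apply: (fib_linear_sum (@uN_linear x)). Qed.

Lemma uapp_linear c P Q : uapp (c *: P + Q) = c *: uapp P + uapp Q.
Proof. by apply: msP => x; rewrite /uapp !msE uN_linear. Qed.

Lemma uapp_fun f : uapp (of_fun Lam f) = 0.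
Proof.
apply: msP => x; rewrite /uapp !msE; have [_ H1 _] := HU x.
have E0 : uN (0 : Lam x) = 0.
  by have := uN_linear (-1) (1 : Lam x) 1; rewrite scaleN1r addNr H1 scaler0 addr0.
by rewrite -[X in uN X]addr0 uN_linear H1 E0 scaler0 addr0.
Qed.

Lemma uapp_sec X : uapp (of_sec Lam X) = of_sec Lam (tapp N X).
Proof.
apply: msP => x; rewrite /uapp !msE; have [_ H1 _] := HU x.
have := uN_cons (X x) [::]; rewrite big_nil !mulr1 H1 mulr0 addr0.
by [].
Qed.

Lemma prod_map_frame j x (t : seq 'I_r) :
  \prod_(a <- t) ext_in (Lam x) (frame j a x) =
  \prod_(u <- [seq @frame _ _ _ _ A j a x | a <- t]) ext_in (Lam x) u.
Proof. by rewrite big_map. Qed.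

Lemma uapp_wedge p q P Q : mvec p P -> mvec q Q ->
  uapp (wedge P Q) = wedge (uapp P) Q + wedge P (uapp Q).
Proof.
move=> HP HQ; apply: msP => x; rewrite /uapp !msE.
have [j dx] := @triv_cover _ _ _ _ A x.
have [g [_ ->]] := HP j; last exact: dx.
have [h [_ ->]] := HQ j; last exact: dx.
rewrite mulr_suml !uN_sum !mulr_suml -big_split /=.
have E0 : uN (0 : Lam x) = 0 by have := uapp_fun (fun=> 0) => /(congr1 (fun P => P x));
  rewrite /uapp !msE scale0r.
have EZ c v : uN (c *: v : Lam x)
  = c *: uN v by rewrite -[c *: v]addr0 uN_linear E0 addr0.
have ES (I : finType) (G : I -> Lam x) : uN (\sum_i G i) = \sum_i uN (G i).
  have := uN_sum (index_enum I) (fun=> 1) G; under eq_bigr do rewrite scale1r.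
  by move=> ->; apply: eq_bigr => i _; rewrite scale1r.
rewrite ES; apply: eq_bigr => t _.
rewrite !mulr_sumr ES -big_split; apply: eq_bigr => u _ /=.
rewrite -!scalerAl -!scalerAr !EZ !prod_map_frame uN_prod !scalerDr.
by rewrite !scalerA.
Qed.

Lemma mvec_uapp p P : mvec p P -> mvec p (uapp P).
Proof.
move=> HP j; have [g [sg Pg]] := HP j.
pose F (t : seq 'I_r) : multisec Lam := fun x => \prod_(a <- t) ext_in (Lam x)
  (frame j a x).
have lF t : lmvec j (size t) (F t).
  apply: (lmvec_prod_frame (s := t) (f := fun=> 1)) => //; first exact: smooth_fun_cst.
  by move=> x _; rewrite scale1r.
have lU t : lmvec j (size t) (uapp (F t)).
  elim: t => [|a t IH].
    apply: (eq_lmvec _ (@lmvec0 _ _ _ _ _ Lam j 0)) => x _; have [_ H1 _] := HU x.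
    by rewrite /uapp /F big_nil H1.
  have l1 : lmvec j 1 (of_sec Lam (frame j a)) by have := lF [:: a];
    apply: eq_lmvec => x _; rewrite /F big_seq1.
  have l2 : lmvec j 1 (of_sec Lam (tapp N (frame j a))) by apply: lmvec_of_sec;
    exact: HN.2.
  have H1 := lmvec_wedge l2 (lF t); have H2 := lmvec_wedge l1 IH.
  apply: eq_lmvec (lmvecZD 1 H1 H2) => x _.
  by rewrite scale1r !msE /uapp /F big_cons prod_map_frame uN_cons.
pose T (t : p.-tuple 'I_r) : multisec Lam := wedge (of_fun Lam (g t)) (uapp (F t)).
apply: (@eq_lmvec _ _ _ _ _ _ _ _ (\sum_t T t)).
  move=> x dx; rewrite /uapp msE Pg// uN_sum; apply: eq_bigr => t _.
  by rewrite /T !msE -scalerAl mul1r.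
apply: lmvec_sum => t; rewrite -[p]add0n; apply: lmvec_wedge.
  by apply: (lmvec_prod_frame (s := [::]) (f := g t)) => // x _; rewrite big_nil.
by have := lU (tval t); rewrite size_tuple.
Qed.

Lemma mgr_uapp d P : mgr Lam d P -> mgr Lam d (uapp P).
Proof.
move=> [->|[p -> HP]]; last by right; exists p => //; apply: mvec_uapp.
have := uapp_linear 1 0 0; rewrite !scale1r addr0 => /add_idem0 ->.
exact: mgr0.
Qed.

End Underline.

(** * The Lie algebroid and the Schouten bracket deformed by N *)

Section DeformedAlgebroid.
Variables (R : realType) (n : nat) (M : manifold R n).
Variables (r : nat) (A : vbundle M r) (T : lie_algebroid A).
Variable (N : forall x : M, A x -> A x).
Hypothesis HN : nijenhuis T N.
Implicit Types (X Y Z : section A) (f : M -> R).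

Lemma tapp_linear c X Y : tapp N (c *: X + Y) = c *: tapp N X + tapp N Y.
Proof. by apply: secP => x; rewrite /tapp !secE HN.1.1. Qed.

Lemma tappD X Y : tapp N (X + Y) = tapp N X + tapp N Y.
Proof. by have := tapp_linear 1 X Y; rewrite !scale1r. Qed.

Lemma tapp0 : tapp N (0 : section A) = 0.
Proof. by have := tappD 0 0; rewrite addr0; exact: add_idem0. Qed.

Lemma tappZ c X : tapp N (c *: X) = c *: tapp N X.
Proof. by rewrite -[c *: X]addr0 tapp_linear tapp0 addr0. Qed.

Lemma tappN X : tapp N (- X) = - tapp N X.
Proof. by rewrite -scaleN1r tappZ scaleN1r. Qed.

Lemma tapp_fscale f X : tapp N (fscale f X) = fscale f (tapp N X).
Proof.
apply: secP => x; rewrite /tapp !secE -[_ *: X x]addr0 HN.1.1.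
by have := congr1 (fun X : section A => X x) tapp0; rewrite /tapp !secE => ->;
  rewrite addr0.
Qed.

Let gN X : gsec X -> gsec (tapp N X).
Proof. exact: gsec_tapp HN.1. Qed.
Let gL X Y : gsec X -> gsec Y -> gsec (lbr T X Y).
Proof. exact: lbr_smooth. Qed.

Lemma gsec_def_br X Y : gsec X -> gsec Y -> gsec (def_br (lbr T) N X Y).
Proof. by move=> gX gY; apply: gsecB; [apply: gsecD; apply: gL|apply/gN/gL]; auto. Qed.

Lemma nijenhuisE X Y : gsec X -> gsec Y ->
  tapp N (def_br (lbr T) N X Y) = lbr T (tapp N X) (tapp N Y).
Proof. by move=> gX gY; rewrite HN.2. Qed.

(** The Nijenhuis identity is applied to N [Y, Z]_N and to [N X, N [Y, Z]]; the terms N [X, N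
    [Y, Z]] then cancel. Every remaining term is a double bracket with N on its arguments or in
    front, so cyclic sums become Jacobi sums of the original bracket. *)
Lemma def_br_br X Y Z : gsec X -> gsec Y -> gsec Z ->
  def_br (lbr T) N X (def_br (lbr T) N Y Z) =
  lbr T (tapp N X) (lbr T (tapp N Y) Z) + lbr T (tapp N X) (lbr T Y (tapp N Z))
  + lbr T X (lbr T (tapp N Y) (tapp N Z))
  - tapp N (lbr T (tapp N X) (lbr T Y Z) + lbr T X (lbr T (tapp N Y) Z)
            + lbr T X (lbr T Y (tapp N Z)))
  + tapp N (tapp N (lbr T X (lbr T Y Z))).
Proof.
move=> gX gY gZ; have [gX' gY' gZ'] := And3 (gN gX) (gN gY) (gN gZ).
have gYZ := gL gY gZ.
rewrite {1}/def_br (nijenhuisE gY gZ).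
rewrite [in lbr T (tapp N X) _]/def_br [in lbr T X (def_br _ _ _ _)]/def_br.
rewrite !(lbrDr T, lbrNr T); try by auto using gsecD, gsecN.
rewrite (HN.2 _ _ gX gYZ) /def_br !(tappD, tappN).
abel.
Qed.

(** Built transparently, so that its bracket and anchor reduce to [def_br] and [def_anchor] when
    [koszulE] is instantiated with it. *)
Definition deformed_algebroid : lie_algebroid A.
Proof.
refine (@LieAlgebroid _ _ _ _ A (def_br (lbr T) N) (def_anchor (anchor T) N)
  _ _ _ _ _ _ _).
- exact: gsec_def_br.
- move=> c X Y Z gX gY gZ; rewrite /def_br !tapp_linear !lbr_linear//; auto.
  rewrite tapp_linear !scalerDr !scalerN; abel.
- move=> X Y gX gY; rewrite /def_br (lbr_anti T (gN gX) gY) (lbr_anti T gX (gN gY)).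
  rewrite (lbr_anti T gX gY) tappN; abel.
- move=> X Y Z gX gY gZ; rewrite !def_br_br//.
  have [gX' gY' gZ'] := And3 (gN gX) (gN gY) (gN gZ).
  pose J (X Y Z : section A) := lbr T X (lbr T Y Z) + lbr T Y (lbr T Z X)
    + lbr T Z (lbr T X Y).
  transitivity (J (tapp N X) (tapp N Y) Z + J (tapp N X) Y (tapp N Z) + J X (tapp N Y)
    (tapp N Z)
    - tapp N (J (tapp N X) Y Z + J X (tapp N Y) Z + J X Y (tapp N Z))
    + tapp N (tapp N (J X Y Z))).
    by rewrite /J !tappD; abel.
  by rewrite /J !lbr_jacobi// !(addr0, tapp0, subr0).
- have [Ht Hl Hs] := anchorP T; split.
  + by move=> x u; apply: Ht.
  + by move=> x c u v f sf; rewrite /def_anchor HN.1.1 Hl.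
  + by move=> X f gX sf; apply: (Hs (tapp N X)) => //; apply: gN.
- move=> X Y f gX gY sf.
  have := anchor_morph T (gN gX) (gN gY) sf; rewrite -nijenhuisE//.
- move=> X Y f gX gY sf.
  rewrite /def_br tapp_fscale !lbr_leibniz//; auto.
  rewrite !(tappD, tapp_fscale).
  by apply: secP => x; rewrite !secE !scalerDr !scalerN /anc /def_anchor; abel.
Defined.

End DeformedAlgebroid.

Section DeformedSchouten.
Variables (R : realType) (n : nat) (M : manifold R n).
Variables (r : nat) (A : vbundle M r) (Lam : forall x, exterior (A x)).
Variables (T : lie_algebroid A) (sn : multisec Lam -> multisec Lam -> multisec Lam).
Variables (N : forall x : M, A x -> A x) (uN : forall x : M, Lam x -> Lam x).
Hypothesis H : is_schouten T sn.
Hypothesis HN : nijenhuis T N.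
Hypothesis HU : is_underline N uN.
Let G := schouten_graded H.
Let U : multisec Lam -> multisec Lam := uapp uN.
Let Ulin : forall (c : R) P Q, U (c *: P + Q) = c *: U P + U Q.
Proof. exact: uapp_linear HU. Qed.
Let Ugr : forall d P, mgr Lam d P -> mgr Lam d (U P).
Proof. exact: mgr_uapp HN.1 HU. Qed.
Let mU : forall p P, mvec p P -> mvec p (U P).
Proof. exact: mvec_uapp HN.1 HU. Qed.

(** U is a derivation of degree zero, so deforming by it preserves the Leibniz rule; on functions
    and sections U is 0 and N, which gives the deformed anchor and bracket. The Jacobi identity of
    the deformed bracket is then an instance of [schouten_jacobi]. *)
Lemma deformed_schouten : is_schouten (deformed_algebroid HN) (deform U sn).
Proof.
have GN := deform_graded Ulin Ugr G.
have [_ Hd _ _ _] := H.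
split.
- move=> p q c P P' Q /mgr_mvec mP /mgr_mvec mP' /mgr_mvec mQ.
  exact: (gb_lin GN _ mP mP' mQ).
- move=> p q P Q mP mQ.
  have [d1 z1] := Hd p q _ _ (mU mP) mQ; have [d2 z2] := Hd p q _ _ mP (mU mQ).
  have [d3 z3] := Hd p q _ _ mP mQ; split=> [k E|E]; rewrite /deform.
    by apply: mvecB; [apply: mvecD; auto|apply: mU; auto].
  by rewrite z1// z2// z3// (defN0 Ulin) oppr0 !addr0.
- move=> p q P Q /mgr_mvec mP /mgr_mvec mQ.
  rewrite (gb_anti GN mP mQ); congr (- (_ ^ _ *: _)); lia.
- move=> p q q' P Q Q' mP mQ mQ'; rewrite /deform.
  have [gP gQ gQ'] := And3 (mgr_mvec mP) (mgr_mvec mQ) (mgr_mvec mQ').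
  have -> : p%:Z - 1 = p%:Z - 2 + 1 by lia.
  have -> : q%:Z = q%:Z - 2 + 2 by lia.
  have -> : (-1 : R) ^ ((p%:Z - 2 + 1) * (q%:Z - 2 + 2)) = (-1) ^ ((p%:Z - 2 + 1)
    * (q%:Z - 2)).
    by rewrite !expN1E !oddzM (oddzD _ 2) addbF.
  have uw := uapp_wedge HU mQ mQ'; rewrite -/U in uw; rewrite uw.
  rewrite (gbDr G gP (mgr_wedge (Ugr gQ) gQ') (mgr_wedge gQ (Ugr gQ'))).
  rewrite !(schouten_wedge H (d := p%:Z - 2) (e := q%:Z - 2) (k := q'%:Z - 2))//;
    try exact: Ugr.
  have UZ c P' : U (c *: P') = c *: U P' := defNZ Ulin c P'.
  have UW P1 P2 k1 k2 : mgr Lam k1 P1 -> mgr Lam k2 P2 ->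
      U (wedge P1 P2) = wedge (U P1) P2 + wedge P1 (U P2).
    move=> /mgr_single[m1 M1 _] /mgr_single[m2 M2 _]; exact: (uapp_wedge HU M1 M2).
  rewrite (defND Ulin) UZ (UW _ _ _ _ (gb_br G gP gQ) gQ')
    (UW _ _ _ _ gQ (gb_br G gP gQ')).
  rewrite !(wedgeDl, wedgeDr, wedgeNl, wedgeNr, wedgeZl, wedgeZr) !(scalerDr, scalerN).
  abel.
- move=> X gX; have gNX := gsec_tapp HN.1 gX; split=> [Y gY|f sf]; rewrite /deform /U.
    have gNY := gsec_tapp HN.1 gY.
    rewrite !(uapp_sec HU) !(sn_sec_sec H)// (uapp_sec HU).
    by rewrite /= /def_br !of_secD of_secN.
  rewrite (uapp_fun HU) (uapp_sec HU) !(sn_sec_fun H)// (uapp_fun HU) subr0.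
  by rewrite (gb0r G (mgr_of_sec Lam gX)) addr0.
Qed.

End DeformedSchouten.

(** * Bivectors and the Koszul bracket *)

Section PairingTheory.
Variables (R : realType) (V : lmodType R) (L : exterior V).
Implicit Types (a b : V -> R) (w : L) (s : seq (V * V)).
Local Notation iota := (ext_in L).

Definition functional (a : V ->
  R) : Prop := forall (c : R) u v, a (c *: u + v) = c * a u + a v.

Definition bivec s : L := \sum_(u <- s) iota u.1 * iota u.2.
Definition pair_seq s a b : R := \sum_(u <- s) (a u.1 * b u.2 - a u.2 * b u.1).

(* Left multiplication by [a v *: e1 + b v *: e2] on the exterior algebra of
   R^2, in the basis 1, e1, e2, e1 e2. *)
Definition ext2_mx a b (v : V) : 'M[R]_4 := \matrix_(i < 4, j < 4)
  match nat_of_ord i, nat_of_ord j with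
  | 1, 0 | 3, 2 => a v
  | 2, 0 => b v
  | 3, 1 => - b v
  | _, _ => 0
  end.

Lemma ext2_mx_sq a b v : ext2_mx a b v * ext2_mx a b v = 0.
Proof.
apply/matrixP => i j; rewrite !mxE !big_ord_recl big_ord0 !mxE /=.
by case: i j => [[|[|[|[|i]]]] Hi] [[|[|[|[|j]]]] Hj] //=; ring.
Qed.

Lemma ext2_mx_mul a b u v :
  (ext2_mx a b u * ext2_mx a b v) (inord 3) (inord 0) = a u * b v - a v * b u.
Proof. by rewrite !mxE !big_ord_recl big_ord0 !mxE /= !inordK //=; ring. Qed.

Lemma ext2_mx_linear a b (c : R) u v : functional a -> functional b ->
  ext2_mx a b (c *: u + v) = c *: ext2_mx a b u + ext2_mx a b v.
Proof.
move=> fa fb; apply/matrixP => i j; rewrite !mxE fa fb.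
by case: i j => [[|[|[|[|i]]]] Hi] [[|[|[|[|j]]]] Hj] //=; ring.
Qed.

(** The universal property extends [ext2_mx a b] to an algebra morphism, and one matrix entry of the
    image of a bivector is its pairing. So the pairing depends on the bivector only, and the choice
    made in [pairing2] is harmless. *)
Lemma pair_seq_wd s s' a b : functional a -> functional b ->
  bivec s = bivec s' -> pair_seq s a b = pair_seq s' a b.
Proof.
move=> fa fb E.
have flin : linear (ext2_mx a b) by move=> c u v; apply: ext2_mx_linear.
pose f : {linear V -> 'M[R]_4} := HB.pack (ext2_mx a b)
  (GRing.isLinear.Build _ _ _ _ _ flin).
have [g Hg] := ext_lift L (f := f) (ext2_mx_sq a b).
have K t : pair_seq t a b = g (bivec t) (inord 3) (inord 0).
  rewrite /bivec /pair_seq linear_sum summxE; apply: eq_bigr => u _.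
  by rewrite rmorphM /= !Hg -ext2_mx_mul.
by rewrite !K E.
Qed.

Lemma pairing2E s a b : functional a -> functional b ->
  pairing2 (bivec s) a b = pair_seq s a b.
Proof.
move=> fa fb; rewrite /pairing2; case: xgetP => [c _ [s' [E ->]]|/(_ (pair_seq s a b))].
  by apply: (@pair_seq_wd s' s).
by case; exists s.
Qed.

Definition sharp_seq s a : V := \sum_(u <- s) (a u.1 *: u.2 - a u.2 *: u.1).

Lemma functional0 a : functional a -> a 0 = 0.
Proof. by move=> fa; have := fa 1 0 0; rewrite scale1r addr0 mul1r; lra. Qed.

Lemma functional_sum a (I : Type) (r : seq I) (F : I -> V) : functional a ->
  a (\sum_(i <- r) F i) = \sum_(i <- r) a (F i).
Proof.
move=> fa; elim: r => [|i r IH]; first by rewrite !big_nil functional0.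
by rewrite !big_cons -[F i]scale1r fa mul1r scale1r IH.
Qed.

Lemma functionalB a c d u v : functional a -> a (c *: u - d *: v) = c * a u - d * a v.
Proof.
by move=> fa; rewrite fa -scaleNr -[_ *: v]addr0 fa functional0// addr0 mulNr.
Qed.

Lemma functional_sharp_seq s a b : functional b -> b (sharp_seq s a) = pair_seq s a b.
Proof.
move=> fb; rewrite functional_sum//; apply: eq_bigr => u _.
by rewrite functionalB.
Qed.

Hypothesis separating : forall v : V, (forall a, functional a -> a v = 0) -> v = 0.

Lemma functional_linear a : functional a ->
  exists f : {linear V -> R^o}, forall v, f v = a v.
Proof.
move=> fa; have fl : linear (a : V -> R^o) by move=> c u v; apply: fa.
pose f : {linear V -> R^o} := HB.pack (a : V -> R^o) (GRing.isLinear.Build _ _ _ _ _ fl).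
by exists f.
Qed.

(** [sharp] chooses a vector with prescribed values under all functionals: [sharp_seq] is such a
    vector, and [separating] makes it unique. *)
Lemma sharpE s a : functional a -> sharp (bivec s) a = sharp_seq s a.
Proof.
move=> fa; rewrite /sharp; case: xgetP => [v _ Hv|/(_ (sharp_seq s a))].
  apply/eqP; rewrite -subr_eq0; apply/eqP/separating => b fb.
  have [f Hf] := functional_linear fb.
  have fE : (f : V -> R) = b by apply/funext.
  have := Hv f; rewrite Hf fE pairing2E// => E.
  rewrite -[v]scale1r -[sharp_seq s a]scale1r functionalB// !mul1r E.
  by rewrite functional_sharp_seq// subrr.
case=> f; have ff : functional (f : V -> R) by move=> c u v; rewrite linearP.
by rewrite pairing2E//; apply: functional_sharp_seq.
Qed.

Lemma iota_anti u v : iota u * iota v = - (iota v * iota u).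
Proof.
have := ext_sq0 L (u + v); rewrite linearD mulrDl !mulrDr !ext_sq0 add0r addr0.
by move=> /eqP; rewrite addr_eq0 => /eqP.
Qed.

(* A bivector is the sum over all pairs of frame vectors with coefficients K;
   if K is symmetric, antisymmetry of the product gives w = - w. *)
Lemma bivec_eq0 (I : finType) (c : I -> V -> R) (e : I -> V) s :
  (forall i, functional (c i)) -> (forall v, v = \sum_i c i v *: e i) ->
  (forall i j, pair_seq s (c i) (c j) = 0) -> bivec s = 0.
Proof.
move=> fc ce H.
pose K i j := \sum_(u <- s) c i u.1 * c j u.2.
have KE : bivec s = \sum_i \sum_j K i j *: (iota (e i) * iota (e j)).
  rewrite /bivec (eq_bigr (fun u : V * V => \sum_i \sum_j (c i u.1 * c j u.2)
    *: (iota (e i) * iota (e j)))).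
    rewrite exchange_big; apply: eq_bigr => i _; rewrite exchange_big;
      apply: eq_bigr => j _.
    by rewrite /K scaler_suml.
  move=> u _; rewrite {1}(ce u.1) {1}(ce u.2) !linear_sum mulr_suml;
    apply: eq_bigr => i _.
  rewrite mulr_sumr; apply: eq_bigr => j _.
  by rewrite !linearZ /= -scalerAl -scalerAr scalerA.
have Ks i j : K i j = K j i.
  have := H i j; rewrite /pair_seq /K big_split /= sumrN => /eqP;
    rewrite subr_eq0 => /eqP ->.
  by apply: eq_bigr => u _; rewrite mulrC.
have : bivec s = - bivec s.
  rewrite {1}KE exchange_big KE -sumrN; apply: eq_bigr => i _; rewrite -sumrN.
  by apply: eq_bigr => j _; rewrite iota_anti scalerN Ks.
move=> /eqP; rewrite -addr_eq0 -mulr2n -scaler_nat scaler_eq0 pnatr_eq0 /=.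
by move/eqP.
Qed.

End PairingTheory.

Section Bivectors.
Variables (R : realType) (n : nat) (M : manifold R n).
Variables (r : nat) (A : vbundle M r) (Lam : forall x, exterior (A x)).
Local Notation dom j := (@triv_dom _ _ _ _ A j).
Implicit Types (P Q : multisec Lam) (X Y : section A) (f : M -> R).

Lemma fib_separating x (v : A x) : (forall a : A x -> R, functional a -> a v = 0) ->
  v = 0.
Proof.
move=> H; have [j dx] := @triv_cover _ _ _ _ A x.
rewrite (frame_coordP v dx) big1// => a _; rewrite H ?scale0r//.
by move=> c u w; apply: frame_coord_linear.
Qed.

Lemma mvec2_bivec P x : mvec 2 P -> exists s : seq (A x * A x), P x = bivec (Lam x) s.
Proof.
move=> HP; have [j dx] := @triv_cover _ _ _ _ A x.
have [g [_ ->]] := HP j; last exact: dx.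
elim/big_ind: _ => [|u v [s ->] [t ->]|t _].
- by exists [::]; rewrite /bivec big_nil.
- by exists (s ++ t); rewrite /bivec big_cat.
case: t => [[|a [|b [|c t]]] st] //.
exists [:: (g (Tuple st) x *: frame j a x, frame j b x)].
by rewrite /bivec big_seq1 /= !big_cons big_nil mulr1 linearZ /= -scalerAl.
Qed.

Lemma covec_functional (alpha : forall x, A x -> R) x : covec alpha ->
  functional (alpha x).
Proof. by move=> [H _] c u v; apply: H. Qed.

Lemma bivecD (x : M) (s t : seq (A x * A x)) :
  bivec (Lam x) s + bivec (Lam x) t = bivec (Lam x) (s ++ t).
Proof. by rewrite /bivec big_cat. Qed.

Definition scale_pairs (x : M) (c : R) (s : seq (A x * A x)) := [seq (c *: u.1, u.2)
  | u <- s].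

Lemma bivecZ (x : M) c (s : seq (A x * A x)) :
  c *: bivec (Lam x) s = bivec (Lam x) (scale_pairs c s).
Proof.
rewrite /bivec big_map scaler_sumr; apply: eq_bigr => u _ /=.
by rewrite linearZ /= -scalerAl.
Qed.

Lemma functionalZ (V : lmodType R) (a : V -> R) c u : functional a ->
  a (c *: u) = c * a u.
Proof. by move=> fa; rewrite -[c *: u]addr0 fa functional0// addr0. Qed.

Lemma pairingZD x (c : R) P Q (a b : A x -> R) : mvec 2 P -> mvec 2 Q ->
  functional a -> functional b ->
  pairing2 (c *: P x + Q x) a b = c * pairing2 (P x) a b + pairing2 (Q x) a b.
Proof.
move=> /(mvec2_bivec x)[s ->] /(mvec2_bivec x)[t ->] fa fb.
rewrite bivecZ bivecD !pairing2E// /pair_seq big_cat big_map mulr_sumr; congr (_ + _).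
by apply: eq_bigr => u _ /=; rewrite (functionalZ c u.1 fa) (functionalZ c u.1 fb); ring.
Qed.

Lemma sharpZD x (c : R) P Q (a : A x -> R) : mvec 2 P -> mvec 2 Q -> functional a ->
  sharp (c *: P x + Q x) a = c *: sharp (P x) a + sharp (Q x) a.
Proof.
move=> /(mvec2_bivec x)[s ->] /(mvec2_bivec x)[t ->] fa.
have sp := @fib_separating x.
rewrite bivecZ bivecD !sharpE// /sharp_seq big_cat big_map scaler_sumr; congr (_ + _).
apply: eq_bigr => u _ /=; rewrite (functionalZ c u.1 fa) scalerBr !scalerA;
  congr (_ - _ *: _).
by rewrite mulrC.
Qed.

Lemma bivec0 x : (0 : Lam x) = bivec (Lam x) [::].
Proof. by rewrite /bivec big_nil. Qed.

Lemma pairingZ x (c : R) P (a b : A x -> R) : mvec 2 P -> functional a -> functional b ->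
  pairing2 (c *: P x) a b = c * pairing2 (P x) a b.
Proof.
move=> mP fa fb; rewrite -[c *: P x]addr0 -[0]/((0 : multisec Lam) x).
rewrite pairingZD//; last exact: mvec0.
by rewrite ms0E bivec0 pairing2E// /pair_seq big_nil addr0.
Qed.

Lemma sharpZ x (c : R) P (a : A x -> R) : mvec 2 P -> functional a ->
  sharp (c *: P x) a = c *: sharp (P x) a.
Proof.
move=> mP fa; rewrite -[c *: P x]addr0 -[0]/((0 : multisec Lam) x).
rewrite sharpZD//; last exact: mvec0.
by rewrite ms0E bivec0 sharpE// ?/sharp_seq ?big_nil ?addr0//; apply: fib_separating.
Qed.

Lemma functional_sharp x P (a b : A x -> R) : mvec 2 P -> functional a -> functional b ->
  b (sharp (P x) a) = pairing2 (P x) a b.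
Proof.
move=> /(mvec2_bivec x)[s ->] fa fb; rewrite pairing2E// sharpE//.
  exact: functional_sharp_seq.
exact: fib_separating.
Qed.

Lemma pairing_anti x P (a b : A x -> R) : mvec 2 P -> functional a -> functional b ->
  pairing2 (P x) a b = - pairing2 (P x) b a.
Proof.
move=> /(mvec2_bivec x)[s ->] fa fb; rewrite !pairing2E// /pair_seq -sumrN.
by apply: eq_bigr => u _; ring.
Qed.

Lemma pairing_wedge x X Y (a b : A x -> R) : functional a -> functional b ->
  pairing2 (wedge (of_sec Lam X) (of_sec Lam Y) x) a b = a (X x) * b (Y x) - a (Y x)
    * b (X x).
Proof.
move=> fa fb; have -> : wedge (of_sec Lam X) (of_sec Lam Y) x = bivec (Lam x)
  [:: (X x, Y x)].
  by rewrite /bivec big_seq1.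
by rewrite pairing2E// /pair_seq big_seq1.
Qed.

Lemma sharp_wedge x X Y (a : A x -> R) : functional a ->
  sharp (wedge (of_sec Lam X) (of_sec Lam Y) x) a = a (X x) *: Y x - a (Y x) *: X x.
Proof.
move=> fa; have -> : wedge (of_sec Lam X) (of_sec Lam Y) x = bivec (Lam x)
  [:: (X x, Y x)].
  by rewrite /bivec big_seq1.
by rewrite sharpE// /sharp_seq ?big_seq1//; apply: fib_separating.
Qed.

(** At each point the frame coordinates extend to smooth 1-forms, and pairings with these determine
    a bivector by [bivec_eq0]. *)
Lemma mvec2_eq0 P : mvec 2 P ->
  (forall alpha beta x, covec alpha -> covec beta -> pi_pair P alpha beta x = 0) -> P = 0.
Proof.
move=> mP H; apply: msP => x; have [s Ps] := mvec2_bivec x mP.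
have [j dx] := @triv_cover _ _ _ _ A x; rewrite Ps.
have fc a : functional (@frame_coord _ _ _ _ _ j a x) by move=> c u v;
  apply: frame_coord_linear.
apply: (@bivec_eq0 _ _ _ _ (fun a => @frame_coord _ _ _ _ _ j a x)
  (fun a => frame j a x)) => //.
  by move=> v; apply: frame_coordP.
move=> a b; have [al cal Ea] := covec_extend (fc a);
  have [be cbe Eb] := covec_extend (fc b).
by have := H al be x cal cbe; rewrite /pi_pair Ea Eb Ps pairing2E.
Qed.

(* After multiplication with a cutoff a bivector is a finite sum of products of
   global sections, and function-linearity removes the cutoff. *)
Lemma tensorial_zero (W : lmodType R) x (F : multisec Lam -> W) :
  (forall P Q, mvec 2 P -> mvec 2 Q -> F (P + Q) = F P + F Q) ->
  (forall f P, smoothM f -> mvec 2 P -> F (fscale f P) = f x *: F P) ->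
  (forall X Y, gsec X -> gsec Y -> F (wedge (of_sec Lam X) (of_sec Lam Y)) = 0) ->
  forall P, mvec 2 P -> F P = 0.
Proof.
move=> FD FZ F0 P mP.
have [phi [sphi phix [g [e [sg ge E]]]]] := mvec_decomp x mP.
have m2 (t : 2.-tuple 'I_r) :
    mvec 2 (wedge_secs Lam [seq e a | a <- t]) /\ F (wedge_secs Lam [seq e a | a <- t])
      = 0.
  case: t => [[|a [|b [|c t]]] st] //.
  have -> : wedge_secs Lam [seq e i | i <- Tuple st] = wedge (of_sec Lam (e a))
    (of_sec Lam (e b)).
    by apply: msP => y; rewrite /= !msE scale1r mulr1.
  split; last exact: F0.
  by apply: (@mvec_wedge _ _ _ _ _ _ 1 1); apply: mvec_of_sec.
have Fz : F 0 = 0.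
  have := FD 0 0 (@mvec0 _ _ _ _ _ Lam 2) (@mvec0 _ _ _ _ _ Lam 2); rewrite addr0;
    exact: add_idem0.
rewrite -[F P]scale1r -phix -FZ// E.
elim: (index_enum _) => [|t s IH]; first by rewrite big_nil.
have [mt Ft] := m2 t.
rewrite big_cons FD; first by rewrite FZ// Ft scaler0 add0r.
- exact: mvec_fscale.
- by apply: mvec_sum => u; apply: mvec_fscale => //; have [] := m2 u.
Qed.

Lemma gsec_sharp P alpha : mvec 2 P -> covec alpha -> gsec (pi_sharp P alpha).
Proof.
move=> mP ca j; have [g [sg Pg]] := mP j.
(* With e0, e1 the frame vectors indexed by t, the sharp of e0 /\ e1 is alpha(e0) e1 - alpha(e1) e0;
   this is its coefficient on the frame vector b, times [g t]. *)
pose c (t : 2.-tuple 'I_r) b x := g t x *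
  (alpha x (frame j (tnth t ord0) x) * (tnth t (lift ord0 ord0) == b)%:R
   - alpha x (frame j (tnth t (lift ord0 ord0)) x) * (tnth t ord0 == b)%:R).
have o : open (setT `&` dom j) by apply: openI; [exact: openT|exact: open_dom].
have sub f : smooth_fun (dom j) f -> smooth_fun (setT `&` dom j) f.
  by apply: sub_smooth_fun => x [].
exists (fun b x => \sum_t c t b x); split.
  move=> b; apply: smooth_fun_sum => // t; apply: smooth_funM => //; first exact/sub/sg.
  apply: smooth_funD => //; last apply: smooth_funN => //.
    by apply: smooth_funM => //; [apply/sub/ca.2|apply: smooth_fun_cst].
  by apply: smooth_funM => //; [apply/sub/ca.2|apply: smooth_fun_cst].
move=> x _ dx; have fa : functional (alpha x) by exact: covec_functional.
have D (k : 'I_r) : frame j k x = \sum_(b < r) (k == b)%:R *: frame j b x.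
  rewrite (bigD1 k)//= eqxx scale1r big1 ?addr0// => b; rewrite eq_sym => /negbTE ->.
  by rewrite scale0r.
rewrite /pi_sharp; have -> : P x = bivec (Lam x) [seq (g t x *: frame j (tnth t ord0) x,
    frame j (tnth t (lift ord0 ord0)) x) | t <- index_enum _].
  rewrite Pg// /bivec big_map; apply: eq_bigr => t _ /=; rewrite linearZ /= -scalerAl.
  by congr (_ *: _); rewrite big_tuple !big_ord_recl big_ord0 mulr1.
rewrite sharpE//; last exact: fib_separating.
rewrite /sharp_seq big_map; under [RHS]eq_bigr do rewrite scaler_suml.
rewrite exchange_big; apply: eq_bigr => t _ /=.
set k0 := tnth t ord0; set k1 := tnth t (lift ord0 ord0).
transitivity ((g t x * alpha x (frame j k0 x)) *: (\sum_(b < r)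
  (k1 == b)%:R *: frame j b x)
  - (g t x * alpha x (frame j k1 x)) *: (\sum_(b < r) (k0 == b)%:R *: frame j b x)).
  by rewrite -!D (functionalZ _ _ fa) scalerA [alpha x (frame j k1 x) * _]mulrC.
rewrite !scaler_sumr -sumrB; apply: eq_bigr => b _.
by rewrite !scalerA -scalerBl; congr (_ *: _); rewrite /c -/k0 -/k1; ring.
Qed.

End Bivectors.

(** * The Koszul bracket in terms of the Schouten bracket *)

Section Koszul.
Variables (R : realType) (n : nat) (M : manifold R n).
Variables (r : nat) (A : vbundle M r) (Lam : forall x, exterior (A x)).
Implicit Types (P Q : multisec Lam) (X Y : section A) (f : M -> R).
Implicit Types (alpha beta : forall x, A x -> R).
Variables (T : lie_algebroid A) (sn : multisec Lam -> multisec Lam -> multisec Lam).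
Hypothesis H : is_schouten T sn.
Let G := schouten_graded H.

Lemma anc_linear Y (c : R) f g x : smoothM f -> smoothM g ->
  anc (anchor T) Y (fun y => c * f y + g y) x =
  c * anc (anchor T) Y f x + anc (anchor T) Y g x.
Proof. by move=> sf sg; have [Ht _ _] := anchorP T; apply: (Ht _ _).1. Qed.

Lemma ancD Y f g x : smoothM f -> smoothM g ->
  anc (anchor T) Y (fun y => f y + g y) x = anc (anchor T) Y f x + anc (anchor T) Y g x.
Proof.
move=> sf sg; have := anc_linear Y 1 x sf sg; rewrite mul1r => <-.
by congr (anc _ _ _ _); apply/funext => y; rewrite mul1r.
Qed.

Lemma ancB Y f g x : smoothM f -> smoothM g ->
  anc (anchor T) Y (fun y => f y - g y) x = anc (anchor T) Y f x - anc (anchor T) Y g x.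
Proof.
move=> sf sg; have := anc_linear Y (-1) x sg sf; rewrite mulN1r addrC => <-.
by congr (anc _ _ _ _); apply/funext => y; rewrite mulN1r addrC.
Qed.

Lemma ancM Y f g x : smoothM f -> smoothM g ->
  anc (anchor T) Y (fun y => f y * g y) x =
  f x * anc (anchor T) Y g x + g x * anc (anchor T) Y f x.
Proof. by move=> sf sg; have [Ht _ _] := anchorP T; apply: (Ht _ _).2. Qed.

Lemma pi_sharpD P Q alpha : mvec 2 P -> mvec 2 Q -> covec alpha ->
  pi_sharp (P + Q) alpha = pi_sharp P alpha + pi_sharp Q alpha.
Proof.
move=> mP mQ ca; apply: secP => x; rewrite secDE /pi_sharp msDE.
have := sharpZD (x := x) 1 mP mQ (covec_functional ca); rewrite !scale1r; exact.
Qed.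

Lemma pi_sharp_fscale f P alpha : mvec 2 P -> covec alpha ->
  pi_sharp (fscale f P) alpha = fscale f (pi_sharp P alpha).
Proof.
move=> mP ca; apply: secP => x; rewrite fscaleE /pi_sharp fscaleE sharpZ//.
exact: covec_functional.
Qed.

Lemma pi_pairD P Q alpha beta x : mvec 2 P -> mvec 2 Q -> covec alpha -> covec beta ->
  pi_pair (P + Q) alpha beta x = pi_pair P alpha beta x + pi_pair Q alpha beta x.
Proof.
move=> mP mQ ca cb; rewrite /pi_pair msDE.
have := pairingZD (x := x) 1 mP mQ (covec_functional ca) (covec_functional cb).
by rewrite scale1r mul1r.
Qed.

Lemma pi_pairZ (c : R) P alpha beta x : mvec 2 P -> covec alpha -> covec beta ->
  pi_pair (c *: P) alpha beta x = c * pi_pair P alpha beta x.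
Proof. by move=> mP ca cb; rewrite /pi_pair msZE pairingZ//; apply: covec_functional. Qed.

Lemma pi_pair_fscale f P alpha beta x : mvec 2 P -> covec alpha -> covec beta ->
  pi_pair (fscale f P) alpha beta x = f x * pi_pair P alpha beta x.
Proof. by move=> mP ca cb; rewrite /pi_pair fscaleE pairingZ//;
  apply: covec_functional. Qed.

Lemma covec_sharp P alpha beta x : mvec 2 P -> covec alpha -> covec beta ->
  beta x (pi_sharp P alpha x) = pi_pair P alpha beta x.
Proof. by move=> mP ca cb; rewrite /pi_sharp functional_sharp//;
  apply: covec_functional. Qed.

Lemma pi_pair_anti P alpha beta x : mvec 2 P -> covec alpha -> covec beta ->
  pi_pair P alpha beta x = - pi_pair P beta alpha x.
Proof. by move=> mP ca cb; apply: pairing_anti => //; apply: covec_functional. Qed.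

Lemma smooth_pi_pair P alpha beta : mvec 2 P -> covec alpha -> covec beta ->
  smoothM (pi_pair P alpha beta).
Proof.
move=> mP ca cb; have := smooth_covec cb (gsec_sharp mP ca).
by congr smoothM; apply/funext => x; apply: covec_sharp.
Qed.

Lemma mvec_sn_sec P Y : mvec 2 P -> gsec Y -> mvec 2 (sn (of_sec Lam Y) P).
Proof.
move=> mP gY; have [_ Hd _ _ _] := H.
by have [d _] := Hd 1%N 2%N _ _ (mvec_of_sec Lam gY) mP; apply: d.
Qed.

(** Its vanishing is a formula for the Lie derivative [Y, P] paired with two 1-forms. Unlike its
    individual terms, the defect is function-linear in P. *)
Definition koszul_defect P alpha beta Y x : R :=
  alpha x (lbr T (pi_sharp P beta) Y x) - beta x (lbr T (pi_sharp P alpha) Y x)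
  - anc (anchor T) Y (pi_pair P alpha beta) x - pi_pair (sn (of_sec Lam Y) P)
    alpha beta x.

Lemma covecB alpha x (c : R) (u v : A x) : covec alpha ->
  alpha x (c *: u - v) = c * alpha x u - alpha x v.
Proof.
move=> ca; have := functionalB c 1 u v (covec_functional (x := x) ca).
by rewrite scale1r mul1r.
Qed.

Lemma covecD alpha x (u v : A x) : covec alpha -> alpha x (u + v) = alpha x u + alpha x v.
Proof. by move=> [ca _]; have := ca x 1 u v; rewrite scale1r mul1r. Qed.

(** When P is multiplied by f, the four terms containing the derivative of f along Y cancel because
    the pairing is antisymmetric. This leaves products of two sections, where everything is
    explicit. *)
Lemma koszul_defect_eq0 P alpha beta Y x : mvec 2 P -> covec alpha -> covec beta ->
  gsec Y -> koszul_defect P alpha beta Y x = 0.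
Proof.
move=> mP ca cb gY.
have gS Q al : mvec 2 Q -> covec al -> gsec (pi_sharp Q al) by apply: gsec_sharp.
have sP Q al be : mvec 2 Q -> covec al -> covec be -> smoothM (pi_pair Q al be).
  exact: smooth_pi_pair.
apply: (@tensorial_zero _ _ _ _ _ _ R^o x (fun P => koszul_defect P alpha beta Y x))
  mP => {P}.
- move=> P Q mP mQ; rewrite /koszul_defect !pi_sharpD//.
  rewrite !(lbrDl T) ?secDE ?covecD//; try exact: gS.
  rewrite (gbDr G (mgr_of_sec Lam gY) (mgr_mvec mP) (mgr_mvec mQ)).
  rewrite pi_pairD//; try exact: mvec_sn_sec.
  have -> : pi_pair (P + Q)
    alpha beta = fun y => pi_pair P alpha beta y + pi_pair Q alpha beta y.
    by apply/funext => y; apply: pi_pairD.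
  by rewrite ancD//; [ring|apply: sP|apply: sP].
- move=> f P sf mP; rewrite /koszul_defect !pi_sharp_fscale//.
  rewrite !(lbr_fscalel T sf) ?secDE ?secNE ?fscaleE ?covecB//; try exact: gS.
  have -> : pi_pair (fscale f P) alpha beta = fun y => f y * pi_pair P alpha beta y.
    by apply/funext => y; apply: pi_pair_fscale.
  rewrite ancM//; last exact: sP.
  rewrite -wedge_fun (schouten_wedge H (mgr_of_sec Lam gY) (mgr_of_fun Lam sf)
    (mgr_mvec mP)).
  rewrite (sn_sec_fun H gY sf) addNr mul0r expr0z scale1r !wedge_fun.
  have saf := smooth_anc T gY sf.
  rewrite pi_pairD//; try by apply: mvec_fscale => //; apply: mvec_sn_sec.
  rewrite !pi_pair_fscale//; last exact: mvec_sn_sec.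
  rewrite -[anc (anchor T) Y f x *: pi_sharp P alpha x]addr0 -[anc (anchor T)
    Y f x *: pi_sharp P beta x]addr0.
  rewrite ca.1 cb.1 !(functional0 (covec_functional _))// !covec_sharp// (pi_pair_anti
    _ mP cb ca).
  by rewrite /GRing.scale /=; ring.
- move=> X Z gX gZ; rewrite /koszul_defect.
  have sE al X' : covec al -> gsec X' ->
    smoothM (fun y => al y (X' y)) by apply: smooth_covec.
  have SE al : covec al -> pi_sharp (wedge (of_sec Lam X) (of_sec Lam Z)) al =
      fscale (fun y => al y (X y)) Z - fscale (fun y => al y (Z y)) X.
    by move=> cal; apply: secP => y; rewrite /pi_sharp sharp_wedge//;
      apply: covec_functional.
  have LE al : covec al -> lbr T (pi_sharp (wedge (of_sec Lam X) (of_sec Lam Z)) al) Y x =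
      al x (X x) *: lbr T Z Y x - anc (anchor T) Y (fun y => al y (X y)) x *: Z x
      - (al x (Z x) *: lbr T X Y x - anc (anchor T) Y (fun y => al y (Z y)) x *: X x).
    move=> cal; have [s1 s2] := conj (sE _ _ cal gX) (sE _ _ cal gZ).
    rewrite SE// lbrDl//; try by apply: gsecN; apply: gsec_fscale.
      by rewrite lbrNl//; [rewrite !lbr_fscalel//|apply: gsec_fscale].
    exact: gsec_fscale.
  have PE : pi_pair (wedge (of_sec Lam X) (of_sec Lam Z)) alpha beta =
      fun y => alpha y (X y) * beta y (Z y) - alpha y (Z y) * beta y (X y).
    by apply/funext => y; rewrite /pi_pair pairing_wedge//; apply: covec_functional.
  rewrite !LE// PE ancB; try by apply: smooth_funM; [exact: openT|apply: sE|apply: sE].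
  rewrite !ancM; auto.
  rewrite (schouten_wedge H (mgr_of_sec Lam gY) (mgr_of_sec Lam gX) (mgr_of_sec Lam gZ)).
  rewrite addNr mul0r expr0z scale1r !(sn_sec_sec H)//.
  rewrite pi_pairD//; try by apply: (@mvec_wedge _ _ _ _ _ _ 1 1);
    apply: mvec_of_sec => //; apply: lbr_smooth.
  have [fa fb] := conj (covec_functional (x := x) ca) (covec_functional (x := x) cb).
  rewrite /pi_pair !pairing_wedge//.
  rewrite (lbr_anti T gY gX) (lbr_anti T gY gZ) !secNE.
  have E al (c1 c2 c3 c4 : R) u1 u2 u3 u4 : functional (al : A x -> R) ->
      al (c1 *: u1 - c2 *: u2 - (c3 *: u3 - c4 *: u4)) =
      c1 * al u1 - c2 * al u2 - (c3 * al u3 - c4 * al u4).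
    move=> fl; have B u v : al (u - v) = al u - al v.
      by have := functionalB 1 1 u v fl; rewrite !scale1r !mul1r.
    by rewrite B (functionalB c1 c2 u1 u2 fl) (functionalB c3 c4 u3 u4 fl).
  have EN al u : functional (al : A x -> R) -> al (- u) = - al u.
    by move=> fl; rewrite -scaleN1r (functionalZ _ _ fl) mulN1r.
  rewrite !E// !EN//; ring.
Qed.

(** Separates derivatives along the anchor from a single Schouten bracket; in the last
    Poisson-Nijenhuis condition the former will cancel. *)
Lemma koszulE P alpha beta Y x : mvec 2 P -> covec alpha -> covec beta -> gsec Y ->
  koszul (lbr T) (anchor T) P alpha beta Y x =
  anc (anchor T) (pi_sharp P alpha) (fun y => beta y (Y y)) x
  - anc (anchor T) (pi_sharp P beta) (fun y => alpha y (Y y)) x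
  + pi_pair (sn (of_sec Lam Y) P) alpha beta x.
Proof.
move=> mP ca cb gY; have := koszul_defect_eq0 x mP ca cb gY.
by rewrite /koszul_defect /koszul /lie_der; lra.
Qed.

(** Brackets of functions vanish, so [P, f] is function-linear in P and the formula need only be
    checked on products of two sections. *)
Lemma sn_bivec_fun P f x : mvec 2 P -> smoothM f ->
  sn P (of_fun Lam f) x = - ext_in (Lam x) (sharp (P x) (fun u => anchor T u f)).
Proof.
move=> mP sf; have fa y : functional (fun u : A y => anchor T u f).
  by have [_ Hl _] := anchorP T; move=> c u v; apply: Hl.
apply/eqP; rewrite -addr_eq0; apply/eqP.
pose F Q := sn Q (of_fun Lam f) x + ext_in (Lam x) (sharp (Q x) (fun u => anchor T u f)).
have mf := mgr_of_fun Lam sf.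
apply: (@tensorial_zero _ _ _ _ _ _ (Lam x) x F) mP => {P}.
- move=> P Q mP mQ; rewrite /F (gbDl G (mgr_mvec mP) (mgr_mvec mQ) mf) !msDE.
  have := sharpZD (x := x) 1 mP mQ (fa x); rewrite !scale1r => ->.
  by rewrite linearD /=; abel.
- move=> g P sg mP; rewrite /F fscaleE sharpZ//.
  have mg := mgr_of_fun Lam sg.
  have gP : mgr Lam 0 P := mgr_mvec mP.
  have gfP : mgr Lam 0 (fscale g P) := mgr_mvec (mvec_fscale sg mP).
  rewrite (gb_anti G gfP mf) (gb_anti G gP mf).
  rewrite -wedge_fun (schouten_wedge H mf mg gP) (sn_fun_fun H sf sg) wedge0l add0r.
  rewrite [RHS]scalerDr /=; congr (_ + _); last by rewrite linearZ.
  by signs; unsign; rewrite !opprK add0r wedge_fun fscaleE.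
- move=> X Y gX gY; rewrite /F.
  have mXY : mgr Lam 0 (wedge (of_sec Lam X) (of_sec Lam Y)).
    by apply: gb_cast (mgr_wedge (mgr_of_sec Lam gX) (mgr_of_sec Lam gY)) _.
  rewrite (gb_anti G mXY mf) (schouten_wedge H mf (mgr_of_sec Lam gX)
    (mgr_of_sec Lam gY)).
  rewrite !(sn_fun_sec H)// wedgeNl wedge_fun.
  have S (c d : R) (u v : A x) : ext_in (Lam x) (c *: u - d *: v) =
      c *: ext_in (Lam x) u - d *: ext_in (Lam x) v by rewrite linearB !linearZ.
  signs; unsign; rewrite sharp_wedge// S !msE fscaleE !msE /anc.
  by rewrite mulrN -scalerAr mulr1 ?scalerN; abel.
Qed.

End Koszul.

(** * The Poisson-Nijenhuis conditions as an identity between Schouten brackets *)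

Section Compatibility.
Variables (R : realType) (n : nat) (M : manifold R n).
Variables (r : nat) (A : vbundle M r) (T : lie_algebroid A).
Variables (Lam : forall x : M, exterior (A x)).
Variables (sn : multisec Lam -> multisec Lam -> multisec Lam) (pi : multisec Lam).
Variables (N : forall x : M, A x -> A x) (uN : forall x : M, Lam x -> Lam x).
Hypothesis H : is_schouten T sn.
Hypothesis PN : poisson_nijenhuis T sn pi N.
Hypothesis HU : is_underline N uN.
Local Notation U := (uapp uN).
Let G := schouten_graded H.

Let mpi : mvec 2 pi. Proof. by case: PN. Qed.
Let HN : nijenhuis T N. Proof. by case: PN. Qed.
Let gpi : mgr Lam 0 pi := mgr_mvec mpi.
Let mUpi : mvec 2 (U pi). Proof. exact: mvec_uapp HN.1 HU _ _ mpi. Qed.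
Let gUpi : mgr Lam 0 (U pi) := mgr_mvec mUpi.
Let Ulin : forall (c : R) P Q, U (c *: P + Q) = c *: U P + U Q.
Proof. exact: uapp_linear HU. Qed.

Definition uapp_pairs (x : M) (s : seq (A x * A x)) : seq (A x * A x) :=
  [seq (N u.1, u.2) | u <- s] ++ [seq (u.1, N u.2) | u <- s].

Lemma uN_bivec x (s : seq (A x * A x)) : uN (bivec (Lam x) s) = bivec (Lam x)
  (uapp_pairs s).
Proof.
have := uN_sum HU s (fun=> 1) (fun u => ext_in (Lam x) u.1 * ext_in (Lam x) u.2).
rewrite (eq_bigr (fun u => ext_in (Lam x) u.1 * ext_in (Lam x) u.2)) => [E|u _];
  last by rewrite scale1r.
rewrite /bivec E big_cat !big_map /= -!big_split; apply: eq_bigr => u _ /=.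
have /= := uN_prod HU [:: u.1] [:: u.2]; rewrite !big_seq1 scale1r => ->.
have [_ _ Hs] := HU x.
have U1 v : uN (ext_in (Lam x) v) = ext_in (Lam x) (N v).
  by have := Hs [:: v];
    rewrite big_seq1 big_ord_recl big_ord0 addr0 big_ord_recl big_ord0 mulr1.
by rewrite !U1.
Qed.

Lemma functional_comp x (a : A x -> R) : functional a -> functional (fun u => a (N u)).
Proof. by move=> fa c u v; rewrite HN.1.1 fa. Qed.

Lemma pairing_uapp P x (a b : A x -> R) : mvec 2 P -> functional a -> functional b ->
  pairing2 (U P x) a b =
  pairing2 (P x) (fun u => a (N u)) b + pairing2 (P x) a (fun u => b (N u)).
Proof.
move=> mP fa fb; have [s Ps] := mvec2_bivec x mP.
have [fa' fb'] := conj (functional_comp fa) (functional_comp fb).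
rewrite /uapp Ps uN_bivec !pairing2E// /pair_seq big_cat !big_map.
have S (F F' : A x * A x -> R) :
  \sum_(u <- s) F u + \sum_(u <- s) F' u = \sum_(u <- s) (F u + F' u)
    by rewrite big_split.
rewrite /= !S; by apply: eq_bigr => u _ /=; ring.
Qed.

Lemma sharp_transpose x (a : A x -> R) : functional a ->
  N (sharp (pi x) a) = sharp (pi x) (fun u => a (N u)).
Proof.
move=> fa; have [al cal Ea] := covec_extend fa.
have [_ _ _ /(_ al cal) Hs _] := PN.
by have := congr1 (fun X : section A => X x) Hs; rewrite /tapp /pi_sharp /transpose Ea.
Qed.

(** U acts on both factors of a bivector. One contribution is N applied to the sharp of a, the other
    the sharp of the transposed functional, and [sharp_transpose] identifies them. *)
Lemma sharp_uapp x (a : A x -> R) : functional a ->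
  sharp (U pi x) a = N (sharp (pi x) a) *+ 2.
Proof.
move=> fa; have [s Ps] := mvec2_bivec x mpi; have fa' := functional_comp fa.
have sp := @fib_separating _ _ _ _ A x.
rewrite mulr2n {2}sharp_transpose// /uapp Ps uN_bivec !sharpE// /sharp_seq.
have Nl := HN.1.1 x.
have N0 : N (0 : A x) = 0.
  have := Nl 1 0 0; rewrite !scale1r addr0; exact: add_idem0.
have NB c d (u v : A x) : N (c *: u - d *: v) = c *: N u - d *: N v.
  by rewrite Nl -scaleNr -[_ *: v]addr0 Nl N0 addr0 scaleNr.
have ND (u v : A x) : N (u + v) = N u + N v by have := Nl 1 u v; rewrite !scale1r.
have S (F F' : A x * A x -> A x) :
  \sum_(u <- s) F u + \sum_(u <- s) F' u = \sum_(u <- s) (F u + F' u)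
    by rewrite big_split.
rewrite (big_morph (@N x) ND N0) big_cat !big_map /= !S; apply: eq_bigr => u _ /=.
by rewrite NB; abel.
Qed.

Lemma compatible_fun f : smoothM f ->
  sn (U pi) (of_fun Lam f) = U (sn pi (of_fun Lam f)) *+ 2.
Proof.
move=> sf; apply: msP => x.
have fa : functional (fun u : A x => anchor T u f).
  by have [_ Hl _] := anchorP T; move=> c u v; apply: Hl.
have U1 v : uN (- ext_in (Lam x) v) = - ext_in (Lam x) (N v).
  have [Hl _ Hs] := HU x; have := Hs [:: v].
  rewrite big_seq1 big_ord_recl big_ord0 addr0 big_ord_recl big_ord0 mulr1 /= => <-.
  by have := defNN (N := @uN x) (Hl : forall (c : R) u v, _); exact.
rewrite (sn_bivec_fun H x mUpi sf) sharp_uapp// (mulr2n (U _)) msDE /uapp.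
by rewrite (sn_bivec_fun H x mpi sf) U1 mulr2n linearD opprD.
Qed.

(** After [koszulE] the anchor terms on the two sides of the last Poisson-Nijenhuis condition agree,
    since the sharp map intertwines N with its transpose. What remains is U [Y, pi] - [N Y, pi] =
    [Y, pi]_N, and expanding the right side gives the claim. *)
Lemma compatible_sec Y : gsec Y ->
  sn (U pi) (of_sec Lam Y) =
  (U (sn pi (of_sec Lam Y)) - sn pi (U (of_sec Lam Y))) *+ 2.
Proof.
move=> gY; have gNY := gsec_tapp HN.1 gY; rewrite (uapp_sec HU).
have [mY mNY] := conj (mgr_of_sec Lam gY) (mgr_of_sec Lam gNY).
have swap P Z : mgr Lam 0 P -> gsec Z -> sn P (of_sec Lam Z) = - sn (of_sec Lam Z) P.
  by move=> gP gZ; rewrite (gb_anti G gP (mgr_of_sec Lam gZ)); signs; unsign.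
rewrite !swap//.
have UN P : U (- P) = - U P by apply: defNN Ulin _.
have m1 := mvec_sn_sec H mpi gY; have m2 := mvec_sn_sec H mpi gNY.
have m3 := mvec_sn_sec H mUpi gY; have m4 := mvec_uapp HN.1 HU m1.
have K := deformed_schouten H HN HU.
have mY' : mvec 2 (deform U sn (of_sec Lam Y) pi) := mvec_sn_sec K mpi gY.
(* Stated as the vanishing of a bivector, so that it can be tested on pairs of 1-forms. *)
suff Z0 : U (sn (of_sec Lam Y) pi) - sn (of_sec Lam (tapp N Y)) pi
    - deform U sn (of_sec Lam Y) pi = 0.
  move: Z0; rewrite UN /deform (uapp_sec HU) => Z0; apply/eqP; rewrite -subr_eq0;
    apply/eqP.
  by rewrite -[RHS]Z0; abel.
apply: mvec2_eq0; first by apply: mvecB => //; apply: mvecB.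
move=> al be x ca cb.
have [fa fb] := conj (covec_functional (x := x) ca) (covec_functional (x := x) cb).
have B (P Q : multisec Lam) : mvec 2 P -> mvec 2 Q ->
  pi_pair (P - Q) al be x = pi_pair P al be x - pi_pair Q al be x.
  move=> mP mQ; rewrite pi_pairD//; last exact: mvecN.
  by rewrite -scaleN1r pi_pairZ// mulN1r.
have [cNa cNb] := conj (covec_transpose HN.1 ca) (covec_transpose HN.1 cb).
rewrite (B _ _ (mvecB m4 m2) mY') (B _ _ m4 m2).
have [_ _ _ Hs Hk] := PN.
have /(congr1 (fun f => f x)) := Hk al be Y ca cb gY.
rewrite /def_koszul !(koszulE H)//.
have := koszulE K x mpi ca cb gY => /= ->.
have PU := pairing_uapp m1 fa fb.
rewrite /anc /def_anchor.
have tE a : covec a -> N (pi_sharp pi a x) = pi_sharp pi (transpose N a) x.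
  by move=> ca'; have := congr1 (fun X : section A => X x) (Hs a ca').
by rewrite (tE al ca) (tE be cb) /pi_pair PU /transpose /tapp; lra.
Qed.

Lemma compatible d P : mgr Lam d P ->
  sn (U pi) P = (U (sn pi P) - sn pi (U P)) *+ 2.
Proof.
move=> /mgr_single[p mP _].
have gU k Q : mgr Lam k Q -> mgr Lam k (U Q) by apply: mgr_uapp HN.1 HU _ _.
have UW P1 P2 k1 k2 : mgr Lam k1 P1 -> mgr Lam k2 P2 ->
    U (wedge P1 P2) = wedge (U P1) P2 + wedge P1 (U P2).
  by move=> /mgr_single[m1 M1 _] /mgr_single[m2 M2 _]; exact: (uapp_wedge HU M1 M2).
have UZ c Q : U (c *: Q) = c *: U Q := defNZ Ulin c Q.
have UD Q Q' : U (Q + Q') = U Q + U Q' := defND Ulin Q Q'.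
pose D Q := sn (U pi) Q - (U (sn pi Q) - sn pi (U Q)) *+ 2.
suff : D P = 0 by move=> /eqP; rewrite subr_eq0 => /eqP.
apply: (@derivation_zero _ _ _ _ _ _ D 1 _ _ _ _ p P mP) => {P p mP}.
- move=> p c P Q /mgr_mvec gP /mgr_mvec gQ; rewrite /D Ulin.
  rewrite (gb_linr G _ gUpi gP gQ) (gb_linr G _ gpi gP gQ) (gb_linr G _ gpi (gU _ _ gP)
    (gU _ _ gQ)).
  by rewrite Ulin !mulr2n !(scalerDr, scalerN); abel.
- move=> p q P Q /mgr_mvec gP /mgr_mvec gQ; rewrite /D.
  have [gUP gUQ] := conj (gU _ _ gP) (gU _ _ gQ).
  have [sP sQ] := conj (gb_br G gpi gP) (gb_br G gpi gQ).
  have -> : p%:Z * 1 = (0 + 1) * (p%:Z - 2) + 2 by lia.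
  have -> : (-1 : R) ^ ((0 + 1) * (p%:Z - 2) + 2) = (-1) ^ ((0 + 1) * (p%:Z - 2)).
    by rewrite !expN1E (oddzD _ 2) addbF.
  rewrite (UW _ _ _ _ gP gQ) (gbDr G gpi (mgr_wedge gUP gQ) (mgr_wedge gP gUQ)).
  rewrite (schouten_wedge H gUpi gP gQ) (schouten_wedge H gpi gP gQ).
  rewrite (schouten_wedge H gpi gUP gQ) (schouten_wedge H gpi gP gUQ).
  rewrite UD UZ (UW _ _ _ _ sP gQ) (UW _ _ _ _ gP sQ).
  rewrite !mulr2n !(wedgeDl, wedgeDr, wedgeNl, wedgeNr, wedgeZl, wedgeZr).
  by rewrite !(scalerDr, scalerN); abel.
- move=> f sf; rewrite /D compatible_fun// (uapp_fun HU) (gb0r G gpi) subr0 subrr//.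
- by move=> Y gY; rewrite /D compatible_sec// subrr.
Qed.

End Compatibility.

Theorem proposition7p9 (R : realType) (n : nat) (M : manifold R n)
    (r : nat) (A : vbundle M r) (T : lie_algebroid A)
    (Lam : forall x : M, exterior (A x))
    (sn : multisec Lam -> multisec Lam -> multisec Lam)
    (sn_schouten : is_schouten T sn)
    (pi : multisec Lam) (N : forall x : M, A x -> A x)
    (PN : poisson_nijenhuis T sn pi N)
    (uN : forall x : M, Lam x -> Lam x)
    (uN_underline : is_underline N uN) :
  let nu := vform_add (l1 sn pi) (l2 sn) in
  let NN := vform_add (underline_form uN) (vform0 0 pi) in
  [/\ is_dgla (mgr Lam) nu /\ wedge_multiplicative nu,
      weak_nijenhuis (mgr Lam) NN nu
    & curvature NN = pi].
Proof.
move=> nu NN; have [mpi HN pi2 _ _] := PN.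
have G := schouten_graded sn_schouten.
have gpi : mgr Lam 0 pi := mgr_mvec mpi.
have jac d e f x y z := schouten_jacobi sn_schouten (d := d) (e := e) (k := f) (P := x)
  (Q := y) (S := z).
have Ulin := uapp_linear uN_underline.
have Ugr d P : mgr Lam d P ->
  mgr Lam d (uapp uN P) by apply: mgr_uapp HN.1 uN_underline _ _.
have jacN d e f x y z := schouten_jacobi (deformed_schouten sn_schouten HN
  uN_underline) (d := d) (e := e) (k := f) (P := x) (Q := y) (S := z).
(* The forms of the statement are convertible to those studied for an abstract graded bracket. *)
have nuE : nu = unary_binary (sn pi) sn by [].
have NNE : NN = curved_form (uapp uN) pi by [].
have nuV : is_vform (mgr Lam) nu := unary_binary_vform G gpi.
split.
- split.
    split=> //; first by case=> [|u [|v [|w s]]] //= _ _ _; rewrite addr0.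
    exact: (unary_binary_sq0 G jac gpi pi2).
  move=> s q q' Q Q' hs mQ mQ'.
  have [gQ gQ'] := conj (mgr_mvec mQ) (mgr_mvec mQ').
  case: s hs => [|[d P] [|[e P'] s]] /= hs.
  + rewrite !addr0 /totdeg big_nil addr0 mulr1.
    rewrite (schouten_wedge sn_schouten gpi gQ gQ'); congr (_ + _ *: _).
    by rewrite !expN1E !oddzM (oddzD _ (- 2)) !oddzN addbF.
  + rewrite !add0r /totdeg big_seq1 /=; case: hs => gP _.
    rewrite (schouten_wedge sn_schouten gP gQ gQ') scalerDr wedgeZl wedgeZr !scalerA.
    congr (_ + _ *: _); rewrite mulrC; congr (_ * _).
    by rewrite !expN1E !oddzM (oddzD _ (- 2)) !oddzN addbF andbC addrC.
  + by case: s {hs} => [|u s] /=; rewrite !addr0 wedge0l wedge0r scaler0 addr0.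
- split=> //.
    split=> //; rewrite NNE.
    exact: (curved_vform G Ulin Ugr gpi).
  rewrite nuE NNE.
  exact: (curved_weak_nijenhuis G Ulin Ugr jac jacN gpi pi2 (compatible sn_schouten PN
    uN_underline)).
- by rewrite /curvature /= add0r.
Qed.
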